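(* Let $N\in\mathbb{N}$, let $X$ be a Banach space, and let $A\in\mathcal{W}$ be an operator in the Wiener algebra over $\mathbb{Z}^N$ and $X$. Then $A$ is Fredholm on one of the spaces $l^p=l^p(\mathbb{Z}^N,X)$, $p\in\{0\}\cup[1,\infty]$, if and only if $A$ is Fredholm on all the spaces $l^p$, $p\in\{0\}\cup[1,\infty]$. In this case the Fredholm index of $A$ is the same on all these spaces.
   Context: For $1\le p<\infty$, $l^p=l^p(\mathbb{Z}^N,X)$ is the Banach space of all $x=(x_i)_{i\in\mathbb{Z}^N}$, $x_i\in X$, with $\|x\|_p=(\sum_i\|x_i\|^p)^{1/p}<\infty$; $l^\infty$ is the space of bounded sequences with the supremum norm; $l^0$ is the closed subspace of $l^\infty$ of sequences with $\|x_i\|\to0$ as $|i|\to\infty$. Each $a=(a_i)\in l^\infty(\mathbb{Z}^N,\mathcal{L}(X))$ (bounded family of bounded linear operators on $X$) defines the multiplication operator $aI:(x_i)\mapsto(a_ix_i)$; for $\alpha\in\mathbb{Z}^N$ the shift is $V_\alpha:(x_i)\mapsto(x_{i-\alpha})$. A band operator is a finite sum $\sum_\alpha a_\alpha V_\alpha$ with $a_\alpha\in l^\infty(\mathbb{Z}^N,\mathcal{L}(X))$; put $\|\sum_\alpha a_\alpha V_\alpha\|_{\mathcal W}:=\sum_\alpha\|a_\alpha\|_\infty$. The Wiener algebra $\mathcal{W}$ is the closure of the set of band operators with respect to $\|\cdot\|_{\mathcal W}$, i.e. the set of all $\sum_{\alpha\in\mathbb{Z}^N}a_\alpha V_\alpha$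 with $\sum_\alpha\|a_\alpha\|_\infty<\infty$. Each element of $\mathcal{W}$ acts as a bounded linear operator on every $l^p$, $p\in\{0\}\cup[1,\infty]$. Fredholm means that kernel and cokernel are finite-dimensional; the index is $\dim\ker A-\dim\operatorname{coker}A$. *)

(* Defs.v *)
From HB Require Import structures.
From mathcomp Require Import all_boot all_order all_algebra finmap.
From mathcomp Require Import all_classical all_reals all_analysis.
From mathcomp Require Import complex.

Set Implicit Arguments.
Unset Strict Implicit.
Unset Printing Implicit Defensive.

Import Order.TTheory GRing.Theory Num.Theory.
Import numFieldNormedType.Exports.

Local Open Scope classical_set_scope.
Local Open Scope ring_scope.

(* [scalars R K] says that K is the field of real or of complex numbers. The
   norm of a [normedModType K] takes its values in K, hence [modulus], which
   reads a norm as a real number. *)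
Variant scalars (R : realType) : numFieldType -> Type :=
| RealScalars : scalars R R
| ComplexScalars : scalars R R[i].

Definition modulus (R : realType) (K : numFieldType) (sc : scalars R K) :
    K -> R :=
  match sc with
  | RealScalars => fun r => r
  | ComplexScalars => fun z => complex.Re z
  end.

Definition rnorm (R : realType) (K : numFieldType) (sc : scalars R K)
  (X : normedModType K) (x : X) : R := modulus sc `|x|.

Section QuotientDimension.
Variables (K : fieldType) (V : lmodType K).
Implicit Types E F : set V.

(* [quotient_dim E F n] : dim (E / F) = n, for subspaces F `<=` E of V. The b_j
   are representatives of a basis of E / F. *)
Definition quotient_dim E F (n : nat) : Prop :=
  exists2 b : 'I_n -> V, (forall j, E (b j)) &
    forall x, E x ->
      exists! c : 'rV[K]_n, F (x - \sum_(j < n) c ord0 j *: b j).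

Definition finite_dim E F : Prop := exists n, quotient_dim E F n.

(* 0 if E / F is infinite-dimensional *)
Definition dimq E F : nat := xget 0%N (quotient_dim E F).

End QuotientDimension.

Section UnorderedSum.
Variables (I : choiceType) (K : numFieldType) (X : completeNormedModType K).

Definition finite_subsets : set_system {fset I} :=
  filter_from setT (fun A => [set B | (A `<=` B)%fset]).

#[global] Instance finite_subsets_filter : ProperFilter finite_subsets.
Proof.
apply: filter_from_proper; last by move=> A _; exists A => /=.
apply: filter_from_filter; first by exists fset0.
move=> A B _ _; exists (A `|` B)%fset => // C /=.
by rewrite fsubUset => /andP[].
Qed.

Definition usum (f : I -> X) : X :=
  lim ((fun A : {fset I} => \sum_(i <- A) f i) @ finite_subsets).

End UnorderedSum.

Section SequenceSpaces.
Variables (R : realType) (K : numFieldType) (sc : scalars R K).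
Variables (N : nat) (X : completeNormedModType K).

Local Notation ZN := 'rV[int]_N.

Definition zabs (i : ZN) : nat := (\max_(k < N) absz (i ord0 k))%N.

Definition lpnorm (p : \bar R) (x : ZN -> X) : \bar R :=
  match p with
  | r%:E => ((\esum_(i in [set: ZN]) (rnorm sc (x i) `^ r)%:E) `^ r^-1)%E
  | +oo%E => ereal_sup [set (rnorm sc (x i))%:E | i in [set: ZN]]
  | -oo%E => 0%E
  end.

Definition vanishes_at_infinity (x : ZN -> X) : Prop :=
  forall e : R, 0 < e ->
    exists m : nat, forall i, (m <= zabs i)%N -> rnorm sc (x i) < e.

Definition exponent (p : \bar R) : Prop := p = 0%E \/ (1 <= p)%E.

(* p = 0 stands for the closed subspace of null sequences in l^oo. *)
Definition lp (p : \bar R) : set (ZN -> X) :=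
  if p == 0%E then
    [set x | (lpnorm +oo%E x < +oo)%E /\ vanishes_at_infinity x]
  else [set x | (lpnorm p x < +oo)%E].

(* +oo if T is unbounded *)
Definition opnorm (T : {linear X -> X}) : \bar R :=
  ereal_sup [set (rnorm sc (T x))%:E | x in [set x | rnorm sc x <= 1]].

(* [a alpha i] is the i-th entry of the coefficient of the shift V_alpha. *)
Definition wnorm (a : ZN -> ZN -> {linear X -> X}) : \bar R :=
  (\esum_(alpha in [set: ZN]) ereal_sup (range (fun i => opnorm (a alpha i))))%E.

Record wiener := Wiener {
  coef : ZN -> ZN -> {linear X -> X};
  wnorm_coef : (wnorm coef < +oo)%E }.

(* The sum converges absolutely for every bounded x, hence on every l^p. *)
Definition wiener_op (A : wiener) (x : ZN -> X) : ZN -> X :=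
  fun i => usum (fun alpha => coef A alpha i (x (i - alpha))).

Definition lp_ker (A : wiener) (p : \bar R) : set (ZN -> X) :=
  [set x | lp p x /\ wiener_op A x = 0].

Definition lp_range (A : wiener) (p : \bar R) : set (ZN -> X) :=
  wiener_op A @` lp p.

Definition fredholm (A : wiener) (p : \bar R) : Prop :=
  finite_dim (lp_ker A p) [set 0] /\ finite_dim (lp p) (lp_range A p).

Definition fredholm_index (A : wiener) (p : \bar R) : int :=
  (dimq (lp_ker A p) [set 0])%:Z - (dimq (lp p) (lp_range A p))%:Z.

End SequenceSpaces.

(* Main.v *)
(** Write |x| for the scalar sequence of the norms of the entries of x.

    A Fredholm operator on l^p satisfies |z|_p <= C |A z|_p for finitely
    supported z vanishing on a large ball. Sjöstrand's localization argument
    turns this into a pointwise bound that does not mention p: with tent-shaped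
    cutoffs chi_k of width h, the commutator [A, chi_k] is small relative to h,
    so the local norms b_k = |chi_k x|_p satisfy b <= g + kappa * b with a kernel
    kappa of mass at most 1/2, and a Neumann series yields a summable H with
      |x| <= H * (|A x| + 1_ball |x|)      for every bounded x.
    Hence A x in l^q forces x in l^q: the kernel of A is the same on all spaces,
    and the range in l^q is l^q intersected with the range in l^oo. In particular
    l^1 / A l^1 embeds in l^p / A l^p, so A is Fredholm on l^1.

    It remains to solve A x + sum_j c_j b_j = f in l^q when the b_j represent a
    basis of l^1 / A l^1. For f supported at the site j this is done in l^1, and
    cutting off a solution, solving again and subtracting an element of the
    kernel makes its part near the origin, and c, of size G(j) |f(j)| with G
    summable. By the pointwise bound these solutions are then summable over j
    for every bounded f, and what remains of f lies in l^1. *)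
Require Import Defs.
From HB Require Import structures.
From mathcomp Require Import all_boot all_order all_algebra finmap.
From mathcomp Require Import all_classical all_reals all_analysis.
From mathcomp Require Import complex.
From mathcomp Require Import zify ring lra.

Set Implicit Arguments.
Unset Strict Implicit.
Unset Printing Implicit Defensive.

Import Order.TTheory GRing.Theory Num.Theory.
Import numFieldNormedType.Exports.

Local Open Scope classical_set_scope.
Local Open Scope ring_scope.

(** * Nonnegative sums and Minkowski's inequality *)

(** Since [X] is arbitrary, truncation to finitely many sites is not compact, and finitely supported
    sequences are not dense in l^oo; compactness, duality and approximation by finite supports are
    therefore avoided. Estimates are reduced to convolution inequalities for functions with values
    in [[0, +oo]], which read the same for all exponents. The space l^1 is the hub because it lies
    in every l^q and permits summation site by site. The embedding of cokernels only bounds the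
    dimension on l^1; equality needs solvability in each l^q. Superposing solutions for single sites
    requires near parts and coefficients that are summable over the sites, whereas the open mapping
    theorem bounds them only by a constant times [|f j|]. The decay comes from a wide cutoff with a
    plateau: it trades a bound [t] for [s + t / 2], where [s] is a summably weighted size of [f],
    and iteration approaches the fixed point [2 * s]. *)

Section NonnegativeSums.
Local Open Scope ereal_scope.
Variable R : realType.

Section OneIndex.
Variable T : choiceType.
Implicit Types (a b : T -> \bar R) (A : {fset T}).

Lemma fset_le_esum a A : (\sum_(i <- A) a i)%E <= \esum_(i in [set: T]) a i.
Proof.
apply: esum_ge; exists [set` A] => //.
by rewrite fsbig_finite// set_fsetK.
Qed.

Lemma uniq_seq_le_esum a (s : seq T) : uniq s ->
  \sum_(i <- s) a i <= \esum_(i in [set: T]) a i.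
Proof.
move=> us; apply: esum_ge; exists [set` s]; last by rewrite -fsbig_seq.
by split => //; exact: finite_seq.
Qed.

Lemma ge_esum a x : (forall A, \sum_(i <- A) a i <= x) ->
  \esum_(i in [set: T]) a i <= x.
Proof.
move=> h; apply: ge_ereal_sup => /= _ [X [finX _]] <-.
by rewrite fsbig_finite.
Qed.

Lemma le_term_esum a t : (forall i, 0 <= a i) ->
  a t <= \esum_(i in [set: T]) a i.
Proof.
by move=> a0; apply: le_trans (fset_le_esum a [fset t]%fset); rewrite big_seq_fset1.
Qed.

Lemma esumZl a c : 0 <= c -> (forall i, 0 <= a i) ->
  \esum_(i in [set: T]) (c * a i) = c * \esum_(i in [set: T]) a i.
Proof.
move=> c0 a0; have s0 : 0 <= \esum_(i in [set: T]) a i by exact: esum_ge0.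
have [->|cn0] := eqVneq c 0.
  by rewrite mul0e; apply: esum1 => i _; rewrite mul0e.
have cgt0 : 0 < c by rewrite lt0e cn0.
apply/eqP; rewrite eq_le; apply/andP; split.
  apply: ge_esum => A; rewrite -ge0_sume_distrr//.
  by apply: lee_wpmul2l => //; exact: fset_le_esum.
move: c0 cn0 cgt0; case: c => [c| |]//; rewrite ?leNye ?lee_fin ?lte_fin //.
  move=> c0 cn0 cgt0; rewrite muleC -lee_pdivlMr//.
  apply: ge_esum => A; rewrite lee_pdivlMr// muleC ge0_sume_distrr//.
  exact: (fset_le_esum (fun i => c%:E * a i)).
move=> _ _ _; have [s00|sn0] := eqVneq (\esum_(i in [set: T]) a i) 0.
  by rewrite s00 mule0; apply: esum_ge0 => i _; exact: mule_ge0.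
(* For infinite [c], one positive term already makes both sides infinite. *)
have [t at0] : exists t, 0 < a t.
  apply: contrapT => /forallNP h; move/eqP: sn0; apply; apply: esum1 => i _.
  by apply/eqP; rewrite eq_le a0 andbT leNgt; apply/negP; exact: h.
rewrite gt0_mulye ?lt0e ?sn0//.
have := @le_term_esum (fun i => +oo * a i) t (fun i => mule_ge0 (leey _) (a0 i)).
by rewrite gt0_mulye.
Qed.

Lemma esumZr a c : 0 <= c -> (forall i, 0 <= a i) ->
  \esum_(i in [set: T]) (a i * c) = (\esum_(i in [set: T]) a i) * c.
Proof.
move=> c0 a0; rewrite muleC -esumZl//.
by apply: eq_esum => i _; rewrite muleC.
Qed.

Lemma esum_dirac a t : (forall i, i != t -> a i = 0) -> 0 <= a t ->
  \esum_(i in [set: T]) a i = a t.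
Proof.
move=> a0 at0; rewrite -(esum_set1 at0) [RHS]esum_mkcond.
apply: eq_esum => i _; case: ifPn => //; rewrite notin_setE /= => /eqP.
exact: a0.
Qed.

Lemma esum_fset_mem a A : (forall i, 0 <= a i) ->
  \esum_(i in [set: T]) (if i \in A then a i else 0) = \sum_(i <- A) a i.
Proof.
move=> a0; rewrite -[in RHS](set_fsetK A) -fsbig_finite// -esum_fset//.
by rewrite [RHS]esum_mkcond; apply: eq_esum => i _; rewrite mem_setE.
Qed.

Lemma esum_split A a : (forall i, 0 <= a i) ->
  \esum_(i in [set: T]) a i =
  \sum_(i <- A) a i + \esum_(i in [set: T]) (if i \in A then 0 else a i).
Proof.
move=> a0; rewrite -esum_fset_mem// -esumD//; try by move=> i _; case: ifP.
by apply: eq_esum => i _; case: ifP; rewrite ?adde0 ?add0e.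
Qed.

Lemma esum_tail a (e : R) : (forall i, 0 <= a i) ->
  \esum_(i in [set: T]) a i < +oo -> (0 < e)%R ->
  exists A, forall B, (A `<=` B)%fset ->
    \esum_(i in [set: T]) (if i \in B then 0 else a i) <= e%:E.
Proof.
move=> a0 afin e0.
have sfin : \esum_(i in [set: T]) a i \is a fin_num.
  by rewrite ge0_fin_numE//; exact: esum_ge0.
have [_ [X [finX _] <-]] := ub_ereal_sup_adherent e0 sfin.
rewrite -/(esum _ _) fsbig_finite//= => h; exists (fset_set X) => B XB.
apply: (@le_trans _ _
    (\esum_(i in [set: T]) (if i \in fset_set X then 0 else a i))).
  apply: le_esum => i _; case: ifPn => iB; case: ifPn => // iX.
  by rewrite (fsubsetP XB) in iB.
move: h sfin; rewrite (esum_split (fset_set X))//.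
set s := \sum_(i <- _) _; set t := \esum_(i in _) _ => h.
have s0 : 0 <= s by apply: sume_ge0.
have t0 : 0 <= t by apply: esum_ge0 => i _; case: ifP.
move: s t s0 t0 h => [s| |] [t| |]//= _ _.
by rewrite !lte_fin lee_fin => h _; lra.
Qed.

End OneIndex.

Lemma esum_exchange (I J : choiceType) (a : I -> J -> \bar R) :
  (forall i j, 0 <= a i j) ->
  \esum_(i in [set: I]) \esum_(j in [set: J]) a i j =
  \esum_(j in [set: J]) \esum_(i in [set: I]) a i j.
Proof.
move=> a0; rewrite (esum_esum (J := fun=> [set: J]))//.
rewrite (esum_esum (J := fun=> [set: I]))//.
rewrite (@reindex_esum _ _ _ ([set: J] `*`` (fun=> [set: I])) _
  (fun k => (k.2, k.1)))//.
by split => // [[i j] [i' j']|[i j] _] /=; [move=> _ _ [-> ->]|exists (j, i)].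
Qed.

Lemma reindex_esumT (I J : choiceType) (e : I -> J) (a : J -> \bar R) :
  bijective e ->
  \esum_(j in [set: J]) a j = \esum_(i in [set: I]) a (e i).
Proof.
case=> f fe ef; apply: reindex_esum; split => // [i j _ _|j _].
  exact: (can_inj fe).
by exists (f j).
Qed.

End NonnegativeSums.

(** * Convexity of powers with free weights *)

Section Jensen.
Variable R : realType.
Implicit Types (x y M N r : R).

(** Convexity of the power [r] with weights [M / (M + N)] and [N / (M + N)], at the points
    [(M + N) * x / M] and [(M + N) * y / N], whose weighted mean is [x + y]. *)
Lemma powR_add_le x y M N r : 1 <= r -> 0 <= x -> 0 <= y -> 0 < M -> 0 < N ->
  (x + y) `^ r <=
  (M + N) `^ (r - 1) * (M `^ (1 - r) * x `^ r + N `^ (1 - r) * y `^ r).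
Proof.
move=> r1 x0 y0 M0 N0; have MN0 : 0 < M + N by exact: addr_gt0.
have t01 : 0 <= M / (M + N) <= 1.
  by rewrite ler_pdivrMr// mul1r lerDl (ltW N0) divr_ge0// ltW.
pose t : {i01 R} := Itv01 (proj1 (andP t01)) (proj2 (andP t01)).
have := @convex_powR R r r1 t ((M + N) * x / M) ((M + N) * y / N).
rewrite !inE /= !in_itv /= !andbT !divr_ge0 ?mulr_ge0 ?(ltW MN0) ?(ltW M0) ?(ltW N0)//.
move=> /(_ isT isT) h.
have {}h : (M / (M + N) * ((M + N) * x / M)
      + (1 - M / (M + N)) * ((M + N) * y / N)) `^ r <=
    M / (M + N) * ((M + N) * x / M) `^ r
      + (1 - M / (M + N)) * ((M + N) * y / N) `^ r := h.
have e (A z : R) : 0 < A -> 0 <= z -> A / (M + N) * ((M + N) * z / A) `^ r =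
    (M + N) `^ (r - 1) * (A `^ (1 - r) * z `^ r).
  move=> A0 z0; have MNz : 0 <= (M + N) * z by rewrite mulr_ge0// ltW.
  rewrite powRM ?invr_ge0 ?(ltW A0)// powRM ?(ltW MN0)//.
  rewrite -(powR_inv1 (ltW A0)) -powRrM mulN1r powRN.
  have -> : (M + N) `^ (r - 1) = (M + N) `^ r / (M + N).
    by rewrite powRB ?(gt_eqF MN0) ?implybT// powRr1// ltW.
  have -> : A `^ (1 - r) = A / A `^ r.
    by rewrite powRB ?(gt_eqF A0) ?implybT// powRr1// ltW.
  by field; rewrite ?gt_eqF ?powR_gt0.
have NE : 1 - M / (M + N) = N / (M + N) by field; rewrite gt_eqF.
move: h; rewrite NE !e// -mulrDr => h; apply: le_trans h.
rewrite le_eqVlt; apply/orP; left; apply/eqP; congr (_ `^ _).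
by field; rewrite ?gt_eqF.
Qed.

(** The weights stay free until [nu_esum] sets them to the norms of the summands; this takes the
    place of Hölder's inequality in the proof of Minkowski's. *)
Lemma powR_sum_le (I : Type) (s : seq I) (u n : I -> R) r : 1 <= r ->
  (forall i, 0 <= u i) -> (forall i, 0 < n i) ->
  (\sum_(i <- s) u i) `^ r <=
  (\sum_(i <- s) n i) `^ (r - 1) * \sum_(i <- s) n i `^ (1 - r) * u i `^ r.
Proof.
move=> r1 u0 n0; elim: s => [|i s IH].
  by rewrite !big_nil powR0 ?mulr0// gt_eqF// (lt_le_trans _ r1).
(* A singleton is treated apart: the two-term bound needs a positive total weight for the rest of
   the list. *)
case: s IH => [|j s] IH.
  rewrite !big_cons !big_nil !addr0 mulrA -powRD ?(gt_eqF (n0 i)) ?implybT//.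
  by rewrite (_ : _ + _ = 0) ?powRr0 ?mul1r//; ring.
move: IH; move js : (j :: s) => s' IH; rewrite !big_cons.
set U := \sum_(_ <- _) u _ in IH *; set M := \sum_(_ <- _) n _ in IH *.
have M0 : 0 < M.
  by rewrite /M -js big_cons ltr_wpDr// sumr_ge0// => k _; exact: ltW.
apply: le_trans (powR_add_le r1 (u0 i) (sumr_ge0 _ (fun k _ => u0 k)) (n0 i) M0) _.
rewrite ler_wpM2l ?powR_ge0// lerD2l.
apply: le_trans (ler_wpM2l (powR_ge0 _ _) IH) _.
rewrite mulrA -powRD ?(gt_eqF M0) ?implybT//.
by rewrite (_ : 1 - r + (r - 1) = 0) ?powRr0 ?mul1r//; ring.
Qed.

End Jensen.

Section Exponents.
Local Open Scope ereal_scope.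
Variable R : realType.
Implicit Types (p x y : \bar R) (r : R).

Lemma le_poweR r x y : (0 <= r)%R -> 0 <= x -> x <= y -> x `^ r <= y `^ r.
Proof.
move=> r0 x0 xy; apply: gt0_ler_poweR => //; rewrite in_itv/= ?leey ?andbT//.
exact: le_trans xy.
Qed.

Lemma poweRK r x : (0 < r)%R -> 0 <= x -> (x `^ r) `^ r^-1 = x.
Proof.
by move=> r0 x0; rewrite -poweRrM divff ?gt_eqF// poweRe1.
Qed.

Lemma poweRVK r x : (0 < r)%R -> 0 <= x -> (x `^ r^-1) `^ r = x.
Proof.
by move=> r0 x0; rewrite -poweRrM mulVf ?gt_eqF// poweRe1.
Qed.

(** Values in [[0, +oo]] let inequalities be stated before any summability is known. On an empty
    index type the supremum would be [-oo], hence the element of the index type among the arguments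
    of several lemmas. *)
Definition nu (T : choiceType) p (g : T -> \bar R) : \bar R :=
  match p with
  | r%:E => (\esum_(i in [set: T]) (g i `^ r)) `^ r^-1
  | +oo => ereal_sup (range g)
  | -oo => 0
  end.

Section OneType.
Variable T : choiceType.
Implicit Types g h : T -> \bar R.

Lemma nu_mono p g h : 1 <= p -> (forall i, 0 <= g i) ->
  (forall i, g i <= h i) -> nu p g <= nu p h.
Proof.
case: p => [r| |]//= p1 g0 gh.
- rewrite lee_fin in p1; have r0 := lt_le_trans ltr01 p1.
  apply: le_poweR; first by rewrite invr_ge0 ltW.
    by apply: esum_ge0 => i _; exact: poweR_ge0.
  by apply: le_esum => i _; apply: le_poweR => //; exact: ltW.
- apply: ge_ereal_sup => _ [i _ <-]; apply: le_trans (gh i) _.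
  by apply: ereal_sup_ubound; exists i.
Qed.

Lemma nu_term p g i : 1 <= p -> (forall j, 0 <= g j) -> g i <= nu p g.
Proof.
case: p => [r| |]//= p1 g0.
- rewrite lee_fin in p1; have r0 := lt_le_trans ltr01 p1.
  rewrite -[leLHS](poweRK r0)//; apply: le_poweR; first by rewrite invr_ge0 ltW.
    exact: poweR_ge0.
  by apply: (@le_term_esum _ _ (fun j => g j `^ r)) => j; exact: poweR_ge0.
- by apply: ereal_sup_ubound; exists i.
Qed.

Lemma nu_ge0 (i : T) p g : 1 <= p -> (forall j, 0 <= g j) -> 0 <= nu p g.
Proof. by move=> p1 g0; apply: le_trans (g0 i) _; exact: nu_term. Qed.

Lemma nu_dirac p g t : 1 <= p -> (forall i, 0 <= g i) ->
  (forall i, i != t -> g i = 0) -> nu p g = g t.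
Proof.
case: p => [r| |]//= p1 g0 gt0.
- rewrite lee_fin in p1; have r0 := lt_le_trans ltr01 p1.
  rewrite (@esum_dirac _ _ _ t) ?poweRK ?poweR_ge0// => i it.
  by rewrite gt0// poweR0r// gt_eqF.
- apply/eqP; rewrite eq_le; apply/andP; split.
    apply: ge_ereal_sup => _ [i _ <-].
    by have [->//|it] := eqVneq i t; rewrite gt0.
  by apply: ereal_sup_ubound; exists t.
Qed.

Lemma nu_reindex p g (e : T -> T) : bijective e -> nu p (g \o e) = nu p g.
Proof.
move=> be; case: p => [r| |]//=.
  by rewrite [in RHS](reindex_esumT _ be).
congr (ereal_sup _); apply/seteqP; split => [_ [i _ <-]|_ [i _ <-]].
  by exists (e i).
by case: be => f ef fe; exists (f i) => //=; rewrite fe.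
Qed.

Lemma nuZ p g (c : R) (t : T) : 1 <= p -> (0 <= c)%R -> (forall i, 0 <= g i) ->
  nu p (fun i => c%:E * g i) = c%:E * nu p g.
Proof.
case: p => [r| |]//= p1 c0 g0.
- rewrite lee_fin in p1; have r0 := lt_le_trans ltr01 p1.
  under eq_esum do rewrite poweRM//.
  rewrite esumZl ?poweR_ge0//; last by move=> i; exact: poweR_ge0.
  rewrite poweRM ?poweR_ge0 ?poweRK//.
  by apply: esum_ge0 => i _; exact: poweR_ge0.
- rewrite -ereal_supZl//; last by apply/set0P; exists (g t), t.
  by congr ereal_sup; rewrite -image_comp.
Qed.

End OneType.

(** Minkowski's inequality for an arbitrary family. With the norm [n a] of [u a] as weight,
    [powR_sum_le] bounds the power [r] of the sum at [i] by [B i]. Summed over [i], each [a]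
    contributes [n a ^ (1 - r) * n a ^ r = n a], so the total is at most [s ^ r]. *)
Lemma nu_esum (I T : choiceType) p (u : I -> T -> \bar R) : 1 <= p ->
  (forall a i, 0 <= u a i) ->
  nu p (fun i => \esum_(a in [set: I]) u a i) <=
  \esum_(a in [set: I]) nu p (u a).
Proof.
case: p => [r| |]//= p1 u0; last first.
  apply: ge_ereal_sup => _ [i _ <-]; apply: le_esum => a _.
  by apply: ereal_sup_ubound; exists i.
rewrite lee_fin in p1; have r0 := lt_le_trans ltr01 p1.
have ur0 a i : 0 <= u a i `^ r by exact: poweR_ge0.
pose N a := (\esum_(i in [set: T]) u a i `^ r) `^ r^-1.
have N0 a : 0 <= N a by exact: poweR_ge0.
rewrite -/(N _); set S := \esum_(a in _) N a.
have S0 : 0 <= S by exact: esum_ge0.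
have [->|Sy] := eqVneq S +oo; first exact: leey.
have Sfin : S \is a fin_num by rewrite ge0_fin_numE// lt_neqAle Sy leey.
have Nfin a : N a \is a fin_num.
  rewrite ge0_fin_numE//; apply: (@le_lt_trans _ _ S).
    exact: (@le_term_esum _ _ N).
  by rewrite lt_neqAle Sy leey.
have uN a i : u a i <= N a.
  by apply: (@nu_term _ r%:E) => //; rewrite lee_fin.
have ufin a i : u a i \is a fin_num.
  rewrite ge0_fin_numE//; apply: le_lt_trans (uN a i) _.
  by rewrite -ge0_fin_numE.
pose n a := fine (N a); pose s := fine S.
have nE a : N a = (n a)%:E by rewrite fineK.
have n0 a : (0 <= n a)%R by rewrite fine_ge0.
have sE : S = s%:E by rewrite fineK.
have s0 : (0 <= s)%R by rewrite fine_ge0.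
pose B i := (s `^ (r - 1))%:E *
  \esum_(a in [set: I]) ((n a `^ (1 - r))%:E * u a i `^ r).
have B0 i : 0 <= B i.
  apply: mule_ge0; first by rewrite lee_fin powR_ge0.
  by apply: esum_ge0 => a _; apply: mule_ge0 => //; rewrite lee_fin powR_ge0.
have uB i : \esum_(a in [set: I]) u a i <= B i `^ r^-1.
  apply: ge_esum => A; rewrite -[leLHS](poweRK r0) ?sume_ge0//.
  apply: le_poweR; rewrite ?invr_ge0 ?(ltW r0)//; first exact: poweR_ge0.
  (* Summands of norm 0 vanish at every site and are dropped; [n'] gives them weight 1 because
     [powR_sum_le] asks for positive weights everywhere. *)
  pose A' := [seq a <- A | n a != 0%R].
  pose n' a := if n a == 0%R then 1%R else n a.
  have n'0 a : (0 < n' a)%R.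
    by rewrite /n'; case: eqVneq => // na; rewrite lt_neqAle eq_sym na n0.
  pose v a := fine (u a i).
  have v0 a : (0 <= v a)%R by rewrite fine_ge0.
  have -> : \sum_(a <- A) u a i = (\sum_(a <- A') v a)%:E.
    rewrite big_filter [in RHS]big_mkcond /= -sumEFin; apply: eq_bigr => a _.
    case: eqVneq => [na|_]; rewrite /= ?fineK//.
    by apply/eqP; rewrite eq_le u0 andbT; have := uN a i; rewrite nE na.
  rewrite poweR_EFin.
  apply: (@le_trans _ _ ((\sum_(a <- A') n' a) `^ (r - 1) *
      \sum_(a <- A') n' a `^ (1 - r) * v a `^ r)%:E).
    by rewrite lee_fin; exact: powR_sum_le.
  have n'n a : a \in A' -> n' a = n a.
    by rewrite mem_filter /n' => /andP[/negPf ->].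
  have A'u : uniq A' by rewrite filter_uniq// fset_uniq.
  rewrite EFinM; apply: lee_pmul; rewrite ?lee_fin ?powR_ge0//.
  - by apply: sumr_ge0 => a _; rewrite mulr_ge0 ?powR_ge0.
  - apply: ge0_ler_powR; rewrite ?subr_ge0 ?nnegrE//.
      by apply: sumr_ge0 => a _; exact: ltW.
    rewrite (eq_big_seq n n'n) -lee_fin -sE -sumEFin.
    apply: le_trans (uniq_seq_le_esum N A'u).
    by rewrite le_eqVlt; apply/orP; left; apply/eqP/eq_bigr => a _; rewrite nE.
  - rewrite -sumEFin.
    apply: le_trans (uniq_seq_le_esum _ A'u).
    rewrite big_seq [leRHS]big_seq; apply: lee_sum => a aA.
    by rewrite n'n// EFinM -(poweR_EFin (v a)) fineK.
have ESr : s%:E = ((s `^ r)%:E) `^ r^-1 by rewrite -poweR_EFin poweRK// lee_fin.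
rewrite sE ESr; apply: le_poweR; rewrite ?invr_ge0 ?(ltW r0)//.
  by apply: esum_ge0 => i _; exact: poweR_ge0.
apply: (@le_trans _ _ (\esum_(i in [set: T]) B i)).
  apply: le_esum => i _; rewrite -[leRHS](poweRVK r0)//.
  by apply: le_poweR; rewrite ?(ltW r0)//; exact: esum_ge0.
have c0 a : 0 <= (n a `^ (1 - r))%:E by rewrite lee_fin powR_ge0.
rewrite esumZl ?lee_fin ?powR_ge0//; last first.
  by move=> i; apply: esum_ge0 => a _; exact: mule_ge0.
rewrite esum_exchange; last by move=> *; exact: mule_ge0.
have -> : \esum_(a in [set: I]) \esum_(i in [set: T])
    ((n a `^ (1 - r))%:E * u a i `^ r) = S.
  apply: eq_esum => a _; rewrite esumZl//.
  have -> : \esum_(i in [set: T]) u a i `^ r = (n a `^ r)%:E.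
    rewrite -poweR_EFin -nE poweRVK//.
    by apply: esum_ge0.
  rewrite nE -EFinM; congr (_%:E).
  have [->|na] := eqVneq (n a) 0%R.
    by rewrite mulrC powR0 ?mul0r ?(gt_eqF r0).
  by rewrite -powRD ?na ?implybT// subrK powRr1.
rewrite sE -EFinM lee_fin.
have [->|sn0] := eqVneq s 0%R; first by rewrite mulr0 powR_ge0.
rewrite -{2}(powRr1 s0) -powRD ?sn0 ?implybT//.
by rewrite subrK.
Qed.

Lemma esum_bool (f : bool -> \bar R) : (forall b, 0 <= f b) ->
  \esum_(b in [set: bool]) f b = f true + f false.
Proof.
move=> f0; rewrite (@eq_esum _ _ _ _
  (fun b => (if b then f true else 0) + (if b then 0 else f false))).
  rewrite esumD; try by case.
  rewrite (@esum_dirac _ _ (fun b => if b then f true else 0) true)//; last by case.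
  by rewrite (@esum_dirac _ _ (fun b => if b then 0 else f false) false)//; case.
by case; rewrite ?adde0 ?add0e.
Qed.

Section OneTypeSums.
Variable T : choiceType.
Implicit Types g h : T -> \bar R.

Lemma nuD p g h (t : T) : 1 <= p -> (forall i, 0 <= g i) -> (forall i, 0 <= h i) ->
  nu p (fun i => g i + h i) <= nu p g + nu p h.
Proof.
move=> p1 g0 h0.
have := @nu_esum _ _ p (fun (b : bool) i => if b then g i else h i) p1.
rewrite esum_bool; last first.
  move=> b; apply: (nu_ge0 t p1) => i; by case: b.
rewrite (_ : (fun i => \esum_(a in _) _) = (fun i => g i + h i)).
  by apply => -[].
by apply/funext => i; rewrite esum_bool// => -[].
Qed.

(** Minkowski's inequality for the decomposition of [g] into one-point parts, each of which has its
    value as norm. *)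
Lemma nu_le_esum p g : 1 <= p -> (forall i, 0 <= g i) ->
  nu p g <= \esum_(i in [set: T]) g i.
Proof.
move=> p1 g0.
rewrite [leLHS](_ : _ = nu p (fun i =>
    \esum_(k in [set: T]) (if i == k then g k else 0))); last first.
  congr nu; apply/funext => i.
  rewrite (@esum_dirac _ _ _ i) ?eqxx// => k; by rewrite eq_sym => /negPf ->.
apply: le_trans (nu_esum p1 _) _; first by move=> a i; case: ifP.
apply: le_esum => k _; rewrite (@nu_dirac _ _ _ k)// ?eqxx//.
- by move=> i; case: ifP.
- by move=> i /negPf ->.
Qed.

End OneTypeSums.

End Exponents.

(** * Convolution with summable kernels *)

Section Convolution.
Local Open Scope ereal_scope.
Variables (R : realType) (G : zmodType).
Implicit Types (p : \bar R) (H K g h : G -> \bar R).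

Definition mass g := \esum_(i in [set: G]) g i.
Definition conv H g i := \esum_(a in [set: G]) H a * g (i - a)%R.

Lemma mass_ge0 g : (forall i, 0 <= g i) -> 0 <= mass g.
Proof. by move=> g0; apply: esum_ge0. Qed.

Lemma conv_ge0 H g : (forall i, 0 <= H i) -> (forall i, 0 <= g i) ->
  forall i, 0 <= conv H g i.
Proof. by move=> H0 g0 i; apply: esum_ge0 => a _; exact: mule_ge0. Qed.

Lemma le_conv H K g h i : (forall i, 0 <= H i) -> (forall i, 0 <= g i) ->
  (forall i, H i <= K i) -> (forall i, g i <= h i) ->
  conv H g i <= conv K h i.
Proof. by move=> H0 g0 HK gh; apply: le_esum => a _; exact: lee_pmul. Qed.

Lemma addr_bij (a : G) : bijective (fun i : G => i - a)%R.
Proof. by exists (fun i : G => i + a)%R => i; rewrite ?subrK ?addrK. Qed.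

Lemma subr_bij (a : G) : bijective (fun i : G => a - i)%R.
Proof. by exists (fun i : G => a - i)%R => i; rewrite opprB addrCA subrr addr0. Qed.

Lemma mass_shift g a : mass (fun i => g (i - a)%R) = mass g.
Proof. by rewrite /mass [RHS](reindex_esumT _ (addr_bij a)). Qed.

Lemma mass_conv H g : (forall i, 0 <= H i) -> (forall i, 0 <= g i) ->
  mass (conv H g) = mass H * mass g.
Proof.
move=> H0 g0; rewrite /mass esum_exchange; last by move=> *; exact: mule_ge0.
rewrite -esumZr ?mass_ge0//; apply: eq_esum => a _.
by rewrite esumZl// [X in _ * X]mass_shift.
Qed.

Lemma conv_assoc H K g i : (forall i, 0 <= H i) -> (forall i, 0 <= K i) ->
  (forall i, 0 <= g i) -> conv (conv H K) g i = conv H (conv K g) i.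
Proof.
move=> H0 K0 g0; rewrite /conv.
transitivity (\esum_(b in [set: G]) \esum_(a in [set: G])
    (H a * (K (b - a)%R * g (i - b)%R))).
  apply: eq_esum => b _; rewrite -esumZr//; last by move=> *; exact: mule_ge0.
  by apply: eq_esum => a _; rewrite muleA.
rewrite esum_exchange; last by move=> *; rewrite !mule_ge0.
apply: eq_esum => a _; rewrite esumZl//; last by move=> *; exact: mule_ge0.
rewrite (reindex_esumT _ (addr_bij (- a)%R)); congr (_ * _).
by apply: eq_esum => b _; rewrite opprK addrK opprD addrA addrAC.
Qed.

Lemma convDr H g h i : (forall i, 0 <= H i) -> (forall i, 0 <= g i) ->
  (forall i, 0 <= h i) ->
  conv H (fun i => g i + h i) i = conv H g i + conv H h i.
Proof.
move=> H0 g0 h0; rewrite -esumD; try by move=> *; exact: mule_ge0.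
by apply: eq_esum => a _; rewrite ge0_muleDr.
Qed.

Lemma convDl H K g i : (forall i, 0 <= H i) -> (forall i, 0 <= K i) ->
  (forall i, 0 <= g i) ->
  conv (fun i => H i + K i) g i = conv H g i + conv K g i.
Proof.
move=> H0 K0 g0; rewrite -esumD; try by move=> *; exact: mule_ge0.
by apply: eq_esum => a _; rewrite ge0_muleDl.
Qed.

Lemma convZr H g c i : 0 <= c -> (forall i, 0 <= H i) -> (forall i, 0 <= g i) ->
  conv H (fun i => c * g i) i = c * conv H g i.
Proof.
move=> c0 H0 g0; rewrite -esumZl//; last by move=> *; exact: mule_ge0.
by apply: eq_esum => a _; rewrite muleCA.
Qed.

Lemma convZl H g c i : 0 <= c -> (forall i, 0 <= H i) -> (forall i, 0 <= g i) ->
  conv (fun i => c * H i) g i = c * conv H g i.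
Proof.
move=> c0 H0 g0; rewrite -esumZl//; last by move=> *; exact: mule_ge0.
by apply: eq_esum => a _; rewrite muleA.
Qed.

Lemma conv_dirac (b : G) g i : (forall i, 0 <= g i) ->
  conv (fun a => if a == b then 1 else 0) g i = g (i - b)%R.
Proof.
move=> g0; rewrite /conv (@esum_dirac _ _ _ b) ?eqxx ?mul1e//.
by move=> a /negPf ->; rewrite mul0e.
Qed.

Lemma conv_esum (J : choiceType) H (g : J -> G -> \bar R) i :
  (forall i, 0 <= H i) -> (forall j i, 0 <= g j i) ->
  conv H (fun i => \esum_(j in [set: J]) g j i) i =
  \esum_(j in [set: J]) conv H (g j) i.
Proof.
move=> H0 g0; rewrite /conv esum_exchange; last by move=> *; exact: mule_ge0.
by apply: eq_esum => a _; rewrite esumZl.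
Qed.

Lemma conv_esuml (J : choiceType) (H : J -> G -> \bar R) g i :
  (forall j i, 0 <= H j i) -> (forall i, 0 <= g i) ->
  conv (fun i => \esum_(j in [set: J]) H j i) g i =
  \esum_(j in [set: J]) conv (H j) g i.
Proof.
move=> H0 g0; rewrite /conv esum_exchange; last by move=> *; exact: mule_ge0.
by apply: eq_esum => a _; rewrite esumZr.
Qed.

Lemma conv_le_sup H g c i : (forall i, 0 <= H i) -> (forall i, 0 <= g i) ->
  (forall i, g i <= c) -> conv H g i <= mass H * c.
Proof.
move=> H0 g0 gc; have c0 := le_trans (g0 i) (gc i).
by rewrite -esumZr//; apply: le_esum => a _; exact: lee_wpmul2l.
Qed.

Lemma nu_shift p g a : nu p (fun i => g (i - a)%R) = nu p g.
Proof. exact: (nu_reindex p g (addr_bij a)). Qed.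

(** Young's inequality: a convolution is a weighted sum of translates of [g]. Finite mass makes each
    [H a] a real factor, as [nuZ] demands. *)
Lemma nu_conv p H g : 1 <= p -> (forall i, 0 <= H i) -> (forall i, 0 <= g i) ->
  mass H < +oo -> nu p (conv H g) <= mass H * nu p g.
Proof.
move=> p1 H0 g0 Hfin.
apply: le_trans (nu_esum p1 _) _; first by move=> *; exact: mule_ge0.
rewrite -esumZr//; last exact: (nu_ge0 0%R).
apply: le_esum => a _; have Ha : H a \is a fin_num.
  by rewrite ge0_fin_numE//; apply: le_lt_trans Hfin; exact: le_term_esum.
rewrite -(fineK Ha) nuZ ?nu_shift ?fine_ge0//; exact: 0%R.
Qed.

Definition null g := forall e : R, (0 < e)%R ->
  exists A : {fset G}, forall i, i \notin A -> g i <= e%:E.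

Lemma null_le g h : (forall i, g i <= h i) -> null h -> null g.
Proof.
move=> gh hn e e0; have [A hA] := hn _ e0; exists A => i iA.
by apply: le_trans (gh i) _; exact: hA.
Qed.

Lemma mass_null g : (forall i, 0 <= g i) -> mass g < +oo -> null g.
Proof.
move=> g0 gfin e e0; have [A hA] := esum_tail g0 gfin e0.
exists A => i iA; apply: le_trans (hA A (fsubset_refl _)).
have := @le_term_esum _ _ (fun i => if i \in A then 0 else g i) i.
by rewrite (negPf iA); apply => j; case: ifP.
Qed.

Lemma conv_null H g (c : R) : (forall i, 0 <= H i) -> (forall i, 0 <= g i) ->
  mass H < +oo -> (forall i, g i <= c%:E) -> null g -> null (conv H g).
Proof.
move=> H0 g0 Hfin gc gn e e0.
have c0 : (0 <= c)%R by rewrite -lee_fin; apply: le_trans (gc 0%R).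
have [M ME] : exists M, mass H = M%:E.
  by exists (fine (mass H)); rewrite fineK// ge0_fin_numE// mass_ge0.
have M0 : (0 <= M)%R by rewrite -lee_fin -ME mass_ge0.
(* If [i] is outside [A + B], then for every [a] either [a] is outside [B], where [H] has little
   mass, or [i - a] is outside [A], where [g] is small. Adding 1 to [M] and to [c] keeps the
   denominators positive. *)
have d0 : (0 < e / 2 / (M + 1))%R by rewrite !divr_gt0// ltr_wpDl.
have [A hA] := gn _ d0.
have d0' : (0 < e / 2 / (c + 1))%R by rewrite !divr_gt0// ltr_wpDl.
have [B hB] := esum_tail H0 Hfin d0'.
exists [fset (a + b)%R | a in B, b in A]%fset => i iAB.
apply: (@le_trans _ _ (\esum_(a in [set: G]) (H a * (e / 2 / (M + 1))%:E +
   (if a \in B then 0 else H a) * c%:E))).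
  apply: le_esum => a _; case: ifPn => aB.
    rewrite mul0e adde0; apply: lee_wpmul2l => //; apply: hA.
    apply/negP => iaA; move/negP: iAB; apply.
    by apply/imfset2P; exists a => //; exists (i - a)%R => //; rewrite addrC subrK.
  apply: (@le_trans _ _ (H a * c%:E)); first exact: lee_wpmul2l.
  by rewrite leeDr// mule_ge0// lee_fin ltW.
rewrite esumD; last 2 first.
- by move=> a _; rewrite mule_ge0// lee_fin ltW.
- by move=> a _; rewrite mule_ge0// ?lee_fin//; case: ifP.
rewrite !esumZr ?lee_fin ?(ltW d0)//; last by move=> a; case: ifP.
rewrite [X in X * _ + _](_ : _ = M%:E)//.
apply: (@le_trans _ _ (M%:E * (e / 2 / (M + 1))%:E + (e / 2 / (c + 1))%:E * c%:E)).
  by rewrite leeD2l//; apply: lee_wpmul2r; rewrite ?lee_fin//; exact: hB.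
rewrite -!EFinM -EFinD lee_fin.
have h (z : R) : (0 <= z)%R -> (z * (e / 2 / (z + 1)) <= e / 2)%R.
  move=> z0; rewrite mulrCA -[leRHS]mulr1 ler_wpM2l ?divr_ge0 ?(ltW e0)//.
  by rewrite -/(z / _)%R ler_pdivrMr ?ltr_wpDl// mul1r lerDl.
have := h _ M0; have := h _ c0; lra.
Qed.

End Convolution.

(** * Membership in l^p for nonnegative scalar sequences *)

Section LpMembership.
Local Open Scope ereal_scope.
Variables (R : realType) (G : zmodType).
Implicit Types (p : \bar R) (H K g h : G -> \bar R).

(* The exponent 0 stands for null sequences, normed by the supremum. *)
Definition nexp p : \bar R := if p == 0 then +oo else p.

Definition lpmem p g := nu (nexp p) g < +oo /\ (p = 0 -> null g).

Lemma nexp_ge1 p : exponent p -> 1 <= nexp p.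
Proof. by rewrite /nexp => -[->|p1]; rewrite ?eqxx ?leey//; case: ifP; rewrite ?leey. Qed.

Lemma lpmem_le p g h : exponent p -> (forall i, 0 <= g i) ->
  (forall i, g i <= h i) -> lpmem p h -> lpmem p g.
Proof.
move=> /nexp_ge1 p1 g0 gh [h1 h2]; split.
  by apply: le_lt_trans h1; exact: nu_mono.
by move=> /h2; exact: null_le.
Qed.

Lemma lpmem_bound p g : exponent p -> (forall i, 0 <= g i) -> lpmem p g ->
  exists2 c : R, (0 <= c)%R & forall i, g i <= c%:E.
Proof.
move=> /nexp_ge1 p1 g0 [gfin _].
have g1 := nu_ge0 0%R p1 g0.
exists (fine (nu (nexp p) g)); first by rewrite fine_ge0.
by move=> i; rewrite fineK ?ge0_fin_numE//; exact: nu_term.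
Qed.

Lemma lpmem_conv p H g : exponent p -> (forall i, 0 <= H i) ->
  (forall i, 0 <= g i) -> mass H < +oo -> lpmem p g -> lpmem p (conv H g).
Proof.
move=> ep H0 g0 Hfin gp; have p1 := nexp_ge1 ep; split.
  apply: le_lt_trans (nu_conv p1 H0 g0 Hfin) _.
  by apply: lte_mul_pinfty => //; [exact: mass_ge0|rewrite ge0_fin_numE// mass_ge0|case: gp].
move=> p0; have [c c0 gc] := lpmem_bound ep g0 gp.
by apply: conv_null gc _ => //; case: gp => _; exact.
Qed.

Lemma lpmem_mass p g : exponent p -> (forall i, 0 <= g i) -> mass g < +oo ->
  lpmem p g.
Proof.
move=> ep g0 gfin; split; last by move=> _; exact: mass_null.
by apply: le_lt_trans gfin; apply: nu_le_esum => //; exact: nexp_ge1.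
Qed.

Lemma null_sum (g h : G -> \bar R) : null g -> null h -> null (fun i => g i + h i).
Proof.
move=> gn hn e e0; have e20 : (0 < e / 2)%R by rewrite divr_gt0.
have [A hA] := gn _ e20; have [B hB] := hn _ e20.
exists (A `|` B)%fset => i; rewrite in_fsetU negb_or => /andP[iA iB].
by rewrite [e]splitr EFinD leeD// ?hA ?hB.
Qed.

Lemma lpmemD p g h : exponent p -> (forall i, 0 <= g i) -> (forall i, 0 <= h i) ->
  lpmem p g -> lpmem p h -> lpmem p (fun i => g i + h i).
Proof.
move=> ep g0 h0 [g1 g2] [h1 h2]; split.
  by apply: le_lt_trans (nuD 0%R (nexp_ge1 ep) g0 h0) _; exact: lte_add_pinfty.
by move=> p0; apply: null_sum; [exact: g2|exact: h2].
Qed.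

Lemma lpmemZ p g (c : R) : exponent p -> (forall i, 0 <= g i) -> (0 <= c)%R ->
  lpmem p g -> lpmem p (fun i => c%:E * g i).
Proof.
move=> ep g0 c0 gp.
(* Scaling is convolution with a point mass, so [lpmem_conv] covers it. *)
have -> : (fun i => c%:E * g i) = conv (fun a => if a == 0%R then c%:E else 0) g.
  apply/funext => i; rewrite /conv (@esum_dirac _ _ _ 0%R) ?eqxx ?subr0//.
    by move=> a /negPf ->; rewrite mul0e.
  by rewrite mule_ge0.
apply: lpmem_conv => //; first by move=> i; case: ifP.
rewrite /mass (@esum_dirac _ _ _ 0%R) ?eqxx ?ltry//.
by move=> a /negPf ->.
Qed.

End LpMembership.

(** * Real-valued norms and unordered sums *)

Section RealNorm.
Variable R : realType.

Definition ofR (K : numFieldType) (sc : scalars R K) : R -> K :=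
  match sc with
  | RealScalars => fun r => r
  | ComplexScalars => fun r => (r%:C)%C
  end.

Section Modulus.
Variables (K : numFieldType) (sc : scalars R K).

Lemma modulusD (z w : K) : modulus sc (z + w) = modulus sc z + modulus sc w.
Proof. by case: sc z w => //= -[? ?] [? ?]. Qed.

Lemma modulus0 : modulus sc 0 = 0.
Proof. by case: sc. Qed.

Lemma modulus1 : modulus sc 1 = 1.
Proof. by case: sc. Qed.

Lemma modulus_ofR r : modulus sc (ofR sc r) = r.
Proof. by case: sc. Qed.

Lemma le_modulus (z w : K) : z <= w -> modulus sc z <= modulus sc w.
Proof. by case: sc z w => //= -[? ?] [? ?]; rewrite lecE => /andP[]. Qed.

Lemma ofR_modulus (z : K) : 0 <= z -> ofR sc (modulus sc z) = z.
Proof.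
case: sc z => //= -[a b]; rewrite lecE /= => /andP[/eqP b0 _].
by rewrite /real_complex_def b0.
Qed.

Lemma modulusM (z w : K) : 0 <= z -> 0 <= w ->
  modulus sc (z * w) = modulus sc z * modulus sc w.
Proof.
case: sc z w => //= -[a b] [c d]; rewrite !lecE /= => /andP[/eqP -> _] /andP[/eqP -> _].
by rewrite mul0r subr0.
Qed.

Lemma lt_ofR (z : K) r : 0 <= z -> (z < ofR sc r) = (modulus sc z < r).
Proof.
case: sc z => //= -[a b]; rewrite lecE ltcE /= => /andP[/eqP b0 _].
by rewrite b0 eqxx.
Qed.

End Modulus.

Section Norm.
Variables (K : numFieldType) (sc : scalars R K) (X : normedModType K).
Local Notation rnorm := (rnorm sc).
Implicit Types (x y : X) (k : K).

Definition rabs k : R := modulus sc `|k|.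

Lemma rnorm_ge0 x : 0 <= rnorm x.
Proof. by rewrite -(modulus0 sc); exact: le_modulus. Qed.

Lemma rnorm0 : rnorm (0 : X) = 0.
Proof. by rewrite /Defs.rnorm normr0 modulus0. Qed.

Lemma rnorm0_eq0 x : rnorm x = 0 -> x = 0.
Proof.
move=> h; apply/eqP; rewrite -normr_eq0 -(ofR_modulus sc (normr_ge0 x)).
by move: h; rewrite /Defs.rnorm => ->; case: sc.
Qed.

Lemma rnormN x : rnorm (- x) = rnorm x.
Proof. by rewrite /Defs.rnorm normrN. Qed.

Lemma rnormD x y : rnorm (x + y) <= rnorm x + rnorm y.
Proof. by rewrite /Defs.rnorm -modulusD; apply: le_modulus; exact: ler_normD. Qed.

Lemma rnormB x y : rnorm (x - y) <= rnorm x + rnorm y.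
Proof. by rewrite -[rnorm y]rnormN; exact: rnormD. Qed.

Lemma rnorm_sum (I : Type) (s : seq I) (P : pred I) (f : I -> X) :
  rnorm (\sum_(i <- s | P i) f i) <= \sum_(i <- s | P i) rnorm (f i).
Proof.
elim/big_ind2 : _ => [|a b c d h1 h2|//]; first by rewrite rnorm0.
by apply: le_trans (rnormD _ _) _; exact: lerD.
Qed.

Lemma rabs_ge0 k : 0 <= rabs k.
Proof. by rewrite -(modulus0 sc); exact: le_modulus. Qed.

Lemma rabs0_eq0 k : rabs k = 0 -> k = 0.
Proof.
move=> h; apply/eqP; rewrite -normr_eq0 -(ofR_modulus sc (normr_ge0 k)).
by move: h; rewrite /rabs => ->; case: sc.
Qed.

Lemma rabsD k l : rabs (k + l) <= rabs k + rabs l.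
Proof. by rewrite /rabs -modulusD; apply: le_modulus; exact: ler_normD. Qed.

Lemma rabsN k : rabs (- k) = rabs k.
Proof. by rewrite /rabs normrN. Qed.

Lemma rabsM k l : rabs (k * l) = rabs k * rabs l.
Proof. by rewrite /rabs normrM modulusM. Qed.

Lemma rabs_nat n : rabs n%:R = n%:R.
Proof.
rewrite /rabs normr_nat; elim: n => [|n IH]; first exact: modulus0.
by rewrite -!natr1 modulusD IH modulus1.
Qed.

Lemma rnormZ k x : rnorm (k *: x) = rabs k * rnorm x.
Proof. by rewrite /Defs.rnorm normrZ modulusM. Qed.

Lemma rabsV k : rabs k^-1 = (rabs k)^-1.
Proof.
have [->|k0] := eqVneq k 0.
  by rewrite invr0 /rabs normr0 modulus0 invr0.
have r0 : rabs k != 0 by apply/eqP => /rabs0_eq0 /eqP; exact/negP.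
apply: (mulfI r0); rewrite -rabsM !divff//.
by rewrite /rabs normr1 modulus1.
Qed.

Lemma rnormMn x n : rnorm (x *+ n) = rnorm x * n%:R.
Proof. by rewrite -scaler_nat rnormZ rabs_nat mulrC. Qed.

Lemma rnorm_lt x e : (`|x| < ofR sc e) = (rnorm x < e).
Proof. exact: lt_ofR. Qed.

End Norm.

(** The intervals [[u k - d k, u k + d k]] meet pairwise, so the supremum of their left ends lies in
    all of them. *)
Lemma real_complete (u d : nat -> R) :
  (forall k l, (k <= l)%N -> `|u l - u k| <= d k) ->
  exists s, forall k, `|s - u k| <= d k.
Proof.
move=> hu; have d0 k : 0 <= d k by apply: le_trans (hu k k _).
have le_ud k l : u k - d k <= u l + d l.
  have [kl|/ltnW lk] := leqP k l.
    by have := hu k l kl; have := d0 l; rewrite ler_norml; lra.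
  by have := hu l k lk; have := d0 k; rewrite ler_norml; lra.
pose E := [set u k - d k | k in [set: nat]].
have hE : has_sup E.
  split; first by exists (u 0%N - d 0%N), 0%N.
  by exists (u 0%N + d 0%N) => _ [k _ <-].
exists (sup E) => k; rewrite ler_norml; apply/andP; split.
  have : u k - d k <= sup E by apply: (sup_upper_bound hE); exists k.
  by lra.
have : sup E <= u k + d k.
  by apply: ge_sup; [case: hE|move=> _ [l _ <-]].
by lra.
Qed.

Lemma Re_Im_le_norm (z : R[i]) :
  `|complex.Re z| <= complex.Re `|z| /\ `|complex.Im z| <= complex.Re `|z|.
Proof.
case: z => a b; rewrite normc_def /=; split; rewrite -sqrtr_sqr ler_wsqrtr//.
  by rewrite lerDl sqr_ge0.
by rewrite lerDr sqr_ge0.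
Qed.

Lemma norm_le_Re_Im (z : R[i]) :
  complex.Re `|z| <= `|complex.Re z| + `|complex.Im z|.
Proof.
case: z => a b; rewrite normc_def /=.
rewrite -[leRHS]ger0_norm ?addr_ge0// -sqrtr_sqr ler_wsqrtr// sqrrD !real_normK ?num_real//.
by rewrite addrAC lerDl mulrn_wge0// mulr_ge0.
Qed.

(** The factor 2 adds the errors of the real and the imaginary part. *)
Lemma K_complete (K : numFieldType) (sc : scalars R K) (c : nat -> K)
    (d : nat -> R) :
  (forall k l, (k <= l)%N -> rabs sc (c l - c k) <= d k) ->
  exists s, forall k, rabs sc (s - c k) <= 2 * d k.
Proof.
have le2 (x y : R) : `|x| <= y -> `|x| <= 2 * y.
  by have := normr_ge0 x; lra.
case: sc c => [c /real_complete[s hs]|c hc].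
  by exists s => k; exact: le2 (hs k).
have [k l kl|a ha] := @real_complete (fun k => complex.Re (c k)) d.
  rewrite -raddfB; apply: le_trans (hc k l kl).
  by have [] := Re_Im_le_norm (c l - c k).
have [k l kl|b hb] := @real_complete (fun k => complex.Im (c k)) d.
  rewrite -raddfB; apply: le_trans (hc k l kl).
  by have [] := Re_Im_le_norm (c l - c k).
exists (a +i* b)%C => k; apply: le_trans (norm_le_Re_Im _) _.
rewrite !raddfB /= mulr2n mulrDl mul1r; exact: lerD.
Qed.

End RealNorm.

(** * Absolutely convergent unordered sums in a Banach space *)

Section UnorderedSums.
Variables (R : realType) (K : numFieldType) (sc : scalars R K).
Variable X : completeNormedModType K.
Local Notation rnorm := (rnorm sc).

Section OneIndex.
Variable I : choiceType.
Implicit Types (f g : I -> X) (A B : {fset I}).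

Definition abssum f : \bar R := (\esum_(i in [set: I]) (rnorm (f i))%:E)%E.

Definition has_usum f (s : X) := forall e : R, 0 < e ->
  exists A, forall B, (A `<=` B)%fset -> rnorm (s - \sum_(i <- B) f i) <= e.

Lemma modulus_gt0 (eps : K) : 0 < eps -> 0 < modulus sc eps.
Proof.
move=> e0; have := e0; rewrite -{1}(ofR_modulus sc (ltW e0)) lt_ofR//.
by rewrite modulus0.
Qed.

Lemma has_usum_usum f s : has_usum f s -> usum f = s.
Proof.
move=> h; apply: (@cvg_lim _ (@norm_hausdorff _ _)); apply/cvgrPdist_lt => eps eps0.
have e0 := modulus_gt0 eps0.
have [A hA] := h _ (divr_gt0 e0 (ltr0n _ 2)).
exists A => // B /hA; rewrite -[eps](ofR_modulus sc (ltW eps0)) rnorm_lt.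
move/le_lt_trans; apply; rewrite ?modulus_ofR; lra.
Qed.

Lemma rnorm_sum_subD f A B : (A `<=` B)%fset ->
  ((rnorm (\sum_(i <- B) f i - \sum_(i <- A) f i))%:E <=
   \esum_(i in [set: I]) (if i \in A then 0 else (rnorm (f i))%:E))%E.
Proof.
move=> AB.
have -> : \sum_(i <- A) f i = \sum_(i <- B) (if i \in A then f i else 0).
  rewrite -[RHS](big_fset_incl _ AB) => [|i _ /negPf -> //].
  by apply: eq_big_seq => i ->.
rewrite -sumrB; apply: le_trans (fset_le_esum _ B).
apply: (@le_trans _ _ (\sum_(i <- B) (if i \in A then 0 else rnorm (f i)))%:E).
  rewrite lee_fin; apply: le_trans (rnorm_sum _ _ _ _) _.
  by apply: ler_sum => i _; case: ifP; rewrite ?subrr ?rnorm0 ?subr0.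
rewrite -sumEFin; apply: lee_sum => i _; by case: ifP.
Qed.

Lemma abssum_tail f (e : R) : (abssum f < +oo)%E -> 0 < e ->
  exists A, forall B C, (A `<=` B)%fset -> (B `<=` C)%fset ->
    rnorm (\sum_(i <- C) f i - \sum_(i <- B) f i) <= e.
Proof.
move=> ffin e0; have [A hA] := esum_tail (a := fun i => (rnorm (f i))%:E) (fun i => rnorm_ge0 sc (f i)) ffin e0.
exists A => B C AB BC; rewrite -lee_fin; apply: le_trans (hA _ AB).
exact: rnorm_sum_subD.
Qed.

Lemma usumP f : (abssum f < +oo)%E -> has_usum f (usum f).
Proof.
move=> ffin.
have : cvg ((fun A : {fset I} => \sum_(i <- A) f i) @ @finite_subsets I).
  have FF : ProperFilter ((fun A : {fset I} => \sum_(i <- A) f i) @ @finite_subsets I).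
    exact: fmap_proper_filter.
  apply: cauchy_cvg; apply: cauchy_exP => eps eps0.
  have [A hA] := abssum_tail ffin (divr_gt0 (modulus_gt0 eps0) (ltr0n _ 2)).
  exists (\sum_(i <- A) f i); exists A => //= B /(hA _ _ (fsubset_refl _)) h.
  rewrite -ball_normE /ball_ /= distrC -[eps](ofR_modulus sc (ltW eps0)) rnorm_lt.
  by apply: le_lt_trans h _; have := modulus_gt0 eps0; lra.
move=> /cvgrPdist_lt h e e0.
have /h [A _ hA] : 0 < ofR sc e by rewrite lt_ofR// modulus0.
by exists A => B /hA; rewrite rnorm_lt => /ltW.
Qed.

Lemma eq_usum f g : f =1 g -> usum f = usum g.
Proof. by move=> /funext ->. Qed.

Lemma le_abssum f g : (forall i, rnorm (f i) <= rnorm (g i)) ->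
  (abssum f <= abssum g)%E.
Proof. by move=> fg; apply: le_esum => i _; rewrite lee_fin. Qed.

Lemma rnorm_usum f : (abssum f < +oo)%E -> ((rnorm (usum f))%:E <= abssum f)%E.
Proof.
move=> ffin; apply/lee_addgt0Pr => e e0.
have [A hA] := usumP ffin e0; have {}hA := hA A (fsubset_refl _).
apply: (@le_trans _ _ (\sum_(i <- A) rnorm (f i) + e)%:E).
  rewrite lee_fin; have := rnorm_sum sc A xpredT f.
  have := rnormD sc (usum f - \sum_(i <- A) f i) (\sum_(i <- A) f i).
  by rewrite subrK; lra.
by rewrite EFinD leeD2r// -sumEFin fset_le_esum.
Qed.

Lemma abssumD f g : (abssum f < +oo)%E -> (abssum g < +oo)%E ->
  (abssum (fun i => f i + g i)%R < +oo)%E.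
Proof.
move=> ff gf; apply: (@le_lt_trans _ _ (abssum f + abssum g)%E).
  rewrite /abssum -esumD; try by move=> i _; rewrite lee_fin rnorm_ge0.
  by apply: le_esum => i _; rewrite -EFinD lee_fin rnormD.
exact: lte_add_pinfty.
Qed.

Lemma usumD f g : (abssum f < +oo)%E -> (abssum g < +oo)%E ->
  usum (fun i => f i + g i) = usum f + usum g.
Proof.
move=> ff gf; apply: has_usum_usum => e e0.
have e20 : 0 < e / 2 by rewrite divr_gt0.
have [A hA] := usumP ff e20; have [B hB] := usumP gf e20.
exists (A `|` B)%fset => C; rewrite fsubUset => /andP[/hA h1 /hB h2].
rewrite big_split /= opprD addrACA; apply: le_trans (rnormD _ _ _) _.
by lra.
Qed.

Lemma has_usum_morph (Y : completeNormedModType K) (T : {additive X -> Y})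
    (c : R) f s : 0 <= c -> (forall x, Defs.rnorm sc (T x) <= c * rnorm x) ->
  has_usum f s -> forall e : R, 0 < e ->
  exists A, forall B, (A `<=` B)%fset ->
    Defs.rnorm sc (T s - \sum_(i <- B) T (f i)) <= e.
Proof.
move=> c0 Tc h e e0; have d0 : 0 < e / (c + 1) by rewrite divr_gt0// ltr_wpDl.
have [A hA] := h _ d0; exists A => B /hA hB.
rewrite -raddf_sum -raddfB; apply: le_trans (Tc _) _.
apply: le_trans (ler_wpM2l c0 hB) _.
by rewrite mulrCA ler_piMr ?(ltW e0)// ler_pdivrMr ?ltr_wpDl// mul1r lerDl.
Qed.

Lemma usum_morph (T : {additive X -> X}) (c : R) f : 0 <= c ->
  (forall x, rnorm (T x) <= c * rnorm x) -> (abssum f < +oo)%E ->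
  T (usum f) = usum (fun i => T (f i)).
Proof.
move=> c0 Tc ff; apply/esym/has_usum_usum => e e0.
exact: (has_usum_morph c0 Tc (usumP ff)).
Qed.

Lemma usum_fset f A : (forall i, i \notin A -> f i = 0) ->
  usum f = \sum_(i <- A) f i.
Proof.
move=> fA; apply: has_usum_usum => e e0; exists A => B AB.
rewrite -(big_fset_incl _ AB) ?subrr ?rnorm0 ?(ltW e0)// => i _ iA.
exact: fA.
Qed.

End OneIndex.

Lemma usum_nat_cvg (f : nat -> X) (e : R) : (abssum f < +oo)%E -> 0 < e ->
  exists m, forall n, (m <= n)%N -> rnorm (usum f - \sum_(i < n) f i) <= e.
Proof.
move=> ff e0; have [A hA] := usumP ff e0.
exists (\max_(i <- A) i.+1) => n mn.
have /hA h1 : (A `<=` seq_fset tt (iota 0 n))%fset.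
  apply/fsubsetP => i iA; rewrite seq_fsetE mem_iota /= add0n.
  by apply: leq_trans mn; exact: (@leq_bigmax_seq _ _ xpredT (fun i => i.+1)).
move: h1; rewrite (perm_big _ (seq_fset_perm tt _)) /= undup_id ?iota_uniq//.
by rewrite -(big_mkord xpredT f) /index_iota subn0.
Qed.

Lemma rnorm_small_eq (x y : X) :
  (forall e : R, 0 < e -> rnorm (x - y) <= e) -> x = y.
Proof.
move=> h; apply/eqP; rewrite -subr_eq0; apply/eqP/(@rnorm0_eq0 _ _ sc); apply/eqP.
by rewrite eq_le rnorm_ge0 andbT; apply/ler_addgt0Pr => e e0; rewrite add0r h.
Qed.

Lemma usum_natS (f : nat -> X) : (abssum f < +oo)%E ->
  usum f = f 0%N + usum (fun n => f n.+1).
Proof.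
move=> ff.
have ffS : (abssum (fun n => f n.+1) < +oo)%E.
  apply: le_lt_trans ff; apply: ge_esum => A.
  rewrite -(big_map S xpredT (fun n => (rnorm (f n))%:E)).
  apply: (uniq_seq_le_esum (fun n => (rnorm (f n))%:E)).
  by rewrite map_inj_uniq ?fset_uniq//; exact: succn_inj.
apply: rnorm_small_eq => e e0; have e20 : 0 < e / 2 by rewrite divr_gt0.
have [m hm] := usum_nat_cvg ff e20; have [m' hm'] := usum_nat_cvg ffS e20.
pose n := maxn m m'.
have h1 := hm n.+1 (leq_trans (leq_maxl _ _) (leqnSn _)).
have h2 := hm' n (leq_maxr _ _).
rewrite big_ord_recl in h1.
rewrite -(subrKA (f 0%N + \sum_(i < n) f (lift ord0 i))) -[X in _ + X]opprB.
apply: le_trans (rnormB _ _ _) _.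
rewrite [in X in _ + X]opprD addrACA subrr add0r.
by rewrite (splitr e); apply: lerD.
Qed.

Lemma usum_split (I : choiceType) (f : I -> X) (B : {fset I}) :
  (abssum f < +oo)%E ->
  usum f = \sum_(i <- B) f i + usum (fun i => if i \in B then 0 else f i).
Proof.
move=> ff.
rewrite (@eq_usum _ _ (fun i => (if i \in B then f i else 0) +
    (if i \in B then 0 else f i))); last first.
  by move=> i; case: ifP; rewrite ?addr0 ?add0r.
rewrite usumD; last 2 first.
- apply: le_lt_trans ff; apply: le_abssum => i.
  by case: ifP => // _; rewrite rnorm0 rnorm_ge0.
- apply: le_lt_trans ff; apply: le_abssum => i.
  by case: ifP => // _; rewrite rnorm0 rnorm_ge0.
congr (_ + _); rewrite (@usum_fset _ _ B); last by move=> i /negPf ->.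
by apply: eq_big_seq => i ->.
Qed.

Lemma usum_sum (I J : choiceType) (s : seq I) (f : I -> J -> X) :
  (forall i, abssum (f i) < +oo)%E ->
  (abssum (fun j => \sum_(i <- s) f i j)%R < +oo)%E /\
  usum (fun j => \sum_(i <- s) f i j) = \sum_(i <- s) usum (f i).
Proof.
move=> ff; elim: s => [|i s [IH1 IH2]].
  split; rewrite /abssum.
    by rewrite esum1 ?ltry// => j _; rewrite big_nil rnorm0.
  rewrite big_nil (@usum_fset _ _ fset0) ?big_seq_fset0// => j _.
  by rewrite big_nil.
have E j : \sum_(i0 <- i :: s) f i0 j = f i j + \sum_(i0 <- s) f i0 j.
  by rewrite big_cons.
rewrite (eq_usum E) big_cons usumD// IH2; split => //.
rewrite (_ : (fun j => _) = (fun j => f i j + \sum_(i0 <- s) f i0 j)%R).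
  exact: abssumD.
exact/funext.
Qed.

(** Fubini's theorem. For a finite set [B] of rows the exchange is finite additivity; the other rows
    contribute at most the tail of the row sums [F]. *)
Lemma usum_exchange (I J : choiceType) (f : I -> J -> X) :
  (\esum_(i in [set: I]) \esum_(j in [set: J]) (rnorm (f i j))%:E < +oo)%E ->
  usum (fun i => usum (fun j => f i j)) = usum (fun j => usum (fun i => f i j)).
Proof.
pose F i := (\esum_(j in [set: J]) (rnorm (f i j))%:E)%E => ffin.
have F0 i : (0 <= F i)%E by apply: esum_ge0 => j _; rewrite lee_fin rnorm_ge0.
have fr i : (abssum (f i) < +oo)%E.
  by apply: le_lt_trans ffin; exact: (@le_term_esum _ _ F).
have ffin' : (\esum_(j in [set: J]) \esum_(i in [set: I]) (rnorm (f i j))%:E < +oo)%E.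
  by rewrite esum_exchange// => j i; rewrite lee_fin rnorm_ge0.
have fc j : (abssum (f^~ j) < +oo)%E.
  apply: le_lt_trans ffin'.
  apply: (@le_term_esum _ _ (fun j => \esum_(i in [set: I]) (rnorm (f i j))%:E)%E).
  by move=> k; apply: esum_ge0 => i _; rewrite lee_fin rnorm_ge0.
apply: has_usum_usum => e e0; have [A hA] := esum_tail F0 ffin e0.
exists A => B /hA h; rewrite -lee_fin; apply: le_trans h.
have [s1 s2] := usum_sum (enum_fset B) fr.
pose g i j := if i \in B then 0 else f i j.
have gf i j : rnorm (g i j) <= rnorm (f i j).
  by rewrite /g; case: ifP => // _; rewrite rnorm0 rnorm_ge0.
have gc j : (abssum (g^~ j) < +oo)%E.
  by apply: le_lt_trans (fc j); exact: le_abssum.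
have gg : (abssum (fun j => usum (g^~ j)) <=
    \esum_(i in [set: I]) (if i \in B then 0 else F i))%E.
  apply: (@le_trans _ _ (\esum_(j in [set: J]) abssum (g^~ j))%E).
    by apply: le_esum => j _; exact: rnorm_usum.
  rewrite esum_exchange; last by move=> j i; rewrite lee_fin rnorm_ge0.
  apply: le_esum => i _; rewrite /g; case: ifP => // _.
  by rewrite esum1// => j _; rewrite rnorm0.
have ggfin : (abssum (fun j => usum (g^~ j)) < +oo)%E.
  apply: le_lt_trans gg _; apply: le_lt_trans ffin.
  by apply: le_esum => i _; case: ifP => // _; exact: F0.
rewrite -s2.
rewrite (@eq_usum _ (fun j => usum (f^~ j)) (fun j => \sum_(i <- B) f i j + usum (g^~ j))).
  rewrite usumD// addrAC subrr add0r; exact: le_trans (rnorm_usum ggfin) gg.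
by move=> j; exact: usum_split.
Qed.

End UnorderedSums.

(** * Open mapping theorem *)

(* The norms live on subsets of the ambient modules, so that the spaces l^p need
   not be turned into normed types. [V_complete] combines completeness of the
   domain with continuity of [T]. *)
Section OpenMapping.
Variables (R : realType) (K : numFieldType) (sc : scalars R K).
Variables (V W : lmodType K) (DV : set V) (DW : set W) (nV : V -> R) (nW : W -> R).
Variables (T : V -> W) (M : R).
Hypothesis DVB : forall u v, DV u -> DV v -> DV (u - v) /\ nV (u - v) <= nV u + nV v.
Hypothesis DVZ : forall k v, DV v -> DV (k *: v) /\ nV (k *: v) = rabs sc k * nV v.
Hypothesis DWB : forall u v, DW u -> DW v -> DW (u - v) /\ nW (u - v) <= nW u + nW v.
Hypothesis DWZ : forall k v, DW v -> DW (k *: v) /\ nW (k *: v) = rabs sc k * nW v.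
Hypothesis M_ge0 : 0 <= M.
Hypothesis DV0 : DV 0.
Hypothesis DW0 : DW 0.
Hypothesis nW_ge0 : forall w, 0 <= nW w.
Hypothesis nW_eq0 : forall w, DW w -> nW w = 0 -> w = 0.
Hypothesis TB : forall u v, DV u -> DV v -> T (u - v) = T u - T v.
Hypothesis TZ : forall k v, DV v -> T (k *: v) = k *: T v.
Hypothesis TD : forall v, DV v -> DW (T v).
Hypothesis V_complete : forall (v : nat -> V) (B B' : R) (w : W),
  (forall n, DV (v n) /\ nV (v n) <= B / 2 ^+ n) -> DW w ->
  (forall n, nW (w - \sum_(k < n) T (v k)) <= B' / 2 ^+ n) ->
  exists s, [/\ DV s, nV s <= M * B & T s = w].
Hypothesis W_complete : forall (w : nat -> W) (d : nat -> R),
  (forall n, DW (w n)) -> (forall n, nW (w n.+1 - w n) <= d n) ->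
  (forall n, d n.+1 <= d n / 2) ->
  exists s, DW s /\ forall n, nW (s - w n) <= 2 * d n.
Hypothesis T_surj : forall w, DW w -> exists2 v, DV v & T v = w.

Let nW0 : nW 0 = 0.
Proof. by rewrite -(scale0r (0 : W)) (DWZ 0 DW0).2 /rabs normr0 modulus0 mul0r. Qed.

Let nV0 : nV 0 = 0.
Proof. by rewrite -(scale0r (0 : V)) (DVZ 0 DV0).2 /rabs normr0 modulus0 mul0r. Qed.

Let nWN w : DW w -> nW (- w) = nW w.
Proof. by move=> Dw; rewrite -scaleN1r (DWZ _ Dw).2 rabsN -[1](mulr1n 1) rabs_nat mul1r. Qed.

Let DWN w : DW w -> DW (- w).
Proof. by move=> Dw; rewrite -[- w]add0r; exact: (DWB DW0 Dw).1. Qed.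

Let DWD u v : DW u -> DW v -> DW (u + v).
Proof. by move=> Du Dv; rewrite -[v]opprK; exact: (DWB Du (DWN Dv)).1. Qed.

Let nWC u v : DW u -> DW v -> nW (u - v) = nW (v - u).
Proof. by move=> Du Dv; rewrite -(nWN (DWB Dv Du).1) opprB. Qed.

(** Baire's argument by hand. If no image of a ball were dense in a ball of [W], one could choose
    nested balls so that step [k] moves away from the image of the ball of radius [k]; the limit of
    the centres would then have no preimage. *)
Lemma image_somewhere_dense : exists k : nat, exists w0 : W, exists r : R,
  [/\ DW w0, 0 < r & forall w, DW w -> nW (w - w0) <= r -> forall e, 0 < e ->
    exists v, [/\ DV v, nV v <= k%:R & nW (w - T v) <= e]].
Proof.
apply: contrapT => hn.
pose P (s : W * R) := DW s.1 /\ 0 < s.2.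
(* The radii are at least halved, so the limit lies within twice the radius of each centre; hence
   the factor 2 in the last clause. *)
pose Q (k : nat) (s t : W * R) := [/\ P t, nW (t.1 - s.1) <= s.2, t.2 <= s.2 / 2 &
  forall v, DV v -> nV v <= k%:R -> 2 * t.2 < nW (t.1 - T v)].
have step (ks : nat * (W * R)) : exists t, P ks.2 -> Q ks.1 ks.2 t.
  case: ks => k [w0 r]; apply: contrapT => hs; apply: hn.
  have [[/= D0 r0]|nP] := pselect (P (w0, r)); last by case: hs; exists (w0, r).
  exists k, w0, r; split => // w Dw wr e e0; apply: contrapT => hv; apply: hs.
  (* Twice a third of [e] stays strictly below [e]. *)
  exists (w, Num.min (r / 2) (e / 3)) => _; split => //=.
  - by split => //=; rewrite lt_min !divr_gt0.
  - by rewrite ge_min lexx.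
  - move=> v Dv vk; rewrite ltNge; apply/negP => h; apply: hv; exists v; split => //.
    apply: le_trans h _.
    have : Num.min (r / 2) (e / 3) <= e / 3 by rewrite ge_min lexx orbT.
    by lra.
have [f hf] := choice step.
pose s := fix s n := if n is m.+1 then f (m, s m) else (0 : W, 1 : R).
have Ps n : P (s n).
  by elim: n => [//|n IH] /=; case: (hf (n, s n) IH).
have Qs n : Q n (s n) (s n.+1) by exact: (hf (n, s n) (Ps n)).
have [w [Dw hw]] := @W_complete (fun n => (s n).1) (fun n => (s n).2)
  (fun n => (Ps n).1) (fun n => let: And4 _ h _ _ := Qs n in h)
  (fun n => let: And4 _ _ h _ := Qs n in h).
have [v Dv Tv] := T_surj Dw.
have [k vk] : exists k : nat, nV v <= k%:R.
  exists (Num.bound `|nV v|).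
  exact: le_trans (ler_norm _) (ltW (archi_boundP (normr_ge0 _))).
case: (Qs k) => _ _ _ /(_ v Dv vk); rewrite Tv (nWC (Ps k.+1).1 Dw) ltNge.
by rewrite hw.
Qed.

(** Writing [w] as [(w + w0) - w0] moves the centre to 0 and doubles the bound on preimages. *)
Lemma image_dense_near0 : exists k : nat, exists r : R,
  0 < r /\ forall w, DW w -> nW w <= r -> forall e, 0 < e ->
    exists v, [/\ DV v, nV v <= k%:R & nW (w - T v) <= e].
Proof.
have [k [w0 [r [D0 r0 h]]]] := image_somewhere_dense.
exists (k + k)%N, r; split => // w Dw wr e e0.
have e20 : 0 < e / 2 by rewrite divr_gt0.
have [|v1 [Dv1 v1k v1e]] := h (w + w0) (DWD Dw D0) _ _ e20; first by rewrite addrK.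
have [|v2 [Dv2 v2k v2e]] := h w0 D0 _ _ e20; first by rewrite subrr nW0 ltW.
exists (v1 - v2); split; first exact: (DVB Dv1 Dv2).1.
  by rewrite natrD; apply: le_trans (DVB Dv1 Dv2).2 (lerD _ _).
rewrite TB//.
have -> : w - (T v1 - T v2) = (w + w0 - T v1) - (w0 - T v2).
  by rewrite !opprB (addrAC w w0) [T v2 - w0]addrC [in RHS]addrA addrK addrA addrAC.
have D1 : DW (w + w0 - T v1) by apply: (DWB _ _).1; [exact: DWD|exact: TD].
have D2 : DW (w0 - T v2) by apply: (DWB _ _).1 => //; exact: TD.
by apply: le_trans (DWB D1 D2).2 _; lra.
Qed.

(** Successive approximation: after [n] corrections the residual has norm at most [r / 2 ^+ n], and
    scaling it by [2 ^+ n] returns it to the ball where images are dense. [V_complete] sums the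
    corrections. *)
Lemma open_mapping : exists2 C : R, 0 <= C &
  forall w, DW w -> exists v, [/\ DV v, T v = w & nV v <= C * nW w].
Proof.
have [k [r [r0 h]]] := image_dense_near0.
have rabs2 n : rabs sc (2 ^+ n) = 2 ^+ n by rewrite -natrX rabs_nat natrX.
have p2 n : 0 < 2 ^+ n :> R by rewrite exprn_gt0.
have step (nw : nat * W) : exists v, DW nw.2 -> nW nw.2 <= r / 2 ^+ nw.1 ->
    [/\ DV v, nV v <= k%:R / 2 ^+ nw.1 & nW (nw.2 - T v) <= r / 2 ^+ nw.1.+1].
  case: nw => n w /=.
  have [[Dw wr]|nD] := pselect (DW w /\ nW w <= r / 2 ^+ n); last first.
    by exists 0 => Dw wr; case: nD.
  have [D' E'] := DWZ (2 ^+ n) Dw.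
  have [||v [Dv vk ve]] := h (2 ^+ n *: w) D' _ (r / 2); rewrite ?divr_gt0//.
    by rewrite E' rabs2 mulrC -ler_pdivlMr.
  have [D2 E2] := DVZ (2 ^+ n)^-1 Dv.
  exists ((2 ^+ n)^-1 *: v) => _ _; split => //.
    by rewrite E2 rabsV rabs2 mulrC ler_pM2r// invr_gt0.
  have -> : w - T ((2 ^+ n)^-1 *: v) = (2 ^+ n)^-1 *: (2 ^+ n *: w - T v).
    by rewrite TZ// scalerBr scalerA mulVf ?scale1r// expf_neq0.
  rewrite (DWZ _ _).2; last by apply: (DWB D' _).1; exact: TD.
  rewrite rabsV rabs2 exprS invfM mulrA [leRHS]mulrC ler_pM2l// invr_gt0//.
have [f hf] := choice step.
have small w : DW w -> nW w <= r -> exists v, [/\ DV v, T v = w & nV v <= M * k%:R].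
  move=> Dw wr; pose u := fix u n := if n is m.+1 then u m - T (f (m, u m)) else w.
  pose v n := f (n, u n).
  have uP n : DW (u n) /\ nW (u n) <= r / 2 ^+ n.
    elim: n => [|n [IH1 IH2]] /=; first by rewrite expr0 divr1.
    have [D1 D2 D3] := hf (n, u n) IH1 IH2; split => //.
    by apply: (DWB IH1 _).1; exact: TD.
  have vP n : DV (v n) /\ nV (v n) <= k%:R / 2 ^+ n.
    by have [D1 D2 D3] := hf (n, u n) (uP n).1 (uP n).2; split.
  have uE n : w - \sum_(k < n) T (v k) = u n.
    elim: n => [|n IH]; first by rewrite big_ord0 subr0.
    by rewrite big_ord_recr /= opprD addrA IH.
  have [|s [s1 s2 s3]] := @V_complete v k%:R r w vP Dw; last by exists s.
  by move=> n; rewrite uE; exact: (uP n).2.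
exists (M * k%:R / r); first by rewrite divr_ge0 ?(ltW r0)// mulr_ge0.
move=> w Dw; have [w0|wn0] := eqVneq (nW w) 0.
  exists 0; split => //; last by rewrite nV0 w0 mulr0.
  by rewrite (nW_eq0 Dw w0) -(scale0r (0 : V)) TZ// scale0r.
have wp : 0 < nW w by rewrite lt0r wn0 nW_ge0.
(* Scaling by [c] brings [w] to norm exactly [r]. *)
pose c := ofR sc (r / nW w).
have rc : rabs sc c = r / nW w.
  rewrite /rabs /c ger0_norm ?modulus_ofR//.
  by case: sc => /=; rewrite ?lecR divr_ge0// ltW.
have c0 : c != 0.
  apply/eqP => c0; move: rc; rewrite c0 /rabs normr0 modulus0 => /esym/eqP.
  by rewrite gt_eqF// divr_gt0.
have [D' E'] := DWZ c Dw.
have [|v [Dv Tv vk]] := small (c *: w) D'; first by rewrite E' rc divfK.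
have [D2 E2] := DVZ c^-1 Dv.
exists (c^-1 *: v); split => //; first by rewrite TZ// Tv scalerA mulVf// scale1r.
rewrite E2 rabsV rc invf_div.
have -> : M * k%:R / r * nW w = nW w / r * (M * k%:R) by ring.
by apply: ler_wpM2l => //; rewrite divr_ge0// ltW.
Qed.

End OpenMapping.

(** * Wiener operators *)

Section Lattice.
Variable N : nat.
Local Notation ZN := 'rV[int]_N.
Implicit Types i j : ZN.

Lemma zabs_leP i m : reflect (forall k, (absz (i ord0 k) <= m)%N) (zabs i <= m)%N.
Proof.
rewrite /zabs; apply: (iffP (bigmax_leqP _ _ _)) => [h k|h k _]; last exact: h.
exact: h.
Qed.

Lemma absz_le_zabs i k : (absz (i ord0 k) <= zabs i)%N.
Proof. exact: (zabs_leP i (zabs i) (leqnn _)). Qed.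

Lemma zabsN i : zabs (- i) = zabs i.
Proof. by apply: eq_bigr => k _; rewrite mxE abszN. Qed.

Lemma zabsD i j : (zabs (i + j) <= zabs i + zabs j)%N.
Proof.
apply/zabs_leP => k; rewrite mxE.
move: (absz_le_zabs i k) (absz_le_zabs j k).
move: (i ord0 k) (j ord0 k) (zabs i) (zabs j) => a b c d; lia.
Qed.

Lemma zabsB i j : (zabs (i - j) <= zabs i + zabs j)%N.
Proof. by rewrite -(zabsN j); exact: zabsD. Qed.

Lemma zabs0 : zabs (0 : ZN) = 0%N.
Proof. by apply/eqP; rewrite -leqn0; apply/zabs_leP => k; rewrite mxE. Qed.

Lemma zabs_triangle i j : (zabs i <= zabs j + zabs (i - j))%N.
Proof. by rewrite -{1}(subrK j i) addrC; exact: zabsD. Qed.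

Definition zball m : {fset ZN} :=
  [fset i in [seq \row_k ((f k)%:Z - m%:Z) | f : {ffun 'I_N -> 'I_(m + m).+1}]]%fset.

Lemma zabs_zball i m : (zabs i <= m)%N -> i \in zball m.
Proof.
move=> /zabs_leP im; rewrite /zball inE; apply/mapP => /=.
exists [ffun k => inord (absz (i ord0 k + m%:Z))]; first by rewrite mem_enum.
apply/rowP => k; have imk := im k; rewrite mxE ffunE inordK.
  by rewrite -[i 0 k]/(i ord0 k); move: (i ord0 k) imk => z; lia.
by move: (i ord0 k) imk => z; lia.
Qed.

Lemma fset_zabs (A : {fset ZN}) : exists m, forall i, i \in A -> (zabs i < m)%N.
Proof.
exists (\max_(i <- A) (zabs i).+1) => i iA.
exact: (@leq_bigmax_seq _ _ xpredT (fun i => (zabs i).+1)).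
Qed.

End Lattice.

(* |m - n|: one of the truncated differences vanishes. *)
Definition ndist (m n : nat) : nat := (m - n + (n - m))%N.

Section WienerOperators.
Variables (R : realType) (K : numFieldType) (sc : scalars R K).
Variables (N : nat) (X : completeNormedModType K).
Local Notation ZN := 'rV[int]_N.
Local Notation rnorm := (rnorm sc).
Implicit Types x y : ZN -> X.

Definition nrm x (i : ZN) : \bar R := (rnorm (x i))%:E.

Lemma nrm_ge0 x i : (0 <= nrm x i)%E.
Proof. by rewrite lee_fin rnorm_ge0. Qed.

Lemma lpnormE p x : lpnorm sc p x = nu p (nrm x).
Proof. by case: p. Qed.

Lemma vanishE x : vanishes_at_infinity sc x <-> null (nrm x).
Proof.
split => [h e e0|h e e0].
  have [m hm] := h e e0; exists (zball N m) => i /negP iA.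
  rewrite lee_fin ltW//; apply: hm; rewrite leqNgt; apply/negP => im.
  by apply: iA; apply: zabs_zball; exact: ltnW.
have [A hA] := h _ (divr_gt0 e0 (ltr0n _ 2)); have [m hm] := fset_zabs A.
exists m => i mi; have : i \notin A by apply/negP => /hm; rewrite ltnNge mi.
by move/hA; rewrite lee_fin; lra.
Qed.

Lemma lpE p x : lp sc p x <-> lpmem p (nrm x).
Proof.
rewrite /lp /lpmem /nexp -lpnormE; case: eqVneq => [p0|p0].
  split => -[h1 h2]; split => //; first by move=> _; exact/vanishE.
  exact/vanishE/h2.
split => [h|[]//]; split => // p0'; by rewrite p0' eqxx in p0.
Qed.

Definition bounded x := exists c : R, forall i, rnorm (x i) <= c.

Lemma lp_bounded p x : exponent p -> lp sc p x -> bounded x.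
Proof.
move=> ep /lpE /(lpmem_bound ep (nrm_ge0 x))[c c0 hc].
by exists c => i; have := hc i; rewrite lee_fin.
Qed.

Lemma bounded_lp x : bounded x -> lp sc +oo%E x.
Proof.
move=> [c hc]; apply/lpE; split => //=; apply: (@le_lt_trans _ _ c%:E); rewrite ?ltry//.
by apply: ge_ereal_sup => _ [i _ <-]; rewrite lee_fin.
Qed.

Lemma boundedZ k x : bounded x -> bounded (k *: x).
Proof.
move=> [c hc]; exists (rabs sc k * c) => i; rewrite rnormZ.
by apply: ler_wpM2l => //; exact: rabs_ge0.
Qed.

Lemma boundedN x : bounded x -> bounded (- x).
Proof. by move=> [c hc]; exists c => i; rewrite rnormN. Qed.

Lemma nrmD x y i : (nrm (x + y)%R i <= nrm x i + nrm y i)%E.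
Proof. by rewrite /nrm -EFinD lee_fin rnormD. Qed.

Lemma nrmB x y i : (nrm (x - y)%R i <= nrm x i + nrm y i)%E.
Proof. by rewrite /nrm -EFinD lee_fin rnormB. Qed.

Lemma nrmZ k x i : (nrm (k *: x) i = (rabs sc k)%:E * nrm x i)%E.
Proof. by rewrite /nrm -EFinM -rnormZ. Qed.

Lemma lpD p x y : exponent p -> lp sc p x -> lp sc p y -> lp sc p (x + y).
Proof.
move=> ep /lpE xp /lpE yp; apply/lpE.
apply: (lpmem_le ep (nrm_ge0 _) (nrmD x y)).
by apply: (lpmemD ep) => // i; exact: nrm_ge0.
Qed.

Lemma lpZ p k x : exponent p -> lp sc p x -> lp sc p (k *: x).
Proof.
move=> ep /lpE xp; apply/lpE.
rewrite (_ : nrm _ = (fun i => (rabs sc k)%:E * nrm x i)%E); last first.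
  by apply/funext => i; exact: nrmZ.
by apply: (lpmemZ ep) => // [i|]; [exact: nrm_ge0|exact: rabs_ge0].
Qed.

Lemma lpN p x : exponent p -> lp sc p x -> lp sc p (- x).
Proof. by move=> ep xp; rewrite -scaleN1r; exact: lpZ. Qed.

Lemma lpB p x y : exponent p -> lp sc p x -> lp sc p y -> lp sc p (x - y).
Proof. by move=> ep xp yp; apply: lpD => //; exact: lpN. Qed.

Lemma lp0 p : exponent p -> lp sc p (0 : ZN -> X).
Proof.
move=> ep; apply/lpE; apply: (lpmem_mass ep (nrm_ge0 _)).
by rewrite /mass esum1 ?ltry// => i _; rewrite /nrm rnorm0.
Qed.

Lemma lp_sum p (I : Type) (s : seq I) (x : I -> ZN -> X) : exponent p ->
  (forall j, lp sc p (x j)) -> lp sc p (\sum_(j <- s) x j).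
Proof.
move=> ep xp; elim/big_ind: _ => // [|u v]; first exact: lp0.
exact: lpD.
Qed.

Variable A : wiener sc N X.

(** The scalar convolution kernel that dominates [A] on sequences of norms, see [nrm_op]. *)
Definition wmajor (al : ZN) : \bar R :=
  ereal_sup (range (fun i => opnorm sc (coef A al i))).

Lemma opnorm_ge0 (T : {linear X -> X}) : (0 <= opnorm sc T)%E.
Proof.
apply: ereal_sup_ubound; exists 0; first by rewrite /= rnorm0.
by rewrite raddf0 rnorm0.
Qed.

Lemma opnorm_wmajor al i : (opnorm sc (coef A al i) <= wmajor al)%E.
Proof. by apply: ereal_sup_ubound; exists i. Qed.

Lemma wmajor_ge0 al : (0 <= wmajor al)%E.
Proof. by apply: le_trans (opnorm_wmajor al 0); exact: opnorm_ge0. Qed.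

Lemma mass_wmajor : (mass wmajor < +oo)%E.
Proof. exact: wnorm_coef A. Qed.

Lemma wmajor_fin al : (wmajor al \is a fin_num).
Proof.
rewrite ge0_fin_numE ?wmajor_ge0//; apply: le_lt_trans mass_wmajor.
exact: (le_term_esum al wmajor_ge0).
Qed.

Lemma rnorm_coef al i (v : X) :
  rnorm (coef A al i v) <= fine (wmajor al) * rnorm v.
Proof.
have [v0|v0] := eqVneq (rnorm v) 0.
  by rewrite (rnorm0_eq0 v0) raddf0 rnorm0 mulr0.
rewrite -ler_pdivrMr; last by rewrite lt0r v0 rnorm_ge0.
rewrite -lee_fin fineK ?wmajor_fin//; apply: le_trans (opnorm_wmajor al i).
have v'0 : `|v| != 0.
  by apply: contra v0 => /eqP v0; rewrite /Defs.rnorm v0 modulus0.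
apply: ereal_sup_ubound; exists (`|v|^-1 *: v) => /=.
  by rewrite /Defs.rnorm normrZ normfV normr_id mulVf// modulus1.
by rewrite linearZ /= rnormZ rabsV /rabs normr_id mulrC.
Qed.

Lemma nrm_coef al i (v : X) :
  ((rnorm (coef A al i v))%:E <= wmajor al * (rnorm v)%:E)%E.
Proof. by rewrite -(fineK (wmajor_fin al)) -EFinM lee_fin rnorm_coef. Qed.

Lemma conv_fin x i : bounded x -> (conv wmajor (nrm x) i < +oo)%E.
Proof.
move=> [c hc].
apply: (@le_lt_trans _ _ (mass wmajor * c%:E)%E).
  by apply: conv_le_sup => [|j|j]; [exact: wmajor_ge0|exact: nrm_ge0|rewrite lee_fin].
rewrite -(fineK (_ : mass wmajor \is a fin_num)) ?ge0_fin_numE ?mass_wmajor//.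
  by rewrite -EFinM ltry.
by apply: mass_ge0; exact: wmajor_ge0.
Qed.

Definition wterm x i al := coef A al i (x (i - al)).

Lemma abssum_wterm x i : (abssum sc (wterm x i) <= conv wmajor (nrm x) i)%E.
Proof. by apply: le_esum => al _; exact: nrm_coef. Qed.

Lemma abssum_wterm_fin x i : bounded x -> (abssum sc (wterm x i) < +oo)%E.
Proof. by move=> /(conv_fin i); apply: le_lt_trans; exact: abssum_wterm. Qed.

Lemma nrm_op x i : bounded x -> (nrm (wiener_op A x) i <= conv wmajor (nrm x) i)%E.
Proof.
move=> bx; apply: le_trans (abssum_wterm x i).
by apply: rnorm_usum; exact: abssum_wterm_fin.
Qed.

Lemma opD x y : bounded x -> bounded y ->
  wiener_op A (x + y) = wiener_op A x + wiener_op A y.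
Proof.
move=> bx bby; apply/funext => i.
rewrite [RHS]/GRing.add /= -(usumD (abssum_wterm_fin i bx) (abssum_wterm_fin i bby)).
by apply: eq_usum => al; rewrite /wterm raddfD.
Qed.

Lemma opZ k x : bounded x -> wiener_op A (k *: x) = k *: wiener_op A x.
Proof.
move=> bx; apply/funext => i.
rewrite [RHS]/GRing.scale /= (@usum_morph _ _ sc _ _ ( *:%R k) (rabs sc k) (wterm x i)).
- by apply: eq_usum => al; rewrite /wterm linearZ.
- exact: rabs_ge0.
- by move=> v; rewrite rnormZ.
- exact: abssum_wterm_fin.
Qed.

Lemma opN x : bounded x -> wiener_op A (- x) = - wiener_op A x.
Proof. by move=> bx; rewrite -scaleN1r opZ// scaleN1r. Qed.

Lemma opB x y : bounded x -> bounded y ->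
  wiener_op A (x - y) = wiener_op A x - wiener_op A y.
Proof. by move=> bx bby; rewrite opD ?opN//; exact: boundedN. Qed.

Lemma op0 : wiener_op A 0 = 0.
Proof.
rewrite -{1}(scale0r (0 : ZN -> X)) opZ ?scale0r//; exists 0 => i.
by rewrite rnorm0.
Qed.

Lemma op_lp p x : exponent p -> lp sc p x -> lp sc p (wiener_op A x).
Proof.
move=> ep xp; have bx := lp_bounded ep xp; move/lpE: xp => xp; apply/lpE.
apply: (lpmem_le ep (nrm_ge0 _)) => [i|]; first exact: nrm_op.
apply: (lpmem_conv ep) => // [i|i|]; [exact: wmajor_ge0|exact: nrm_ge0|exact: mass_wmajor].
Qed.

(* Cutoffs take natural values and act by multiples, which avoids embedding real
   scalars into [K]. *)
Definition weight (chi : ZN -> nat) x : ZN -> X := fun i => x i *+ chi i.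

Lemma rnorm_mulnB (v : X) (m n : nat) :
  rnorm (v *+ m - v *+ n) = rnorm v * (ndist m n)%:R.
Proof.
wlog nm : m n / (n <= m)%N => [hw|].
  have [/hw//|/ltnW/hw h] := leqP n m.
  by rewrite -rnormN opprB h /ndist addnC.
rewrite -mulrnBr// rnormMn; congr (_ * _%:R).
by rewrite /ndist (eqP nm) addn0.
Qed.

(** The commutator again has the form of a sum over [al], with the coefficient of the shift by [al]
    multiplied by [chi (i - al) - chi i]; only the variation of the cutoff along [al] enters. *)
Lemma commutator chi x i : bounded x -> bounded (weight chi x) ->
  (nrm (wiener_op A (weight chi x) - weight chi (wiener_op A x))%R i <=
   \esum_(al in [set: ZN])
     (wmajor al * ((ndist (chi (i - al)%R) (chi i))%:R%:E * nrm x (i - al)%R)))%E.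
Proof.
move=> bx bcx.
pose d al := wterm (weight chi x) i al + (- (chi i)%:R) *: wterm x i al.
have cE : usum (fun al => (- (chi i)%:R) *: wterm x i al) = - (wiener_op A x i *+ chi i).
  rewrite -(@usum_morph _ _ sc _ _ ( *:%R (- (chi i)%:R)) (rabs sc (- (chi i)%:R)) (wterm x i)).
  - by rewrite /= scaleNr scaler_nat.
  - exact: rabs_ge0.
  - by move=> v; rewrite rnormZ.
  - exact: abssum_wterm_fin.
have f1 := abssum_wterm_fin i bcx.
have f2 : (abssum sc (fun al => (- (chi i)%:R) *: wterm x i al)%R < +oo)%E.
  rewrite /abssum (@eq_esum _ _ _ _ (fun al => (rabs sc (- (chi i)%:R))%:E * (rnorm (wterm x i al))%:E)%E).
    rewrite esumZl ?lee_fin ?rabs_ge0//; last by move=> al; rewrite lee_fin rnorm_ge0.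
    apply: lte_mul_pinfty => //; first by rewrite lee_fin rabs_ge0.
    exact: abssum_wterm_fin.
  by move=> al _; rewrite rnormZ EFinM.
have E : wiener_op A (weight chi x) i - wiener_op A x i *+ chi i = usum d.
  by rewrite -cE /wiener_op -(usumD f1 f2).
have db al : ((rnorm (d al))%:E <= wmajor al *
    ((ndist (chi (i - al)) (chi i))%:R%:E * nrm x (i - al)%R))%E.
  rewrite /d /wterm /weight raddfMn scaleNr scaler_nat rnorm_mulnB EFinM.
  rewrite [leRHS]muleCA [leRHS]muleC.
  by apply: lee_wpmul2r; rewrite ?lee_fin//; exact: nrm_coef.
rewrite /nrm [X in rnorm X]E; apply: le_trans (rnorm_usum (sc := sc) _) _.
  exact: (abssumD f1 f2).
by apply: le_esum => al _; exact: db.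
Qed.

(** In l^oo the superposition need not converge in norm. Absolute summability at each site is
    enough, by boundedness of each coefficient and Fubini's theorem. *)
Lemma op_usum (J : choiceType) (x : J -> ZN -> X) i :
  (forall k, \esum_(j in [set: J]) nrm (x j) k < +oo)%E ->
  (\esum_(j in [set: J]) conv wmajor (nrm (x j)) i < +oo)%E ->
  wiener_op A (fun k => usum (fun j => x j k)) i = usum (fun j => wiener_op A (x j) i).
Proof.
move=> xf cf; rewrite /wiener_op.
have E al : coef A al i (usum (fun j => x j (i - al))) =
    usum (fun j => coef A al i (x j (i - al))).
  apply: (@usum_morph _ _ sc _ _ _ (fine (wmajor al))) => //.
  - by rewrite fine_ge0// wmajor_ge0.
  - by move=> v; exact: rnorm_coef.
  - exact: xf.
rewrite (eq_usum E); apply: (@usum_exchange _ _ sc); rewrite esum_exchange.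
  by apply: le_lt_trans cf; apply: le_esum => j _; exact: abssum_wterm.
by move=> *; rewrite lee_fin rnorm_ge0.
Qed.

End WienerOperators.

(** * Localization *)

Section GeometricSums.
Variable R : realType.

Lemma pow2_small (c e : R) : 0 < e -> exists n : nat, c / 2 ^+ n <= e.
Proof.
move=> e0; pose n := Num.bound (`|c| / e); exists n.
rewrite ler_pdivrMr ?exprn_gt0// mulrC -ler_pdivrMr//.
apply: (@le_trans _ _ (`|c| / e)); first by rewrite ler_pM2r ?invr_gt0// ler_norm.
have : `|c| / e < n%:R by apply: archi_boundP; rewrite divr_ge0// ltW.
move=> /ltW/le_trans; apply; rewrite -natrX ler_nat; exact/ltnW/ltn_expl.
Qed.

Lemma esum_pow2 : (\esum_(n in [set: nat]) ((2 ^+ n)^-1 : R)%:E <= 2%:E)%E.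
Proof.
have p0 n : (0 <= ((2 ^+ n)^-1 : R)%:E)%E by rewrite lee_fin invr_ge0 exprn_ge0.
apply: ge_esum => A; pose M := \max_(i <- A) i.+1.
apply: (@le_trans _ _ (\sum_(0 <= n < M) ((2 ^+ n)^-1 : R)%:E)%E).
  apply: lee_sum_fset_nat => // i /= iA.
  exact: (@leq_bigmax_seq _ _ xpredT (fun i => i.+1)).
rewrite sumEFin lee_fin.
suff -> : \sum_(0 <= n < M) (2 ^+ n)^-1 = 2 - 2 * (2 ^+ M)^-1 :> R.
  by rewrite gerBl mulr_ge0// invr_ge0 exprn_ge0.
elim: M => [|M IH]; first by rewrite big_geq// expr0 invr1 mulr1 subrr.
by rewrite big_nat_recr//= IH exprS invfM; field; rewrite expf_neq0.
Qed.

Lemma esum_fin1 (T : finType) : (\esum_(i in [set: T]) 1 <= (#|T|%:R : R)%:E)%E.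
Proof.
apply: ge_esum => A; rewrite sumEFin lee_fin.
rewrite -(natr_sum _ _ _ (fun=> 1%N)) sum1_size ler_nat cardE.
by apply: uniq_leq_size (fset_uniq A) _ => i _; rewrite mem_enum.
Qed.

End GeometricSums.

(** * Neumann series of convolution kernels *)

Section Neumann.
Variables (R : realType) (G : zmodType).
Local Open Scope ereal_scope.
Implicit Types (kap g b H : G -> \bar R).

(** [H] is the sum of the convolution powers of [kap]. Iterating the inequality [J] times leaves the
    power [J] of [kap] convolved with [b], at most [c / 2 ^+ J]; boundedness of [b] is what makes
    this remainder vanish. *)
Lemma neumann kap : (forall i, 0 <= kap i) -> mass kap <= (2^-1)%:E ->
  exists H, [/\ forall i, 0 <= H i, mass H < +oo &
    forall g b (c : R), (forall i, 0 <= g i) -> (forall i, 0 <= b i) ->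
      (forall i, b i <= c%:E) -> (forall k, b k <= g k + conv kap b k) ->
      forall k, b k <= conv H g k].
Proof.
move=> k0 khalf.
pose pw := fix pw n : G -> \bar R := if n is m.+1 then conv (pw m) kap
  else fun a => if a == 0%R then 1 else 0.
have pw0 n i : 0 <= pw n i.
  elim: n i => [|n IH] i /=; first by case: ifP.
  by apply: conv_ge0.
have pwm n : mass (pw n) <= ((2 ^+ n)^-1)%:E.
  elim: n => [|n IH] /=.
    rewrite /mass (@esum_dirac _ _ _ 0%R) ?eqxx ?expr0 ?invr1//.
    by move=> i /negPf ->.
  rewrite mass_conv// exprS invfM mulrC EFinM.
  by apply: lee_pmul => //; exact: mass_ge0.
exists (fun i => \esum_(n in [set: nat]) pw n i); split.
- by move=> i; exact: esum_ge0.
- rewrite /mass esum_exchange; last by [].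
  apply: (@le_lt_trans _ _ 2%:E); last exact: ltry.
  apply: le_trans (esum_pow2 R); apply: le_esum => n _; exact: pwm.
move=> g b c g0 b0 bc bk k.
have step J : b k <= \sum_(0 <= j < J) conv (pw j) g k + conv (pw J) b k.
  elim: J => [|J IH]; first by rewrite big_geq// add0e conv_dirac// subr0.
  apply: le_trans IH _; rewrite big_nat_recr//= -addeA; apply: leeD2l.
  rewrite conv_assoc// -convDr//; last by move=> i; exact: conv_ge0.
  exact: le_conv.
apply/lee_addgt0Pr => e e0; have [J hJ] := pow2_small c e0.
apply: le_trans (step J) _; apply: leeD.
  rewrite conv_esuml//.
  apply: uniq_seq_le_esum; exact: iota_uniq.
apply: le_trans (conv_le_sup k (pw0 J) b0 bc) _.
have c0 : 0 <= c%:E by apply: le_trans (bc k).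
apply: le_trans (lee_wpmul2r c0 (pwm J)) _.
by rewrite -EFinM lee_fin mulrC.
Qed.

Lemma convE H g k : conv H g k = \esum_(i in [set: G]) H (k - i)%R * g i.
Proof.
rewrite /conv (reindex_esumT _ (subr_bij k)); apply: eq_esum => i _.
by rewrite opprB addrCA subrr addr0.
Qed.

End Neumann.

(** * Tent-shaped cutoffs *)

Section Tents.
Variable N : nat.
Local Notation ZN := 'rV[int]_N.

Definition tent (h : nat) (k i : ZN) : nat := (h + h - zabs (i - k))%N.

Definition eshift (h : nat) (f : {ffun 'I_N -> 'I_4}) : ZN :=
  \row_t (h%:Z * ((f t)%:Z - 2%:Z)).

(* 4^N translates of the half-height parts of tents cover the ball of radius 2h,
   uniformly in h. *)
Lemma tent_cover h k j : (zabs (j - k) < h + h)%N ->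
  exists f, (h <= tent h (k + eshift h f) j)%N.
Proof.
rewrite /tent; under eq_exists do rewrite opprD addrA.
move: (j - k) => d jk; have h0 : (0 < h)%N by move: jk; case: h.
have dk t : (absz (d ord0 t) < h + h)%N.
  by apply: leq_ltn_trans jk; exact: absz_le_zabs.
(* In each coordinate [d + 2h] lies strictly between 0 and [4h]; the quotient by [h] selects one of
   four cells, and the remainder is the distance to the left end of that cell. *)
exists [ffun t => inord (absz (d ord0 t + (h + h)%:Z) %/ h)].
set f := finfun _; suff : (zabs (d - eshift h f) <= h)%N.
  by move=> dh; apply: leq_trans (leq_sub2l _ dh); rewrite addnK.
apply/zabs_leP => t; rewrite mxE [(- eshift _ _) _ _]mxE [eshift _ _ _ _]mxE ffunE.
have := dk t; move: (d ord0 t) => z zh.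
rewrite inordK; last by rewrite ltn_divLR//; lia.
have := divn_eq (absz (z + (h + h)%:Z)) h; have := ltn_pmod (absz (z + (h + h)%:Z)) h0.
move: (absz _ %/ h)%N (absz _ %% h)%N => q r; nia.
Qed.

Lemma tent_lip h k (i al : ZN) :
  (ndist (tent h k (i - al)) (tent h k i) <= minn (h + h) (zabs al))%N.
Proof.
rewrite /ndist /tent addrAC; move: (i - k) => d.
have := zabs_triangle d (d - al); have := zabs_triangle (d - al) d.
rewrite subKr addrAC subrr sub0r zabsN.
move: (zabs (d - al)) (zabs d) (zabs al) => u v w; lia.
Qed.

Lemma tent_far h k i : (h + h <= zabs (i - k))%N -> tent h k i = 0%N.
Proof. by move=> ik; apply/eqP; rewrite subn_eq0. Qed.

Lemma tent_le h k i : (tent h k i <= h + h)%N.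
Proof. exact: leq_subr. Qed.

End Tents.

Section Sjostrand.
Variables (R : realType) (N : nat).
Local Notation ZN := 'rV[int]_N.
Local Open Scope ereal_scope.

(** The factor bounds the change of a tent under a shift by [al] ([tent_lip]), measured relative to
    half its height. *)
Definition lipw (a : ZN -> \bar R) (h : nat) (al : ZN) : \bar R :=
  a al * ((minn (h + h) (zabs al))%:R / h%:R : R)%:E.

Lemma lipw_ge0 a h al : (forall i, 0 <= a i) -> 0 <= lipw a h al.
Proof. by move=> a0; apply: mule_ge0 => //; rewrite lee_fin divr_ge0. Qed.

(** Dominated convergence: the factor in [lipw] is at most 2 and tends to 0 for each fixed [al].
    Outside the finite set [B] the mass [e / 4] is doubled at worst; inside, the factor is at most
    [m / h]. *)
Lemma mass_lipw_small (a : ZN -> \bar R) (e : R) : (forall i, 0 <= a i) ->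
  mass a < +oo -> (0 < e)%R ->
  exists h0, forall h, (h0 <= h)%N -> (0 < h)%N /\ mass (lipw a h) <= e%:E.
Proof.
move=> a0 afin e0.
have [M ME] : exists M, mass a = M%:E.
  by exists (fine (mass a)); rewrite fineK// ge0_fin_numE// mass_ge0.
have M0 : (0 <= M)%R by rewrite -lee_fin -ME mass_ge0.
have e40 : (0 < e / 4)%R by rewrite divr_gt0.
have [B hB] := esum_tail a0 afin e40; have [m hm] := fset_zabs B.
pose h0 := (Num.bound (M * m%:R / (e / 2))).+1; exists h0 => h hh.
have h_gt0 : (0 < h)%N by exact: leq_trans hh.
have hR : (0 < h%:R :> R)%R by rewrite ltr0n.
split => //.
have small : (M * (m%:R / h%:R) <= e / 2)%R.
  rewrite mulrA ler_pdivrMr// [leRHS]mulrC -ler_pdivrMr ?divr_gt0//.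
  have : (M * m%:R / (e / 2) < (Num.bound (M * m%:R / (e / 2)))%:R)%R.
    by apply: archi_boundP; rewrite !mulr_ge0// invr_ge0 divr_ge0 ?(ltW e0).
  by move=> /ltW/le_trans; apply; rewrite ler_nat; exact: ltnW.
apply: (@le_trans _ _ (\esum_(al in [set: ZN]) (a al * (m%:R / h%:R : R)%:E +
    (if al \in B then 0 else a al) * 2%:E))).
  apply: le_esum => al _; rewrite /lipw; case: ifPn => aB.
    rewrite mul0e adde0; apply: lee_wpmul2l => //.
    rewrite lee_fin ler_pM2r ?invr_gt0// ler_nat geq_min; apply/orP; right.
    exact/ltnW/hm.
  apply: (@le_trans _ _ (a al * 2%:E)).
    apply: lee_wpmul2l => //; rewrite lee_fin ler_pdivrMr// -natrM ler_nat.
    by rewrite geq_min mul2n addnn leqnn.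
  by rewrite leeDr// mule_ge0// lee_fin divr_ge0.
rewrite esumD; last 2 first.
- by move=> al _; rewrite mule_ge0// lee_fin divr_ge0.
- by move=> al _; rewrite mule_ge0//; case: ifP.
rewrite !esumZr ?lee_fin ?divr_ge0//; last by move=> al; case: ifP.
rewrite [X in X * _ + _](_ : _ = M%:E)//.
apply: (@le_trans _ _ (M%:E * (m%:R / h%:R : R)%:E + (e / 4)%:E * 2%:E)).
  by rewrite leeD2l//; apply: lee_wpmul2r => //; exact: hB.
rewrite -!EFinM -EFinD lee_fin; lra.
Qed.

End Sjostrand.

Lemma mass_fset (R : realType) (G : zmodType) (r : G -> R) (B : {fset G}) :
  (forall i, 0 <= r i) -> (forall i, i \notin B -> r i = 0) ->
  (mass (fun i => (r i)%:E) < +oo)%E.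
Proof.
move=> r0 rB; rewrite /mass.
rewrite (@eq_esum _ _ _ _ (fun i => if i \in B then (r i)%:E else 0%E)).
  by rewrite esum_fset_mem ?sumEFin ?ltry// => i; rewrite lee_fin.
by move=> i _; case: ifPn => // /rB ->.
Qed.

Section Domination.
Variables (R : realType) (K : numFieldType) (sc : scalars R K).
Variables (N : nat) (X : completeNormedModType K) (A : wiener sc N X).
Local Notation ZN := 'rV[int]_N.
Local Notation nrm := (nrm sc).
Local Open Scope ereal_scope.
Variables (p : \bar R) (p1 : 1 <= p).
Implicit Types x : ZN -> X.

Let I4 := {ffun 'I_N -> 'I_4}.

Definition tentn h x (k i : ZN) : \bar R := (tent h k i)%:R%:E * nrm x i.

Lemma tentn_ge0 h x k i : 0 <= tentn h x k i.
Proof. by apply: mule_ge0; [rewrite lee_fin|exact: nrm_ge0]. Qed.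

Lemma nrm_weight chi x i : nrm (weight chi x) i = (chi i)%:R%:E * nrm x i.
Proof. by rewrite /nrm rnormMn EFinM muleC. Qed.

Definition tentnu h x (k : ZN) : \bar R := nu p (tentn h x k).

Lemma tentnu_ge0 h x k : 0 <= tentnu h x k.
Proof. by apply: (nu_ge0 (0%R : ZN)) => // i; exact: tentn_ge0. Qed.

Lemma bounded_weight chi x (h : nat) : (forall i, (chi i <= h)%N) ->
  bounded sc x -> bounded sc (weight chi x).
Proof.
move=> ch [c hc]; have c0 : (0 <= c)%R by apply: le_trans (hc 0%R); exact: rnorm_ge0.
exists (c * h%:R)%R => i; rewrite rnormMn.
by apply: ler_pM => //; [exact: rnorm_ge0|rewrite ler_nat].
Qed.

Let a := wmajor A.
Let a0 : forall i, 0 <= a i := wmajor_ge0 A.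

Lemma lipw_fin h al : lipw a h al \is a fin_num.
Proof. by rewrite fin_numM// wmajor_fin. Qed.

(** The tent varies between [i - al] and [i] only if one of them is within [2h] of [k], that is, if
    [i - al] is within [2h] of [k] or of [k - al]. In either case [tent_cover] supplies a translate
    about that centre of height at least [h] at [i - al]; hence the two terms. *)
Lemma tent_commutator h k x i : (0 < h)%N -> bounded sc x ->
  nrm (wiener_op A (weight (tent h k) x) - weight (tent h k) (wiener_op A x))%R i
  <= \esum_(al in [set: ZN]) \esum_(f in [set: I4])
       (lipw a h al * (tentn h x (k + eshift h f)%R (i - al)%R
                     + tentn h x (k - al + eshift h f)%R (i - al)%R)).
Proof.
move=> h0 bx; have bcx := bounded_weight (tent_le h k) bx.
apply: le_trans (commutator A i bx bcx) _; apply: le_esum => al _.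
have t0 f : 0 <= tentn h x (k + eshift h f)%R (i - al)%R
                     + tentn h x (k - al + eshift h f)%R (i - al)%R.
  by apply: adde_ge0; exact: tentn_ge0.
rewrite esumZl ?lipw_ge0// /lipw -muleA; apply: lee_wpmul2l => //.
have hR : (0 < h%:R :> R)%R by rewrite ltr0n.
have big : (zabs (i - al - k) < h + h)%N \/ (zabs (i - k) < h + h)%N ->
    h%:R%:E * nrm x (i - al)%R <= \esum_(f in [set: I4])
      (tentn h x (k + eshift h f)%R (i - al)%R
                     + tentn h x (k - al + eshift h f)%R (i - al)%R).
  case=> hk.
    have [f hf] := tent_cover hk.
    apply: (le_trans _ (le_term_esum f t0)); rewrite -[leLHS]adde0.
    apply: leeD; last exact: tentn_ge0.
    by apply: lee_wpmul2r; rewrite ?nrm_ge0// lee_fin ler_nat.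
  have hk' : (zabs (i - al - (k - al))%R < h + h)%N by rewrite opprB addrA subrK.
  have [f hf] := tent_cover hk'.
  apply: (le_trans _ (le_term_esum f t0)); rewrite -[leLHS]add0e.
  apply: leeD; first exact: tentn_ge0.
  by apply: lee_wpmul2r; rewrite ?nrm_ge0// lee_fin ler_nat.
have [hk|hk] := leqP (h + h)%N (zabs (i - al - k)); last first.
  have := big (or_introl hk) => {}big.
  apply: (@le_trans _ _ (((minn (h + h) (zabs al))%:R / h%:R : R)%:E * (h%:R%:E * nrm x (i - al)%R))).
    rewrite muleA -(EFinM (_ / h%:R) h%:R) divfK ?gt_eqF//; apply: lee_wpmul2r; first exact: nrm_ge0.
    by rewrite lee_fin ler_nat tent_lip.
  by apply: lee_wpmul2l => //; rewrite lee_fin divr_ge0.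
have [hk'|hk'] := leqP (h + h)%N (zabs (i - k)); last first.
  have := big (or_intror hk') => {}big.
  apply: (@le_trans _ _ (((minn (h + h) (zabs al))%:R / h%:R : R)%:E * (h%:R%:E * nrm x (i - al)%R))).
    rewrite muleA -(EFinM (_ / h%:R) h%:R) divfK ?gt_eqF//; apply: lee_wpmul2r; first exact: nrm_ge0.
    by rewrite lee_fin ler_nat tent_lip.
  by apply: lee_wpmul2l => //; rewrite lee_fin divr_ge0.
rewrite !tent_far// mul0e; apply: mule_ge0; first by rewrite lee_fin divr_ge0.
by apply: esum_ge0 => f _.
Qed.

Definition shiftk h (l : ZN) : \bar R :=
  \esum_(f in [set: I4]) (if l == (- eshift h f)%R then 1 else 0).

Lemma shiftk_ge0 h l : 0 <= shiftk h l.
Proof. by apply: esum_ge0 => f _; case: ifP. Qed.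

Lemma conv_shiftk h g k : (forall i, 0 <= g i) ->
  conv (shiftk h) g k = \esum_(f in [set: I4]) g (k + eshift h f)%R.
Proof.
move=> g0; rewrite conv_esuml//; last by move=> f l; case: ifP.
by apply: eq_esum => f _; rewrite conv_dirac// opprK.
Qed.

Lemma mass_shiftk h : mass (shiftk h) <= (#|I4|%:R : R)%:E.
Proof.
rewrite /mass esum_exchange; last by move=> *; case: ifP.
apply: le_trans (esum_fin1 R I4); apply: le_esum => f _.
rewrite (@esum_dirac _ _ _ (- eshift h f)%R) ?eqxx//.
by move=> i /negPf ->.
Qed.

(* Kernel dominating the local norms of the commutator with a tent; its mass is
   2 * 4^N * mass (lipw a h), which tends to 0 as h grows. *)
Definition commk h (l : ZN) : \bar R :=
  mass (lipw a h) * shiftk h l + conv (lipw a h) (shiftk h) l.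

Lemma commk_ge0 h l : 0 <= commk h l.
Proof.
apply: adde_ge0.
  apply: mule_ge0; last exact: shiftk_ge0.
  by apply: mass_ge0 => i; exact: lipw_ge0.
by apply: conv_ge0 => i; [exact: lipw_ge0|exact: shiftk_ge0].
Qed.

(** Minkowski's inequality over [al] and [f]: translates about [k] give the first part of [commk],
    translates about [k - al] the second. *)
Lemma nu_tent_commutator h k x : (0 < h)%N -> bounded sc x ->
  nu p (nrm (wiener_op A (weight (tent h k) x) - weight (tent h k) (wiener_op A x))%R)
  <= conv (commk h) (tentnu h x) k.
Proof.
move=> h0 bx.
have b0 := tentnu_ge0 h x.
have l0 al : 0 <= lipw a h al by exact: lipw_ge0.
have s0 := shiftk_ge0 h.
apply: le_trans (nu_mono p1 (nrm_ge0 sc _) (fun i => tent_commutator k i h0 bx)) _.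
apply: le_trans (nu_esum p1 _) _.
  move=> al i; apply: esum_ge0 => f _; apply: mule_ge0 => //.
  by apply: adde_ge0; exact: tentn_ge0.
apply: (@le_trans _ _ (\esum_(al in [set: ZN]) \esum_(f in [set: I4])
   (lipw a h al * (tentnu h x (k + eshift h f)%R
                     + tentnu h x (k - al + eshift h f)%R)))).
  apply: le_esum => al _; apply: le_trans (nu_esum p1 _) _.
    move=> f i; apply: mule_ge0 => //.
    by apply: adde_ge0; exact: tentn_ge0.
  apply: le_esum => f _; rewrite -(fineK (lipw_fin h al)) (nuZ (0%R : ZN))//; last 2 first.
  - by rewrite fine_ge0.
  - by move=> i; apply: adde_ge0; exact: tentn_ge0.
  apply: lee_wpmul2l; first by rewrite lee_fin fine_ge0.
  apply: le_trans (nuD (0%R : ZN) p1 _ _) _; try by move=> i; exact: tentn_ge0.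
  by rewrite !(@nu_shift _ _ p (tentn h x _)).
rewrite /commk convDl//; last 2 first.
- by move=> i; apply: mule_ge0 => //; exact: mass_ge0.
- by move=> i; exact: conv_ge0.
rewrite convZl ?mass_ge0// conv_assoc// conv_shiftk//.
rewrite [X in X * _]/mass -esumZr//; last by apply: esum_ge0.
rewrite /(conv (lipw a h)) -esumD; last 2 first.
- by move=> al _; apply: mule_ge0 => //; exact: esum_ge0.
- by move=> al _; apply: mule_ge0 => //; exact: conv_ge0.
apply: le_esum => al _; rewrite esumZl//; last by move=> f; exact: adde_ge0.
by rewrite conv_shiftk// -ge0_muleDr ?esum_ge0// -esumD.
Qed.

Definition tentk h (l : ZN) : R := (h + h - zabs l)%:R.

Lemma mass_tentk h : mass (fun l => (tentk h l)%:E) < +oo.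
Proof.
apply: (@mass_fset _ _ _ (zball N (h + h))) => i; rewrite /tentk// => iB.
apply/eqP; rewrite pnatr_eq0 subn_eq0 leqNgt; apply: contra iB => ih.
exact/zabs_zball/ltnW.
Qed.

Lemma tentnu_le h x k : tentnu h x k <= conv (fun l => (tentk h l)%:E) (nrm x) k.
Proof.
apply: le_trans (nu_le_esum p1 (tentn_ge0 h x k)) _.
rewrite convE; apply: le_esum => i _; rewrite /tentn /tentk /tent.
by rewrite -zabsN opprB.
Qed.

(** A tent far from the origin is handled by the hypothesis together with the commutator. A tent
    near the origin is out of reach of the hypothesis, and there [x] itself is counted among the
    data. *)
Lemma domination (C : R) (m : nat) : (0 <= C)%R ->
  (forall z, (exists M, forall i, (M <= zabs i)%N -> z i = 0%R) ->
     (forall i, (zabs i < m)%N -> z i = 0%R) ->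
     nu p (nrm z) <= C%:E * nu p (nrm (wiener_op A z))) ->
  exists (H : ZN -> \bar R) (m' : nat), [/\ forall i, 0 <= H i, mass H < +oo &
    forall x, bounded sc x -> forall i,
      nrm x i <= conv H (fun k => nrm (wiener_op A x) k +
                           if (zabs k < m')%N then nrm x k else 0) i].
Proof.
move=> C0 hE.
pose Q : R := #|I4|%:R; have Q0 : (0 <= Q)%R by [].
(* The mass of [kap] is at most [2 * C * Q] times that of [lipw a h]; dividing by [4 * (C * Q + 1)]
   makes it at most one half, and the added 1 keeps the divisor positive. *)
have CQ0 : (0 < 4 * (C * Q + 1))%R by rewrite mulr_gt0// ltr_wpDl// mulr_ge0.
have eps0 : (0 < (4 * (C * Q + 1))^-1)%R by rewrite invr_gt0.
have [h /(_ h (leqnn h)) [h0 hsmall]] := mass_lipw_small a0 (mass_wmajor A) eps0.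
have l0 al : 0 <= lipw a h al by exact: lipw_ge0.
have s0 := shiftk_ge0 h.
pose kap l := C%:E * commk h l.
have kap0 l : 0 <= kap l by apply: mule_ge0; rewrite ?lee_fin//; exact: commk_ge0.
have kaph : mass kap <= (2^-1)%:E.
  rewrite /mass /kap esumZl ?lee_fin//; last by move=> l; exact: commk_ge0.
  rewrite /commk esumD; last 2 first.
  - by move=> l _; apply: mule_ge0 => //; exact: mass_ge0.
  - by move=> l _; exact: conv_ge0.
  rewrite esumZl ?mass_ge0// -/(mass (shiftk h)) -/(mass (conv _ _)) mass_conv//.
  have le1 : mass (lipw a h) * mass (shiftk h) <= ((4 * (C * Q + 1))^-1 * Q)%:E.
    rewrite EFinM; apply: lee_pmul => //; [exact: mass_ge0|exact: mass_ge0|].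
    exact: mass_shiftk.
  apply: le_trans (lee_wpmul2l _ (leeD le1 le1)) _; first by rewrite lee_fin.
  rewrite -EFinD -EFinM lee_fin.
  rewrite [leLHS](_ : _ = (2 * (C * Q)) / (4 * (C * Q + 1)))%R; last by ring.
  rewrite ler_pdivrMr//; lra.
have [H0 [H00 H0m H0b]] := neumann kap0 kaph.
pose T l := (tentk h l)%:E; have T0 l : 0 <= T l by rewrite lee_fin.
have Tm : mass T < +oo := mass_tentk h.
(* A tent about [k] with [zabs k < m + 2h] only sees sites with [zabs < m + 4h], which fixes the
   radius. The factor [C + 1] serves both data terms, of weights [C] and 1. *)
exists (fun l => (C + 1)%:E * conv H0 T l), (m + (h + h) + (h + h))%N.
have C10 : 0 <= (C + 1)%:E by rewrite lee_fin addr_ge0.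
have HT0 l : 0 <= conv H0 T l by exact: conv_ge0.
have mfin (g : ZN -> \bar R) : (forall i, 0 <= g i) -> mass g < +oo -> mass g \is a fin_num.
  by move=> g0 gm; rewrite ge0_fin_numE// mass_ge0.
split.
- by move=> l; exact: mule_ge0.
- rewrite /mass esumZl// -/(mass _) mass_conv//.
  by rewrite ltey_eq !fin_numM ?mfin.
move=> x bx i.
pose y := wiener_op A x.
pose g' k := C%:E * nrm y k + (if (zabs k < m + (h + h) + (h + h))%N then nrm x k else 0).
have g'0 k : 0 <= g' k.
  apply: adde_ge0; first by apply: mule_ge0; rewrite ?lee_fin// rnorm_ge0.
  by case: ifP => // _; exact: nrm_ge0.
have [c hc] := bx; have c0 : (0 <= c)%R by apply: le_trans (hc 0%R); exact: rnorm_ge0.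
have bound k : tentnu h x k <= (fine (mass T) * c)%:E.
  apply: le_trans (tentnu_le h x k) _; rewrite EFinM fineK ?mfin//.
  by apply: conv_le_sup => // j; rewrite lee_fin// rnorm_ge0.
pose g k := conv T g' k.
have key k : tentnu h x k <= g k + conv kap (tentnu h x) k.
  have cv0 : 0 <= conv kap (tentnu h x) k.
    by apply: conv_ge0 => // j; exact: tentnu_ge0.
  have [kn|kf] := ltnP (zabs k) (m + (h + h))%N.
    rewrite -[leLHS]adde0; apply: leeD => //.
    apply: le_trans (nu_le_esum p1 (tentn_ge0 h x k)) _.
    rewrite /g convE; apply: le_esum => j _; rewrite /T /tentk.
    have [jf|jn] := leqP (h + h)%N (zabs (j - k)).
      by rewrite /tentn tent_far// mul0e mule_ge0.
    rewrite /tentn /tent -zabsN opprB; apply: lee_wpmul2l; first by rewrite lee_fin.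
    rewrite /g' ifT; first by rewrite leeDr// mule_ge0 ?lee_fin// rnorm_ge0.
    apply: leq_ltn_trans (zabs_triangle j k) _; rewrite -addnS.
    by apply: leq_add => //; exact: ltnW.
  (* Now [zabs k] is at least [m + 2h], so the tent vanishes on the ball of radius [m] and the
     hypothesis applies to [z]. *)
  pose z := weight (tent h k) x.
  have bz : bounded sc z := bounded_weight (tent_le h k) bx.
  have hz : nu p (nrm z) <= C%:E * nu p (nrm (wiener_op A z)).
    apply: hE.
      exists (zabs k + (h + h))%N => j jM; rewrite /z /weight tent_far ?mulr0n//.
      rewrite -(leq_add2l (zabs k)).
      exact: leq_trans jM (zabs_triangle j k).
    move=> j jm; rewrite /z /weight tent_far ?mulr0n//.
    rewrite -(leq_add2l m); apply: leq_trans kf _.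
    apply: leq_trans (zabs_triangle k j) _.
    by rewrite -(zabsN (k - j)) opprB leq_add2r ltnW.
  have -> : tentnu h x k = nu p (nrm z).
    by congr nu; apply/funext => j; rewrite nrm_weight.
  apply: le_trans hz _.
  have nz : nu p (nrm (wiener_op A z)) <=
      tentnu h y k + conv (commk h) (tentnu h x) k.
    apply: le_trans (leeD (lexx _) (nu_tent_commutator k h0 bx)).
    have -> : tentnu h y k = nu p (nrm (weight (tent h k) y)).
      by congr nu; apply/funext => j; rewrite nrm_weight.
    apply: le_trans (nuD (0%R : ZN) p1 _ _); try by move=> j; exact: nrm_ge0.
    apply: nu_mono => // [j|j]; first exact: nrm_ge0.
    by apply: le_trans (nrmD _ _ _ _); rewrite addrC subrK.
  apply: le_trans (lee_wpmul2l _ nz) _; first by rewrite lee_fin.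
  rewrite ge0_muleDr; last 2 first.
  - exact: tentnu_ge0.
  - by apply: conv_ge0 => j; [exact: commk_ge0|exact: tentnu_ge0].
  apply: leeD; last first.
    by rewrite convZl ?lee_fin// => j; [exact: commk_ge0|exact: tentnu_ge0].
  apply: le_trans (lee_wpmul2l _ (tentnu_le h y k)) _; first by rewrite lee_fin.
  rewrite -convZr ?lee_fin//; last by move=> j; exact: nrm_ge0.
  apply: le_conv => // j; first by apply: mule_ge0; rewrite ?lee_fin// rnorm_ge0.
  by rewrite leeDl//; case: ifP => // _; exact: nrm_ge0.
have g0 k : 0 <= g k by exact: conv_ge0.
have := H0b _ _ _ g0 (tentnu_ge0 h x) bound key i.
(* At its own centre the tent has height [2h], which is at least 1, so the local norm at [i]
   dominates the entry. *)
move=> hi; apply: (@le_trans _ _ (tentnu h x i)).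
  apply: (@le_trans _ _ (tentn h x i i)); last first.
    by apply: nu_term => // j; exact: tentn_ge0.
  rewrite /tentn /tent subrr zabs0 subn0 -[leLHS]mul1e.
  by apply: lee_wpmul2r; rewrite ?nrm_ge0// lee_fin ler1n addn_gt0 h0.
apply: le_trans hi _; rewrite -conv_assoc// convZl//; last first.
  by move=> k; apply: adde_ge0; rewrite ?nrm_ge0//; case: ifP => // _; exact: nrm_ge0.
rewrite -convZr//; last first.
  by move=> k; apply: adde_ge0; rewrite ?nrm_ge0//; case: ifP => // _; exact: nrm_ge0.
apply: le_conv => // k; rewrite ge0_muleDr ?nrm_ge0//; last first.
  by case: ifP => // _; exact: nrm_ge0.
apply: leeD; first by apply: lee_wpmul2r; rewrite ?nrm_ge0// lee_fin lerDl.
case: ifP => _; last by rewrite mule0.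
by rewrite -[leLHS]mul1e; apply: lee_wpmul2r; rewrite ?nrm_ge0// lee_fin lerDr.
Qed.

End Domination.

(** * Estimates for Fredholm operators *)

Section LpNorm.
Variables (R : realType) (K : numFieldType) (sc : scalars R K).
Variables (N : nat) (X : completeNormedModType K).
Local Notation ZN := 'rV[int]_N.
Local Notation nrm := (nrm sc).
Local Notation rnorm := (rnorm sc).
Variables (p : \bar R) (ep : exponent p).
Implicit Types x y : ZN -> X.

Let p1 := nexp_ge1 ep.

Definition lpn x : R := fine (nu (nexp p) (nrm x)).

Lemma lpnE x : lp sc p x -> nu (nexp p) (nrm x) = (lpn x)%:E.
Proof.
move=> /lpE [xf _]; rewrite /lpn fineK// ge0_fin_numE//.
by apply: (nu_ge0 (0 : ZN)) => // i; exact: nrm_ge0.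
Qed.

Lemma lpn_ge0 x : 0 <= lpn x.
Proof.
by apply: fine_ge0; apply: (nu_ge0 (0 : ZN)) => // i; exact: nrm_ge0.
Qed.

Lemma rnorm_le_lpn x i : lp sc p x -> rnorm (x i) <= lpn x.
Proof.
move=> xp; rewrite -lee_fin -lpnE//.
by apply: (nu_term i p1) => j; exact: nrm_ge0.
Qed.

Lemma lpnD x y : lp sc p x -> lp sc p y -> lpn (x + y) <= lpn x + lpn y.
Proof.
move=> xp yp; rewrite -lee_fin EFinD -!lpnE//; last exact: lpD.
apply: (le_trans _ (nuD (0 : ZN) p1 _ _)); try by move=> i; exact: nrm_ge0.
by apply: nu_mono => // i; [exact: nrm_ge0|exact: nrmD].
Qed.

Lemma lpnZ k x : lp sc p x -> lpn (k *: x) = rabs sc k * lpn x.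
Proof.
move=> xp; apply: EFin_inj; rewrite EFinM -!lpnE//; last exact: lpZ.
rewrite -(nuZ (0 : ZN))//; last 2 first.
- exact: rabs_ge0.
- by move=> i; exact: nrm_ge0.
by congr nu; apply/funext => i; exact: nrmZ.
Qed.

Lemma lpnN x : lp sc p x -> lpn (- x) = lpn x.
Proof.
by move=> xp; rewrite -scaleN1r lpnZ// rabsN -[1](mulr1n 1) rabs_nat mul1r.
Qed.

Lemma lpnB x y : lp sc p x -> lp sc p y -> lpn (x - y) <= lpn x + lpn y.
Proof. by move=> xp yp; rewrite -(lpnN yp); apply: lpnD => //; exact: lpN. Qed.

Lemma lpn_eq0 x : lp sc p x -> lpn x = 0 -> x = 0.
Proof.
move=> xp x0; apply/funext => i; apply: (@rnorm0_eq0 _ _ sc); apply/eqP.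
by rewrite eq_le rnorm_ge0 andbT -x0 rnorm_le_lpn.
Qed.

Lemma lpn0 : lpn (0 : ZN -> X) = 0.
Proof.
rewrite -(scale0r (0 : ZN -> X)) lpnZ; last exact: lp0.
by rewrite /rabs normr0 modulus0 mul0r.
Qed.

Lemma lpn_sum (I : Type) (s : seq I) (x : I -> ZN -> X) :
  (forall j, lp sc p (x j)) -> lpn (\sum_(j <- s) x j) <= \sum_(j <- s) lpn (x j).
Proof.
move=> xp; elim: s => [|j s IH]; first by rewrite !big_nil lpn0.
rewrite !big_cons; apply: le_trans (lpnD (xp j) (lp_sum _ ep xp)) _.
exact: lerD.
Qed.

Lemma esum_geom (d : nat -> R) : (forall n, 0 <= d n) ->
  (forall n, d n.+1 <= d n / 2) ->
  (\esum_(n in [set: nat]) (d n)%:E <= (2 * d 0%N)%:E)%E.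
Proof.
move=> d0 dS; have dn n : d n <= d 0%N * (2 ^+ n)^-1.
  elim: n => [|n IH]; first by rewrite expr0 invr1 mulr1.
  apply: le_trans (dS n) _; rewrite exprS invfM [_^-1 * _]mulrC mulrA.
  by rewrite ler_pM2r// invr_gt0.
apply: (@le_trans _ _ (\esum_(n in [set: nat]) ((d 0%N)%:E * ((2 ^+ n)^-1)%:E))%E).
  by apply: le_esum => n _; rewrite -EFinM lee_fin.
rewrite esumZl ?lee_fin//.
rewrite mulrC EFinM; apply: lee_wpmul2l; rewrite ?lee_fin//; exact: esum_pow2.
Qed.

(** The limit is the telescoping series, summed at each site. Starting the series at any [n] gives
    the same sequence, so Minkowski's inequality for the tail bounds its distance to [w n]. *)
Lemma lp_complete (w : nat -> ZN -> X) (d : nat -> R) :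
  (forall n, lp sc p (w n)) -> (forall n, lpn (w n.+1 - w n) <= d n) ->
  (forall n, d n.+1 <= d n / 2) ->
  exists s, lp sc p s /\ forall n, lpn (s - w n) <= 2 * d n.
Proof.
move=> wp wd dS.
have dp n : lp sc p (w n.+1 - w n) by exact: lpB.
have d0 n : 0 <= d n by apply: le_trans (wd n); exact: lpn_ge0.
pose D n k := w (n + k).+1 - w (n + k)%N.
have nuD' n : (\esum_(k in [set: nat]) nu (nexp p) (nrm (D n k)) <= (2 * d n)%:E)%E.
  apply: (@le_trans _ _ (\esum_(k in [set: nat]) (d (n + k)%N)%:E)%E).
    by apply: le_esum => k _; rewrite /D (lpnE (dp _)) lee_fin.
  rewrite -{2}[n]addn0; apply: (esum_geom (d := fun k => d (n + k)%N)) => // k.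
  by rewrite addnS.
have as_fin n i : (abssum sc (fun k => D n k i) < +oo)%E.
  apply: (@le_lt_trans _ _ (2 * d n)%:E); last exact: ltry.
  apply: le_trans (nuD' n); apply: le_esum => k _.
  by apply: (nu_term i p1) => j; exact: nrm_ge0.
pose U n i := w n i + usum (fun k => D n k i).
have US n : U n.+1 = U n.
  apply/funext => i; rewrite /U (usum_natS (as_fin n i)) /D addn0 addrA.
  congr (_ + _); first by rewrite addrC subrK.
  by apply: eq_usum => k; rewrite addSn addnS.
have U0 n : U n = U 0%N by elim: n => // n <-.
have Uw n : (nu (nexp p) (nrm (U 0%N - w n)%R) <= (2 * d n)%:E)%E.
  rewrite -(U0 n); apply: le_trans (nuD' n).
  apply: le_trans (nu_esum p1 _) => [|k i]; last exact: nrm_ge0.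
  apply: nu_mono => // i; first exact: nrm_ge0.
  rewrite /nrm /U [X in rnorm X](_ : _ = usum (fun k => D n k i)).
    exact: rnorm_usum.
  by rewrite [LHS]addrAC subrr add0r.
have dlim (e : R) : 0 < e -> exists n, 2 * d n <= e.
  move=> e0; have [n hn] := pow2_small (2 * d 0%N) e0; exists n.
  apply: le_trans hn; rewrite -mulrA ler_pM2l//.
  elim: n => [|n IH]; first by rewrite expr0 divr1.
  apply: le_trans (dS n) _; rewrite exprS invfM [_^-1 * _]mulrC mulrA.
  by rewrite ler_pM2r// invr_gt0.
have Up n : lp sc p (U 0%N - w n).
  apply/lpE; split; first by apply: le_lt_trans (Uw n) (ltry _).
  (* For exponent 0, decay at infinity is inherited from a uniformly close [w m]. *)
  move=> p0 e e0; have e20 : 0 < e / 2 by rewrite divr_gt0.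
  have [m hm] := dlim _ e20.
  have /lpE[_ /(_ p0) /(_ _ e20)[B hB]] : lp sc p (w m - w n) by exact: lpB.
  exists B => i /hB iB.
  rewrite (_ : U 0%N - w n = (U 0%N - w m) + (w m - w n)); last by rewrite addrA subrK.
  apply: le_trans (nrmD _ _ _ _) _; rewrite [e]splitr EFinD; apply: leeD => //.
  apply: le_trans (nu_term i p1 (nrm_ge0 sc _)) _; apply: le_trans (Uw m) _.
  by rewrite lee_fin.
exists (U 0%N); split; first by rewrite -[U 0%N](subrK (w 0%N)); apply: lpD.
by move=> n; rewrite -lee_fin -lpnE.
Qed.

Variable A : wiener sc N X.

Definition opn : R := fine (mass (wmajor A)).

Lemma opn_ge0 : 0 <= opn.
Proof. by apply: fine_ge0; apply: mass_ge0 => i; exact: wmajor_ge0. Qed.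

Lemma opnE : mass (wmajor A) = opn%:E.
Proof.
rewrite /opn fineK// ge0_fin_numE ?mass_wmajor//.
by apply: mass_ge0 => i; exact: wmajor_ge0.
Qed.

Lemma lpn_op x : lp sc p x -> lpn (wiener_op A x) <= opn * lpn x.
Proof.
move=> xp; have bx := lp_bounded ep xp.
rewrite -lee_fin EFinM -opnE -!lpnE//; last exact: op_lp.
apply: (@le_trans _ _ (nu (nexp p) (conv (wmajor A) (nrm x)))).
  by apply: nu_mono => // i; [exact: nrm_ge0|exact: nrm_op].
exact: (nu_conv p1 (wmajor_ge0 A) (nrm_ge0 sc x) (mass_wmajor A)).
Qed.

End LpNorm.

(** * The operator bordered by representatives of its cokernel *)

Section Bordered.
Variables (R : realType) (K : numFieldType) (sc : scalars R K).
Variables (N : nat) (X : completeNormedModType K).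
Local Notation ZN := 'rV[int]_N.
Local Notation rnorm := (rnorm sc).
Variables (p : \bar R) (ep : exponent p) (A : wiener sc N X).
Local Notation lpn := (lpn sc p).
Variables (n : nat) (b : 'I_n -> ZN -> X).
Hypothesis bp : forall j, lp sc p (b j).
Implicit Types c : 'rV[K]_n.

Definition lincomb (c : 'rV[K]_n) : ZN -> X := \sum_(j < n) c ord0 j *: b j.

Lemma lincomb_lp c : lp sc p (lincomb c).
Proof. by apply: lp_sum => // j; exact: lpZ. Qed.

Lemma lincombB c d : lincomb (c - d) = lincomb c - lincomb d.
Proof. by rewrite -sumrB; apply: eq_bigr => j _; rewrite !mxE scalerBl. Qed.

Lemma lincombD c d : lincomb (c + d) = lincomb c + lincomb d.
Proof. by rewrite -big_split; apply: eq_bigr => j _; rewrite !mxE scalerDl. Qed.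

Lemma lincombZ k c : lincomb (k *: c) = k *: lincomb c.
Proof. by rewrite /lincomb scaler_sumr; apply: eq_bigr => j _; rewrite !mxE scalerA. Qed.

Lemma lincomb0 : lincomb 0 = 0.
Proof. by rewrite -(scale0r (0 : 'rV_n)) lincombZ scale0r. Qed.

Lemma lpn_lincomb (c : 'rV[K]_n) t : (forall j, rabs sc (c ord0 j) <= t) ->
  lpn (lincomb c) <= t * \sum_(j < n) lpn (b j).
Proof.
move=> ct; apply: le_trans (lpn_sum ep _ _) _; first by move=> j; exact: lpZ.
rewrite mulr_sumr; apply: ler_sum => j _; rewrite lpnZ//.
by apply: ler_wpM2r => //; exact: lpn_ge0.
Qed.

Lemma rabs0 : rabs sc 0 = 0.
Proof. by rewrite /rabs normr0 modulus0. Qed.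

(** The open mapping theorem for the map sending [(x, c)] to [wiener_op A x + lincomb c]. Bordering
    makes the map onto, which takes the place of a separate proof that [A] has closed range. *)
Lemma bordered_open :
  (forall f, lp sc p f -> exists2 x, lp sc p x & exists c, f = wiener_op A x + lincomb c) ->
  exists2 C : R, 0 <= C & forall f, lp sc p f -> exists x c,
    [/\ lp sc p x, wiener_op A x + lincomb c = f, lpn x <= C * lpn f &
        forall j, rabs sc (c ord0 j) <= C * lpn f].
Proof.
move=> surj; pose V := ((ZN -> X) * 'rV[K]_n)%type; pose W := ZN -> X.
pose cn (c : 'rV[K]_n) : R := \sum_(j < n) rabs sc (c ord0 j).
pose DV : set V := [set v | lp sc p v.1]; pose DW : set W := lp sc p.
pose nV (v : V) := lpn v.1 + cn v.2.
pose T (v : V) : W := wiener_op A v.1 + lincomb v.2.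
(* The 2 comes from [lp_complete]; each coordinate costs 4, namely 2 for summing the geometric
   series and 2 from [K_complete]. *)
pose M : R := 2 + 4 * n%:R.
have cn0 c : 0 <= cn c by apply: sumr_ge0 => j _; exact: rabs_ge0.
have bdd (x : ZN -> X) : lp sc p x -> bounded sc x by exact: lp_bounded.
have cnB c d : cn (c - d) <= cn c + cn d.
  rewrite /cn -big_split; apply: ler_sum => j _ /=; rewrite !mxE.
  by apply: le_trans (rabsD _ _ _) _; rewrite rabsN.
have le_cn c j : rabs sc (c ord0 j) <= cn c.
  by rewrite /cn (bigD1 j)//= lerDl sumr_ge0// => i _; exact: rabs_ge0.
have [|||||||||||||||C C0 hC] := @open_mapping R K sc V W DV DW nV lpn T M.
- move=> u v Du Dv; split; first exact: lpB.
  have := lpnB ep Du Dv; have := cnB u.2 v.2; rewrite /nV /=; lra.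
- move=> k v Dv; split; first exact: lpZ.
  rewrite /nV lpnZ// mulrDr; congr (_ + _); rewrite mulr_sumr.
  by apply: eq_bigr => j _; rewrite mxE rabsM.
- by move=> u v Du Dv; split; [exact: lpB|exact: lpnB].
- by move=> k v Dv; split; [exact: lpZ|exact: lpnZ].
- by rewrite /M addr_ge0// mulr_ge0.
- exact: lp0.
- exact: lp0.
- exact: lpn_ge0.
- exact: lpn_eq0.
- move=> u v Du Dv; rewrite /T opB; [|exact: bdd|exact: bdd].
  by rewrite lincombB opprD addrACA.
- by move=> k v Dv; rewrite /T opZ ?lincombZ ?scalerDr//; exact: bdd.
- by move=> v Dv; apply: lpD => //; [exact: op_lp|exact: lincomb_lp].
(* This is [V_complete]: first components converge in l^p, the coordinates in the scalar field, and
   continuity identifies the image of the limit. *)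
- move=> v B B' w vB Dw hw.
  have B0 : 0 <= B.
    have [_] := vB 0%N; rewrite expr0 divr1; apply: le_trans.
    by rewrite addr_ge0// lpn_ge0.
  pose d m : R := B / 2 ^+ m.
  have d0 m : 0 <= d m by rewrite divr_ge0// exprn_ge0.
  have dS m : d m.+1 <= d m / 2 by rewrite /d exprS invfM mulrA mulrAC.
  pose x m : ZN -> X := \sum_(k < m) (v k).1.
  have xp m : lp sc p (x m) by apply: lp_sum => // j; exact: (vB j).1.
  have xd m : lpn (x m.+1 - x m) <= d m.
    rewrite /x big_ord_recr /= addrAC subrr add0r.
    by apply: le_trans (vB m).2; rewrite lerDl.
  have [s [sp sx]] := lp_complete ep xp xd dS.
  pose cc j m : K := \sum_(k < m) (v k).2 ord0 j.
  have ccd j k l : (k <= l)%N -> rabs sc (cc j l - cc j k) <= 2 * d k.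
    (* Keeping the term [2 * d l] makes the induction on [l] close. *)
    move=> kl; have : rabs sc (cc j l - cc j k) <= 2 * d k - 2 * d l.
      elim: l kl => [|l IH]; first by rewrite leqn0 => /eqP ->; rewrite !subrr rabs0.
      rewrite leq_eqVlt ltnS => /orP[/eqP <-|/IH {}IH].
        by rewrite !subrr rabs0.
      rewrite /cc big_ord_recr /= addrAC -/(cc j l); apply: le_trans (rabsD _ _ _) _.
      have h1 : rabs sc ((v l).2 ord0 j) <= d l.
        by apply: le_trans (le_cn _ j) _; apply: le_trans (vB l).2; rewrite lerDr lpn_ge0.
      by have := dS l; lra.
    by move/le_trans; apply; rewrite gerBl mulr_ge0.
  have [c hc] := choice (fun j => K_complete (ccd j)).
  pose crow : 'rV[K]_n := \row_j c j.
  have crowb m j : rabs sc (c j - cc j m) <= 4 * d m.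
    by apply: le_trans (hc j m) _; lra.
  have TE m : \sum_(k < m) T (v k) = wiener_op A (x m) + lincomb (\row_j cc j m).
    elim: m => [|m IH].
      rewrite /x !big_ord0 op0 (_ : \row_j _ = 0) ?lincomb0 ?addr0//.
      by apply/rowP => j; rewrite !mxE /cc big_ord0.
    rewrite big_ord_recr /= IH /T /x big_ord_recr /= opD; last 2 first.
    + exact/bdd/xp.
    + exact/bdd/(vB m).1.
    have -> : \row_j cc j m.+1 = \row_j cc j m + (v m).2.
      by apply/rowP => j; rewrite !mxE /cc big_ord_recr.
    rewrite lincombD; exact: addrACA.
  have Tw : T (s, crow) = w.
    apply/esym/eqP; rewrite -subr_eq0; apply/eqP; apply: (@lpn_eq0 _ _ sc _ _ _ ep).
      by apply: lpB => //; apply: lpD => //; [exact: op_lp|exact: lincomb_lp].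
    apply/eqP; rewrite eq_le (lpn_ge0 sc ep) andbT; apply/ler_addgt0Pr => e e0; rewrite add0r.
    (* [L / 2 ^+ m] collects the errors at step [m]: the residual, the tail of the first components,
       and the tail of the coordinates. *)
    pose L : R := `|B'| + opn A * (2 * B) + 4 * B * \sum_(j < n) lpn (b j).
    have [m hm] := pow2_small L e0; apply: le_trans hm.
    have -> : w - T (s, crow) = (w - \sum_(k < m) T (v k)) -
        (wiener_op A (s - x m) + lincomb (crow - \row_j cc j m)).
      rewrite TE opB; [|exact/bdd|exact/bdd/xp].
      rewrite lincombB [in RHS]addrACA /T /=.
      by rewrite -[in RHS]opprD [in RHS]opprB addrA subrK.
    have D1 : lp sc p (w - \sum_(k < m) T (v k)).
      apply: lpB => //; apply: lp_sum => // k.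
      by apply: lpD => //; [apply: op_lp => //; exact: (vB k).1|exact: lincomb_lp].
    have D2 : lp sc p (s - x m) by exact: lpB.
    have D3 := op_lp A ep D2; have D4 := lincomb_lp (crow - \row_j cc j m).
    apply: le_trans (lpnB ep D1 (lpD ep D3 D4)) _.
    have h1 : lpn (w - \sum_(k < m) T (v k)) <= `|B'| / 2 ^+ m.
      apply: le_trans (hw m) _; apply: ler_wpM2r; last exact: ler_norm.
      by rewrite invr_ge0 exprn_ge0.
    have h2 : lpn (wiener_op A (s - x m)) <= opn A * (2 * d m).
      apply: le_trans (lpn_op ep A D2) _; apply: ler_wpM2l; first exact: opn_ge0.
      exact: sx.
    have h3 : lpn (lincomb (crow - \row_j cc j m)) <= 4 * d m * \sum_(j < n) lpn (b j).
      by apply: lpn_lincomb => j; rewrite !mxE; exact: crowb.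
    have h4 := lpnD ep D3 D4.
    have -> : L / 2 ^+ m = `|B'| / 2 ^+ m + (opn A * (2 * d m)
        + 4 * d m * \sum_(j < n) lpn (b j)) by rewrite /L /d; ring.
    by move: h1 h2 h3 h4; lra.
  exists (s, crow); split => //; rewrite /nV /= /M mulrDl; apply: lerD.
    by have := sx 0%N; rewrite /x big_ord0 subr0 /d expr0 divr1.
  apply: (@le_trans _ _ (\sum_(j < n) 4 * B)).
    apply: ler_sum => j _; rewrite mxE.
    by have := crowb 0%N j; rewrite /cc big_ord0 subr0 /d expr0 divr1.
  by rewrite sumr_const card_ord -[leLHS]mulr_natr; lra.
- by move=> w d wp wd dS; exact: lp_complete wp wd dS.
- by move=> w /surj [x xp [c ->]]; exists (x, c).
exists C => // f /hC [[x c] [xp Tf nvf]]; exists x, c; split => //.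
  by apply: le_trans nvf; rewrite lerDl.
move=> j; apply: le_trans (le_cn c j) _; apply: le_trans nvf.
by rewrite lerDr lpn_ge0.
Qed.

End Bordered.

(** * Dimensions of quotients *)

Section QuotientDimension.
Variables (K : fieldType) (V : lmodType K).
Implicit Types E F : set V.

Definition subspace E := E 0 /\ forall k u v, E u -> E v -> E (k *: u + v).

Section Subspace.
Variables (E : set V) (sE : subspace E).

Lemma subspaceD u v : E u -> E v -> E (u + v).
Proof. by move=> Eu Ev; rewrite -[u]scale1r; exact: sE.2. Qed.

Lemma subspaceZ k u : E u -> E (k *: u).
Proof. by move=> Eu; rewrite -[_ *: _]addr0; apply: sE.2 => //; exact: sE.1. Qed.

Lemma subspaceB u v : E u -> E v -> E (u - v).
Proof.
by move=> Eu Ev; rewrite -scaleN1r; apply: subspaceD => //; exact: subspaceZ.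
Qed.

Lemma subspace_sum n (c : 'rV[K]_n) (b : 'I_n -> V) : (forall j, E (b j)) ->
  E (\sum_(j < n) c ord0 j *: b j).
Proof.
move=> Eb; elim/big_ind: _ => [|u v|j _]; first exact: sE.1.
  exact: subspaceD.
exact: subspaceZ.
Qed.

End Subspace.

(** Linearity of the coordinates follows from their uniqueness. *)
Lemma quotient_coord E F n (b : 'I_n -> V) : subspace E -> subspace F ->
  (forall j, E (b j)) ->
  (forall x, E x -> exists! c : 'rV[K]_n, F (x - \sum_(j < n) c ord0 j *: b j)) ->
  exists phi : V -> 'rV[K]_n,
   [/\ forall k x y, E x -> E y -> phi (k *: x + y) = k *: phi x + phi y,
       forall x, E x -> (phi x = 0 <-> F x) &
       forall x, E x -> F (x - \sum_(j < n) phi x ord0 j *: b j)].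
Proof.
move=> sE sF Eb hb.
have exist_coord x : exists c : 'rV[K]_n, E x ->
    F (x - \sum_(j < n) c ord0 j *: b j) /\
    forall d : 'rV[K]_n, F (x - \sum_(j < n) d ord0 j *: b j) -> c = d.
  have [/hb[c [c1 c2]]|nE] := pselect (E x); last by exists 0.
  by exists c => _; split.
have [phi hphi] := choice exist_coord.
exists phi; split.
- move=> k x y Ex Ey.
  have Exy : E (k *: x + y) by exact: sE.2.
  apply: (hphi _ Exy).2.
  have -> : k *: x + y - \sum_(j < n) (k *: phi x + phi y) ord0 j *: b j =
      k *: (x - \sum_(j < n) phi x ord0 j *: b j) + (y - \sum_(j < n) phi y ord0 j *: b j).
    rewrite scalerBr addrACA -opprD scaler_sumr -big_split /=.
    congr (_ - _); apply: eq_bigr => j _.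
    by rewrite !mxE scalerDl scalerA.
  by apply: sF.2; [exact: (hphi _ Ex).1|exact: (hphi _ Ey).1].
- move=> x Ex; split => [h|Fx].
    have := (hphi _ Ex).1; rewrite h big1 ?subr0// => j _.
    by rewrite mxE scale0r.
  apply: (hphi _ Ex).2; rewrite big1 ?subr0// => j _.
  by rewrite mxE scale0r.
- by move=> x /hphi[].
Qed.

Lemma linear_on_sum E n m (phi : V -> 'rV[K]_n) (c : 'rV[K]_m) (b : 'I_m -> V) :
  subspace E -> (forall k x y, E x -> E y -> phi (k *: x + y) = k *: phi x + phi y) ->
  (forall j, E (b j)) ->
  phi (\sum_(j < m) c ord0 j *: b j) = c *m (\matrix_(j < m) phi (b j)).
Proof.
move=> sE lphi Eb.
have phi0 : phi 0 = 0.
  have := lphi 1 0 0 sE.1 sE.1; rewrite !scale1r addr0 => /esym/eqP.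
  by rewrite -subr_eq0 addrK => /eqP.
rewrite mulmx_sum_row.
suff [] : E (\sum_(j < m) c ord0 j *: b j) /\ phi (\sum_(j < m) c ord0 j *: b j) =
  \sum_(j < m) c ord0 j *: row j (\matrix_(j < m) phi (b j)) by [].
elim/big_ind2: _ => [|u1 u2 v1 v2 [E1 h1] [E2 h2]|j _].
- by split; [exact: sE.1|].
- split; first exact: subspaceD.
  by rewrite -h1 -h2 -[u2]scale1r lphi// !scale1r.
- split; first exact: subspaceZ.
  by rewrite -[_ *: b j]addr0 lphi ?phi0 ?addr0 ?rowK//; exact: sE.1.
Qed.

(** If [m > n], the coordinate rows of the [b' j] are dependent. A dependence [c] puts the
    combination of the [b' j] in [F], so both [c] and 0 are coordinates of it, and [c = 0]. *)
Lemma quotient_dim_le E F n m : subspace E -> subspace F ->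
  quotient_dim E F n -> quotient_dim E F m -> (m <= n)%N.
Proof.
move=> sE sF [b Eb hb] [b' Eb' hb'].
have [phi [p1 p2 p3]] := quotient_coord sE sF Eb hb.
rewrite leqNgt; apply/negP => nm.
pose P := \matrix_(j < m) phi (b' j).
have : kermx P != 0.
  by rewrite -mxrank_eq0 mxrank_ker -lt0n subn_gt0 (leq_ltn_trans (rank_leq_col _)).
move=> /eqP; apply; apply/row_matrixP => i; rewrite row0.
pose c := row i (kermx P).
have cP : c *m P = 0 by apply/sub_kermxP; exact: row_sub.
have Ec := subspace_sum sE c Eb'.
have Fc : F (\sum_(j < m) c ord0 j *: b' j).
  by apply/(p2 _ Ec); rewrite (linear_on_sum _ sE p1 Eb') -/P.
have [d [_ dU]] := hb' _ Ec.
have dc : d = c by apply: dU; rewrite subrr; exact: sF.1.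
rewrite -[LHS]dc; apply: dU; rewrite [X in F (_ - X)]big1 ?subr0// => j _.
by rewrite mxE scale0r.
Qed.

Lemma quotient_dim_unique E F n m : subspace E -> subspace F ->
  quotient_dim E F n -> quotient_dim E F m -> n = m.
Proof.
move=> sE sF hn hm; apply/eqP; rewrite eqn_leq.
by rewrite (quotient_dim_le sE sF hn hm) (quotient_dim_le sE sF hm hn).
Qed.

Lemma dimqE E F n : subspace E -> subspace F -> quotient_dim E F n -> dimq E F = n.
Proof.
move=> sE sF hn; rewrite /dimq.
by case: xgetP => [m _ hm|/(_ n)//]; exact: quotient_dim_unique hm hn.
Qed.

(** [E1 / F1] embeds in [E / F]: a family in [E1] of maximal size with independent coordinates
    represents a basis. *)
Lemma finite_dim_sub E F E1 F1 : subspace E -> subspace F -> subspace E1 ->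
  E1 `<=` E -> (forall x, E1 x -> (F1 x <-> F x)) ->
  finite_dim E F -> finite_dim E1 F1.
Proof.
move=> sE sF sE1 E1E F1F [n [b Eb hb]].
have [phi [p1 p2 p3]] := quotient_coord sE sF Eb hb.
have p1' k x y : E1 x -> E1 y -> phi (k *: x + y) = k *: phi x + phi y.
  by move=> /E1E Ex /E1E Ey; exact: p1.
pose P r := `[< exists y : 'I_r -> V, (forall i, E1 (y i)) /\
  row_free (\matrix_(i < r) phi (y i)) >].
have P0 : exists r, P r.
  exists 0%N; apply/asboolP; exists (fun=> 0); split; first by case.
  by rewrite /row_free -leqn0 rank_leq_row.
have Pn r : P r -> (r <= n)%N.
  by move=> /asboolP[y [_ /eqP <-]]; exact: rank_leq_col.
case: (ex_maxnP P0 Pn) => r /asboolP[y [Ey fy]] rmax.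
exists r, y => // x Ex; pose M := \matrix_(i < r) phi (y i).
have : (phi x <= M)%MS.
  apply: contraT => nxM.
  have : P (r + 1)%N.
    apply/asboolP.
    exists (fun i => match @fintype.split r 1 i with inl j => y j | inr _ => x end); split.
      by move=> i; case: fintype.split.
    have -> : \matrix_(i < r + 1) phi (match @fintype.split r 1 i with inl j => y j | inr _ => x end)
        = col_mx M (phi x).
      apply/matrixP => i j; rewrite !mxE; case: fintype.split => k; rewrite ?mxE//.
      by rewrite ord1.
    have rk : (r < \rank (col_mx M (phi x)))%N.
      rewrite -addsmxE -[X in (X < _)%N](eqP fy); apply: rank_ltmx.
      by rewrite ltmxE addsmxSl/= addsmx_sub submx_refl.
    by rewrite /row_free eqn_leq rank_leq_row/= (leq_trans _ rk)// addn1.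
  by move=> /rmax; rewrite addn1 ltnn.
case/submxP => c hc.
have Esum (d : 'rV[K]_r) : E1 (\sum_(j < r) d ord0 j *: y j) by exact: (subspace_sum sE1).
have key (d : 'rV[K]_r) : F1 (x - \sum_(j < r) d ord0 j *: y j) <-> phi x = d *m M.
  have E1d : E1 (x - \sum_(j < r) d ord0 j *: y j) by exact: (subspaceB sE1).
  rewrite (F1F _ E1d) -(p2 _ (E1E _ E1d)) addrC -scaleN1r p1'//.
  rewrite scaleN1r (linear_on_sum _ sE1 p1' Ey) addrC; split.
    by move=> /eqP; rewrite subr_eq0 => /eqP.
  by move=> ->; rewrite subrr.
exists c; split; first exact/key.
move=> d /key; rewrite hc => /eqP; rewrite -subr_eq0 -mulmxBl => /eqP h.
by apply/eqP; rewrite -subr_eq0 -(mulmx_free_eq0 _ fy) h.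
Qed.

End QuotientDimension.

(** * Finite-dimensional spaces of sequences *)

Section FiniteDimensional.
Variables (R : realType) (K : numFieldType) (sc : scalars R K).
Variables (N : nat) (X : completeNormedModType K).
Local Notation ZN := 'rV[int]_N.
Local Notation rnorm := (rnorm sc).

Lemma ball_bound (y : ZN -> X) m : exists2 Y : R, 0 <= Y &
  forall i, (zabs i < m)%N -> rnorm (y i) <= Y.
Proof.
exists (\sum_(i <- zball N m) rnorm (y i)).
  by apply: sumr_ge0 => i _; exact: rnorm_ge0.
move=> i /ltnW/zabs_zball im; rewrite (big_fsetD1 _ im) /= lerDl.
by apply: sumr_ge0 => j _; exact: rnorm_ge0.
Qed.

(** Independent sequences are already independent, with a quantitative bound, on some finite ball.
    By induction it suffices that on a large enough ball the last sequence [y] keeps a positive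
    distance from the span of the others. *)
Lemma finite_dim_bound (n : nat) (e : 'I_n -> ZN -> X) :
  (forall c : 'I_n -> K, \sum_(j < n) c j *: e j = 0 -> forall j, c j = 0) ->
  exists (m : nat) (C : R), 0 <= C /\ forall (c : 'I_n -> K) (t : R), 0 <= t ->
    (forall i, (zabs i < m)%N -> rnorm ((\sum_(j < n) c j *: e j) i) <= t) ->
    forall j, rabs sc (c j) <= C * t.
Proof.
elim: n e => [|n IH] e free; first by exists 0%N, 0; split => // c t t0 _ [].
pose e' j := e (widen_ord (leqnSn n) j); pose y := e ord_max.
have sumE (c : 'I_n.+1 -> K) : \sum_(j < n.+1) c j *: e j =
    \sum_(j < n) c (widen_ord (leqnSn n) j) *: e' j + c ord_max *: y.
  by rewrite big_ord_recr.
pose ext (c : 'I_n -> K) (k : K) (j : 'I_n.+1) : K :=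
  if unlift ord_max j is Some i then c i else k.
have extw c k j : ext c k (widen_ord (leqnSn n) j) = c j.
  rewrite /ext (_ : widen_ord _ j = lift ord_max j) ?liftK//.
  by apply: val_inj; rewrite /= /bump leqNgt ltn_ord.
have extm c k : ext c k ord_max = k by rewrite /ext unlift_none.
have sumext c k : \sum_(j < n.+1) ext c k j *: e j = \sum_(j < n) c j *: e' j + k *: y.
  by rewrite sumE extm; congr (_ + _); apply: eq_bigr => j _; rewrite extw.
have free' (c : 'I_n -> K) : \sum_(j < n) c j *: e' j = 0 -> forall j, c j = 0.
  move=> c0 j; rewrite -(extw c 0); apply: free.
  by rewrite sumext c0 scale0r addr0.
have [m0 [C0 [C00 h0]]] := IH e' free'.
have [Y Y0 hY] := ball_bound y m0.
(* Otherwise combinations approximate [y] to within [2 ^- k] on growing balls. The induction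
   hypothesis makes their coefficients Cauchy, and the limits express [y] through the others. *)
have [m [delta [m0m delta0 hdelta]]] : exists (m : nat) (delta : R),
    [/\ (m0 <= m)%N, 0 < delta & forall c : 'I_n -> K, exists i : ZN,
      (zabs i < m)%N /\ delta <= rnorm ((y - \sum_(j < n) c j *: e' j) i)].
  apply: contrapT => hn.
  have hc k : exists c : 'I_n -> K, forall i : ZN, (zabs i < m0 + k)%N ->
      rnorm ((y - \sum_(j < n) c j *: e' j) i) < (2 ^+ k)^-1.
    apply: contrapT => hk; apply: hn; exists (m0 + k)%N, (2 ^+ k)^-1.
    split; [exact: leq_addr|by rewrite invr_gt0 exprn_gt0|] => c.
    apply: contrapT => hi; apply: hk; exists c => i im.
    by rewrite ltNge; apply/negP => h; apply: hi; exists i.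
  have [c {}hc] := choice hc.
  pose d k : R := C0 * (2 * (2 ^+ k)^-1).
  have cd j k l : (k <= l)%N -> rabs sc (c l j - c k j) <= d k.
    move=> kl; apply: (h0 (fun j => c l j - c k j)).
      by rewrite mulr_ge0// invr_ge0 exprn_ge0.
    move=> i im.
    have -> : (\sum_(j < n) (c l j - c k j) *: e' j) i =
        (y - \sum_(j < n) c k j *: e' j) i - (y - \sum_(j < n) c l j *: e' j) i.
      have -> : \sum_(j < n) (c l j - c k j) *: e' j =
          (y - \sum_(j < n) c k j *: e' j) - (y - \sum_(j < n) c l j *: e' j).
        rewrite opprB [RHS]addrC addrA subrK -sumrB.
        by apply: eq_bigr => i0 _; rewrite scalerBl.
      by [].
    apply: le_trans (rnormB _ _ _) _.
    have h1 := hc k i (leq_trans im (leq_addr _ _)).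
    have h2 := hc l i (leq_trans im (leq_addr _ _)).
    have h3 : (2 ^+ l)^-1 <= (2 ^+ k)^-1 :> R.
      by rewrite lef_pV2 ?posrE ?exprn_gt0// ler_eXn2l// ltr1n.
    by lra.
  have [s hs] := choice (fun j => K_complete (cd j)).
  have ys : y = \sum_(j < n) s j *: e' j.
    apply/funext => i; apply: (@rnorm_small_eq _ _ sc) => eps eps0.
    pose L : R := 1 + 4 * C0 * \sum_(j < n) rnorm (e' j i).
    have L0 : 0 <= L.
      by rewrite addr_ge0// !mulr_ge0// sumr_ge0// => j _; exact: rnorm_ge0.
    have [k0 hk0] := pow2_small L eps0; pose k := maxn k0 (zabs i).+1.
    have hk : L * (2 ^+ k)^-1 <= eps.
      apply: le_trans hk0; apply: ler_wpM2l => //.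
      by rewrite lef_pV2 ?posrE ?exprn_gt0// ler_eXn2l ?ltr1n// leq_maxl.
    apply: le_trans hk.
    have -> : y i - (\sum_(j < n) s j *: e' j) i =
       (y - \sum_(j < n) c k j *: e' j) i - \sum_(j < n) (s j - c k j) *: e' j i.
      have -> : \sum_(j < n) (s j - c k j) *: e' j i =
          (\sum_(j < n) s j *: e' j) i - (\sum_(j < n) c k j *: e' j) i.
        by rewrite !fct_sumE -sumrB; apply: eq_bigr => j _; rewrite scalerBl.
      rewrite opprB addrA; congr (_ - _).
      by rewrite [X in _ = X + _](_ : _ = y i - (\sum_(j < n) c k j *: e' j) i)// subrK.
    apply: le_trans (rnormB _ _ _) _; rewrite /L mulrDl mul1r; apply: lerD.
      apply/ltW/hc; rewrite /k; apply: leq_trans (leq_addl _ _); exact: leq_maxr.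
    apply: le_trans (rnorm_sum _ _ _ _) _.
    rewrite mulrAC mulr_sumr; apply: ler_sum => j _; rewrite rnormZ.
    apply: ler_wpM2r; first exact: rnorm_ge0.
    by apply: le_trans (hs j k) _; rewrite /d; lra.
  have := free (ext (fun j => - s j) 1) _ ord_max; rewrite extm => h.
  have /eqP : (1 : K) = 0.
    apply: h; rewrite sumext scale1r ys -big_split big1// => j _ /=.
    by rewrite scaleNr addNr.
  by rewrite oner_eq0.
have d1 : 0 <= delta^-1 by rewrite invr_ge0 ltW.
(* The coefficient of [y] is at most [t / delta]. Subtracting its multiple of [y] leaves at most
   [t + t / delta * Y] on the smaller ball, where the induction hypothesis bounds the other
   coefficients. *)
exists m, (C0 * (1 + Y / delta) + delta^-1); split.
  by rewrite addr_ge0// mulr_ge0// addr_ge0// mulr_ge0.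
move=> c t t0 ht.
pose k := c ord_max; pose c' j := c (widen_ord (leqnSn n) j).
have kt : rabs sc k <= t / delta.
  have [k0|kn0] := eqVneq k 0.
    by rewrite k0 /rabs normr0 modulus0 mulr_ge0.
  have [i [im hi]] := hdelta (fun j => - (k^-1 * c' j)).
  rewrite ler_pdivlMr//.
  have E : y - \sum_(j < n) - (k^-1 * c' j) *: e' j = k^-1 *: \sum_(j < n.+1) c j *: e j.
    rewrite sumE scalerDr scalerA mulVf// scale1r addrC; congr (_ + _).
    rewrite scaler_sumr -sumrN; apply: eq_bigr => j _.
    by rewrite scaleNr opprK scalerA.
  have rk0 : 0 < rabs sc k.
    by rewrite lt0r rabs_ge0 andbT; apply/eqP => /rabs0_eq0 /eqP; exact/negP.
  move: hi; rewrite E rnormZ rabsV mulrC ler_pdivlMr// mulrC => hi.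
  exact: le_trans hi (ht i im).
have c't j : rabs sc (c' j) <= C0 * (t + t / delta * Y).
  apply: (h0 c').
    by rewrite addr_ge0// !mulr_ge0.
  move=> i im.
  have -> : (\sum_(j < n) c' j *: e' j) i = (\sum_(j < n.+1) c j *: e j) i - k *: y i.
    by rewrite sumE; apply/esym; exact: addrK.
  apply: le_trans (rnormB _ _ _) _; apply: lerD; first exact: ht (leq_trans im m0m).
  rewrite rnormZ; apply: ler_pM; rewrite ?rabs_ge0 ?rnorm_ge0//; exact: hY.
move=> j; rewrite mulrDl.
have td : 0 <= t / delta by rewrite mulr_ge0.
case: (unliftP ord_max j) => [j' ->|->].
  have := c't j'; rewrite /c' (_ : widen_ord _ j' = lift ord_max j'); last first.
    by apply: val_inj; rewrite /= /bump leqNgt ltn_ord.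
  move/le_trans; apply.
  have -> : C0 * (t + t / delta * Y) = C0 * (1 + Y / delta) * t by ring.
  by rewrite lerDl mulrC.
apply: le_trans kt _; rewrite [delta^-1 * t]mulrC lerDr.
by rewrite !mulr_ge0// addr_ge0// mulr_ge0.
Qed.

End FiniteDimensional.

(** * Independence of the exponent *)

Section FredholmEstimates.
Variables (R : realType) (K : numFieldType) (sc : scalars R K).
Variables (N : nat) (X : completeNormedModType K) (A : wiener sc N X).
Local Notation ZN := 'rV[int]_N.
Local Notation rnorm := (rnorm sc).
Local Notation nrm := (nrm sc).

Lemma subspace_lp (p : \bar R) : exponent p -> subspace (lp sc p : set (ZN -> X)).
Proof.
move=> ep; split; first exact: lp0.
by move=> k u v up vp; apply: lpD => //; exact: lpZ.
Qed.

Lemma subspace_ker (p : \bar R) : exponent p -> subspace (lp_ker A p).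
Proof.
move=> ep; split; first by split; [exact: lp0|exact: op0].
move=> k u v [up u0] [vp v0]; split; first by apply: lpD => //; exact: lpZ.
have bu := lp_bounded ep up; have bv := lp_bounded ep vp.
by rewrite opD ?opZ//; [rewrite u0 v0 scaler0 addr0|exact: boundedZ].
Qed.

Lemma subspace_range (p : \bar R) : exponent p -> subspace (lp_range A p).
Proof.
move=> ep; split; first by exists 0; [exact: lp0|exact: op0].
move=> k _ _ [u up <-] [v vp <-]; exists (k *: u + v).
  by apply: lpD => //; exact: lpZ.
have bu := lp_bounded ep up; have bv := lp_bounded ep vp.
by rewrite opD ?opZ//; exact: boundedZ.
Qed.

Lemma subspace_set0 : subspace ([set 0] : set (ZN -> X)).
Proof. by split => // k u v -> ->; rewrite scaler0 addr0. Qed.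

(** The open mapping theorem gives a controlled solution [x] with the same right-hand side; by
    uniqueness its coefficients are [d], so [z - x] lies in the kernel and serves as [u]. *)
Lemma bordered_estimate (p : \bar R) (n : nat) (b : 'I_n -> ZN -> X) :
  exponent p -> (forall j, lp sc p (b j)) ->
  (forall f, lp sc p f -> exists! c : 'rV[K]_n,
     lp_range A p (f - \sum_(j < n) c ord0 j *: b j)) ->
  exists2 C : R, 0 <= C & forall z (d : 'rV[K]_n), lp sc p z ->
    exists u, [/\ lp_ker A p u,
      lpn sc p (z - u) <= C * lpn sc p (wiener_op A z + lincomb b d) &
      forall j, rabs sc (d ord0 j) <= C * lpn sc p (wiener_op A z + lincomb b d)].
Proof.
move=> ep bp hb.
have [|C C0 hC] := bordered_open ep (A := A) bp.
  move=> f /hb[c [[x xp Ax] _]]; exists x => //; exists c.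
  by rewrite Ax subrK.
exists C => // z d zp; set f := wiener_op A z + lincomb b d.
have fp : lp sc p f by apply: lpD => //; [exact: op_lp|exact: lincomb_lp].
have [x [c [xp xf xC cC]]] := hC _ fp.
have [c' [_ cU]] := hb _ fp.
have dc : d = c.
  rewrite -(cU d) ?(cU c)//.
    by exists x => //; rewrite -xf addrK.
  by exists z => //; rewrite /f addrK.
exists (z - x); split; last by rewrite dc.
  split; first exact: lpB.
  rewrite opB; [|exact: lp_bounded ep zp|exact: lp_bounded ep xp].
  apply/eqP; rewrite subr_eq0; apply/eqP.
  by apply: (addIr (lincomb b c)); rewrite xf -dc.
by rewrite opprB addrCA subrr addr0.
Qed.

Lemma lp_finite_support (p : \bar R) (z : ZN -> X) m : exponent p ->
  (forall i, (m <= zabs i)%N -> z i = 0) -> lp sc p z.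
Proof.
move=> ep hz; apply/lpE; apply: (lpmem_mass ep (nrm_ge0 sc z)).
apply: (mass_fset (B := zball N m)) => [i|i iB]; first exact: rnorm_ge0.
rewrite hz ?rnorm0// leqNgt; apply: contra iB => im.
exact/zabs_zball/ltnW.
Qed.

Lemma kernel_local_bound (p : \bar R) : exponent p ->
  finite_dim (lp_ker A p) [set 0] ->
  exists (m : nat) (C : R), 0 <= C /\ forall u (t : R), lp_ker A p u -> 0 <= t ->
    (forall i, (zabs i < m)%N -> rnorm (u i) <= t) -> lpn sc p u <= C * t.
Proof.
move=> ep [a [e eker he]].
have free (c : 'I_a -> K) : \sum_(j < a) c j *: e j = 0 -> forall j, c j = 0.
  move=> c0 j; have [d [_ dU]] := he 0 (subspace_ker ep).1.
  have d0 : d = 0.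
    by apply: dU => /=; rewrite big1 ?subr0// => k _; rewrite mxE scale0r.
  have /rowP/(_ j) : d = \row_j c j.
    apply: dU => /=; rewrite sub0r; apply/eqP; rewrite oppr_eq0; apply/eqP.
    by rewrite -[RHS]c0; apply: eq_bigr => k _; rewrite mxE.
  by rewrite d0 !mxE.
have [m [C [C0 hC]]] := finite_dim_bound sc free.
have ep' j : lp sc p (e j) by case: (eker j).
exists m, (C * \sum_(j < a) lpn sc p (e j)); split.
  by rewrite mulr_ge0// sumr_ge0// => j _; exact: lpn_ge0.
move=> u t uker t0 ut; have [d [/= /eqP du _]] := he _ uker.
move: du; rewrite subr_eq0 => /eqP du.
rewrite du -/(lincomb e d) mulrAC; apply: lpn_lincomb => // j.
by apply: (hC (fun j => d ord0 j)) => // i im; rewrite -du; exact: ut.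
Qed.

(** The bound required by [domination] holds because the kernel part [u] of [z] is determined by its
    values on a ball where [z] vanishes: there [u] equals [-(z - u)], which is already
    controlled. *)
Lemma fredholm_domination (p : \bar R) : exponent p -> fredholm A p ->
  exists (H : ZN -> \bar R) (m : nat),
  [/\ forall i, (0 <= H i)%E, (mass H < +oo)%E &
    forall x, bounded sc x -> forall i,
      (nrm x i <= conv H (fun k => nrm (wiener_op A x) k +
                           if (zabs k < m)%N then nrm x k else 0) i)%E].
Proof.
move=> ep [fker [n [b bp hb]]].
have [C C0 hC] := bordered_estimate ep bp hb.
have [m [D [D0 hD]]] := kernel_local_bound ep fker.
apply: (@domination _ _ _ _ _ A (nexp p) (nexp_ge1 ep) (C + D * C) m).
  by rewrite addr_ge0// mulr_ge0.
move=> z [M zM] zm; have zp := lp_finite_support ep zM.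
rewrite (lpnE ep zp) (lpnE ep (op_lp A ep zp)) -EFinM lee_fin.
have [u [uker zu _]] := hC z 0 zp; move: zu; rewrite lincomb0 addr0 => zu.
have up : lp sc p u by case: uker.
have zup : lp sc p (z - u) by exact: lpB.
have t0 : 0 <= C * lpn sc p (wiener_op A z) by rewrite mulr_ge0// lpn_ge0.
have ub : lpn sc p u <= D * (C * lpn sc p (wiener_op A z)).
  apply: hD => // i im; apply: le_trans zu.
  apply: le_trans (rnorm_le_lpn ep i zup).
  by rewrite -[leRHS]rnormN [X in _ <= rnorm (- X)](_ : _ = z i - u i)// zm// sub0r opprK.
rewrite -[z](subrK u); apply: le_trans (lpnD ep zup up) _.
by rewrite subrK mulrDl -mulrA; exact: lerD.
Qed.

End FredholmEstimates.

(** * Regularity of bounded solutions and transfer to l^1 *)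

Section Regularity.
Variables (R : realType) (K : numFieldType) (sc : scalars R K).
Variables (N : nat) (X : completeNormedModType K) (A : wiener sc N X).
Local Notation ZN := 'rV[int]_N.
Local Notation rnorm := (rnorm sc).
Local Notation nrm := (nrm sc).
Variables (H : ZN -> \bar R) (m : nat).
Hypothesis H0 : forall i, (0 <= H i)%E.
Hypothesis Hm : (mass H < +oo)%E.
Hypothesis dom : forall x, bounded sc x -> forall i,
  (nrm x i <= conv H (fun k => nrm (wiener_op A x) k +
                           if (zabs k < m)%N then nrm x k else 0) i)%E.

Lemma mass_near (x : ZN -> X) :
  (mass (fun k => if (zabs k < m)%N then nrm x k else 0) < +oo)%E.
Proof.
pose r k := if (zabs k < m)%N then rnorm (x k) else 0.
rewrite (_ : (fun k => _) = (fun k => (r k)%:E)); last first.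
  by apply/funext => k; rewrite /r; case: ifP.
apply: (mass_fset (B := zball N m)) => i; rewrite /r.
  by case: ifP => // _; exact: rnorm_ge0.
by move=> iB; rewrite ifN//; apply: contra iB => im; exact/zabs_zball/ltnW.
Qed.

Lemma near_ge0 (x : ZN -> X) k : (0 <= if (zabs k < m)%N then nrm x k else 0)%E.
Proof. by case: ifP => // _; exact: nrm_ge0. Qed.

Lemma regularity (q : \bar R) x : exponent q -> bounded sc x ->
  lp sc q (wiener_op A x) -> lp sc q x.
Proof.
move=> eq bx /lpE Axq; apply/lpE.
apply: (lpmem_le eq (nrm_ge0 sc x) (dom bx)).
have g0 k : (0 <= nrm (wiener_op A x) k + if (zabs k < m)%N then nrm x k else 0)%E.
  by apply: adde_ge0; [exact: nrm_ge0|exact: near_ge0].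
apply: (lpmem_conv eq H0 g0 Hm).
apply: (lpmemD eq (nrm_ge0 sc _) (near_ge0 x) Axq).
exact: (lpmem_mass eq (near_ge0 x) (mass_near x)).
Qed.

Lemma exponent_oo : exponent (+oo : \bar R).
Proof. by right; rewrite leey. Qed.

Lemma exponent_1 : exponent (1%E : \bar R).
Proof. by right. Qed.

Lemma lp_ker_oo (q : \bar R) : exponent q -> lp_ker A q = lp_ker A +oo%E.
Proof.
move=> eq; apply/seteqP; split => x [xq Ax]; split => //.
  exact/bounded_lp/(lp_bounded eq).
apply: regularity => //; first exact: lp_bounded exponent_oo xq.
by rewrite Ax; exact: lp0.
Qed.

Lemma lp_rangeE (q : \bar R) f : exponent q ->
  lp_range A q f <-> lp sc q f /\ lp_range A +oo%E f.
Proof.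
move=> eq; split => [[x xq <-]|[fq [x xo xf]]].
  split; first exact: op_lp.
  by exists x => //; exact/bounded_lp/(lp_bounded eq).
exists x => //; apply: regularity => //; first exact: lp_bounded exponent_oo xo.
by rewrite xf.
Qed.

Lemma nu1 (g : ZN -> \bar R) : (forall i, (0 <= g i)%E) -> nu 1%E g = mass g.
Proof.
move=> g0; rewrite /= invr1 poweRe1; first by apply: eq_esum => i _; rewrite poweRe1.
by apply: esum_ge0 => i _; rewrite poweR_ge0.
Qed.

Lemma nexp1 : nexp (1%E : \bar R) = 1%E.
Proof. by rewrite /nexp eqe oner_eq0. Qed.

Lemma lp1E (x : ZN -> X) : lp sc 1%E x <-> (mass (nrm x) < +oo)%E.
Proof.
rewrite lpE /lpmem nexp1 nu1; last by move=> i; exact: nrm_ge0.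
by split => [[]//|h]; split => // /eqP; rewrite eqe oner_eq0.
Qed.

Lemma lpn1E (x : ZN -> X) : lp sc 1%E x -> mass (nrm x) = (lpn sc 1%E x)%:E.
Proof.
move=> xp; rewrite -(lpnE exponent_1 xp) nexp1 nu1// => i; exact: nrm_ge0.
Qed.

Lemma lp1_lp (q : \bar R) (x : ZN -> X) : exponent q -> lp sc 1%E x -> lp sc q x.
Proof. by move=> eq /lp1E xm; apply/lpE; exact: (lpmem_mass eq (nrm_ge0 sc x)). Qed.

Lemma fredholm_lp1 (p : \bar R) : exponent p -> fredholm A p -> fredholm A 1%E.
Proof.
move=> ep [kf rf]; split; first by rewrite (lp_ker_oo exponent_1) -(lp_ker_oo ep).
apply: (finite_dim_sub (@subspace_lp _ _ sc N X _ ep) (subspace_range A ep)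
  (@subspace_lp _ _ sc N X _ exponent_1) _ _ rf); first by move=> x; exact: lp1_lp.
move=> x x1; rewrite (lp_rangeE _ exponent_1) (lp_rangeE _ ep).
by split => -[_ ?]; split => //; exact: lp1_lp.
Qed.

End Regularity.

Section Trapezoid.
Variable N : nat.
Local Notation ZN := 'rV[int]_N.

(** A tent cut at half height. The plateau lets division by [h] recover [x] exactly near the
    origin. *)
Definition trap (h : nat) (i : ZN) : nat := minn h (h + h - zabs i).

Lemma trap_le h i : (trap h i <= h)%N.
Proof. exact: geq_minl. Qed.

Lemma trap_near h i : (zabs i <= h)%N -> trap h i = h.
Proof. by move=> ih; apply/minn_idPl; rewrite -addnBA// leq_addr. Qed.

Lemma trap_far h i : (h + h <= zabs i)%N -> trap h i = 0%N.
Proof. by rewrite -subn_eq0 /trap => /eqP ->; rewrite minn0. Qed.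

Lemma trap_lip h (k al : ZN) :
  (ndist (trap h k) (trap h (k + al)) <= minn (h + h) (zabs al))%N.
Proof.
have h1 := zabsD k al; have h2 := zabsB (k + al) al.
rewrite addrK in h2; move: h1 h2; rewrite /ndist /trap.
move: (zabs (k + al)) (zabs k) (zabs al) => u v w; lia.
Qed.

Lemma ndist_le (a b : nat) : (ndist a b <= a + b)%N.
Proof. by rewrite /ndist leq_add// leq_subr. Qed.

End Trapezoid.

(** Used twice in [improve], with [M = M1] and [M = 1]: each of two errors costs a quarter, and
    together they give the factor one half. *)
Lemma absorption_le (R : realType) (C M : R) : 0 <= C -> 0 <= M ->
  C * ((4 * (C * M + 1))^-1 * M) <= 4^-1.
Proof.
move=> C0 M0; have CM : 0 <= C * M by rewrite mulr_ge0.
have D0 : 0 < 4 * (C * M + 1) by lra.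
rewrite (_ : _ * _ = (C * M) / (4 * (C * M + 1))); last by ring.
by rewrite ler_pdivrMr//; lra.
Qed.

Lemma quarter_add_quarter (R : realType) : 4^-1 + 4^-1 <= 2^-1 :> R.
Proof. lra. Qed.

(** * Improving solutions by elements of the kernel *)

Section Correction.
Variables (R : realType) (K : numFieldType) (sc : scalars R K).
Variables (N : nat) (X : completeNormedModType K) (A : wiener sc N X).
Local Notation ZN := 'rV[int]_N.
Local Notation rnorm := (rnorm sc).
Local Notation nrm := (nrm sc).
Local Notation lpn1 := (lpn sc 1%E).
Variables (H : ZN -> \bar R) (m : nat).
Hypothesis H0 : forall i, (0 <= H i)%E.
Hypothesis Hm : (mass H < +oo)%E.
Hypothesis dom : forall x, bounded sc x -> forall i,
  (nrm x i <= conv H (fun k => nrm (wiener_op A x) k +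
                           if (zabs k < m)%N then nrm x k else 0) i)%E.
Variables (n : nat) (b : 'I_n -> ZN -> X).
Hypothesis b1 : forall j, lp sc 1%E (b j).
Hypothesis b_basis : forall f, lp sc 1%E f -> exists! c : 'rV[K]_n,
     lp_range A 1%E (f - \sum_(j < n) c ord0 j *: b j).
Implicit Types (x f : ZN -> X) (c : 'rV[K]_n) (t : R).
Local Open Scope ereal_scope.

Let a := wmajor A.
Let a0 : forall i, 0 <= a i := wmajor_ge0 A.

Definition bmass (i : ZN) : \bar R := \sum_(j < n) nrm (b j) i.
Definition nearm (i : ZN) : \bar R := if (zabs i < m)%N then 1 else 0.
(** For a solution of size [t], the data in the pointwise bound are at most [nrm f + t * junk]: the
    coefficients contribute through [bmass], the entries near the origin through [nearm]. *)
Definition junk (i : ZN) : \bar R := bmass i + nearm i.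

Lemma bmass_ge0 i : 0 <= bmass i.
Proof. by apply: sume_ge0 => j _; exact: nrm_ge0. Qed.

Lemma nearm_ge0 i : 0 <= nearm i.
Proof. by rewrite /nearm; case: ifP. Qed.

Lemma junk_ge0 i : 0 <= junk i.
Proof. by apply: adde_ge0; [exact: bmass_ge0|exact: nearm_ge0]. Qed.

Lemma mass_bmass : mass bmass < +oo.
Proof.
rewrite /mass /bmass esum_sum; last by move=> *; exact: nrm_ge0.
rewrite (@eq_bigr _ _ _ _ _ _ _ (fun j => (lpn1 (b j))%:E)); last first.
  by move=> j _; rewrite -lpn1E.
by rewrite sumEFin ltry.
Qed.

Lemma mass_junk : mass junk < +oo.
Proof.
rewrite /mass esumD; last 2 first.
- by move=> i _; exact: bmass_ge0.
- by move=> i _; exact: nearm_ge0.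
apply: lte_add_pinfty; first exact: mass_bmass.
pose r (k : ZN) : R := if (zabs k < m)%N then 1%R else 0%R.
rewrite (@eq_esum _ _ _ _ (fun k => (r k)%:E)); last first.
  by move=> k _; rewrite /r /nearm; case: ifP.
apply: (mass_fset (B := zball N m)) => i; rewrite /r; first by case: ifP.
by move=> iB; rewrite ifN//; apply: contra iB => im; exact/zabs_zball/ltnW.
Qed.

Lemma nrm_lincomb c t i : (forall j, rabs sc (c ord0 j) <= t)%R ->
  nrm (lincomb b c) i <= t%:E * bmass i.
Proof.
move=> ct; rewrite /bmass ge0_sume_distrr; last by move=> j _; exact: nrm_ge0.
apply: (@le_trans _ _ (\sum_(j < n) (rnorm ((c ord0 j *: b j) i))%:E)).
  rewrite sumEFin lee_fin /lincomb fct_sumE; exact: rnorm_sum.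
apply: lee_sum => j _; rewrite -EFinM lee_fin rnormZ.
by apply: ler_wpM2r => //; exact: rnorm_ge0.
Qed.

(** [t] bounds what the pointwise estimate does not control through [f]: the entries of [x] near the
    origin and the coefficients. *)
Definition solves f x c t := [/\ lp sc 1 x, (wiener_op A x + lincomb b c)%R = f,
  forall i, (zabs i < m)%N -> (rnorm (x i) <= t)%R &
  forall j, (rabs sc (c ord0 j) <= t)%R].

Lemma solves_dom f x c t k : (0 <= t)%R -> solves f x c t ->
  nrm x k <= conv H (nrm f) k + t%:E * conv H junk k.
Proof.
move=> t0 [x1 xf xt ct]; have bx := lp_bounded (exponent_1 R) x1.
rewrite -convZr ?lee_fin//; last by move=> i; exact: junk_ge0.
rewrite -convDr//; last 2 first.
- by move=> i; exact: nrm_ge0.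
- by move=> i; apply: mule_ge0; rewrite ?lee_fin//; exact: junk_ge0.
apply: le_trans (dom bx k) _; apply: le_conv => // i.
  by apply: adde_ge0; [exact: nrm_ge0|exact: near_ge0].
rewrite /junk ge0_muleDr ?bmass_ge0 ?nearm_ge0// addeA; apply: leeD.
  have -> : wiener_op A x = (f - lincomb b c)%R by rewrite -xf addrK.
  by apply: le_trans (nrmB _ _ _ _) _; rewrite leeD2l// nrm_lincomb.
rewrite /nearm; case: ifP => im; last by rewrite mule0.
by rewrite mule1 lee_fin xt.
Qed.

Lemma weight_lp1 chi (h : nat) x : (forall i, (chi i <= h)%N) ->
  lp sc 1 x -> lp sc 1 (weight chi x).
Proof.
move=> ch /lpE x1; apply/lpE.
apply: (lpmem_le (exponent_1 R) (nrm_ge0 sc _) _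
  (lpmemZ (c := h%:R) (exponent_1 R) (nrm_ge0 sc x) _ x1)) => // i.
rewrite nrm_weight; apply: lee_wpmul2r; first exact: nrm_ge0.
by rewrite lee_fin ler_nat.
Qed.

(** Bounds column [k] of the commutator with the trapezoid, as suits the norm of l^1. It is
    uniformly small relative to [h] ([trapvar_le]) and, the trapezoid having finite support,
    summable over [k] ([mass_trapvar]). *)
Definition trapvar h (k : ZN) : \bar R :=
  \esum_(al in [set: ZN]) (a al * (ndist (trap h k) (trap h (k + al)%R))%:R%:E).

Lemma trapvar_ge0 h k : 0 <= trapvar h k.
Proof. by apply: esum_ge0 => al _; apply: mule_ge0 => //; rewrite lee_fin. Qed.

Lemma trapvar_le h k : (0 < h)%N -> trapvar h k <= h%:R%:E * mass (lipw a h).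
Proof.
move=> h0; rewrite -esumZl ?lee_fin//; last by move=> al; exact: lipw_ge0.
apply: le_esum => al _; rewrite /lipw muleCA -EFinM; apply: lee_wpmul2l => //.
rewrite lee_fin mulrC divfK; last by rewrite pnatr_eq0 -lt0n.
by rewrite ler_nat trap_lip.
Qed.

Lemma mass_trap h : mass (fun i : ZN => ((trap h i)%:R : R)%:E) < +oo.
Proof.
apply: (mass_fset (B := zball N (h + h))) => i; first by [].
move=> iB; rewrite trap_far// leqNgt; apply: contra iB => ih.
exact/zabs_zball/ltnW.
Qed.

Lemma mass_trapvar h : mass (trapvar h) < +oo.
Proof.
have ta0 al k : 0 <= a al * (ndist (trap h k) (trap h (k + al)%R))%:R%:E.
  by apply: mule_ge0 => //; rewrite lee_fin.
rewrite /mass esum_exchange//.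
pose Th := mass (fun i : ZN => ((trap h i)%:R : R)%:E).
have Th0 : 0 <= Th by apply: mass_ge0 => i; rewrite lee_fin.
apply: (@le_lt_trans _ _ (\esum_(al in [set: ZN]) (a al * (Th + Th)))).
  apply: le_esum => al _; rewrite esumZl//; apply: lee_wpmul2l => //.
  apply: (@le_trans _ _ (\esum_(k in [set: ZN]) (((trap h k)%:R : R)%:E +
    ((trap h (k + al)%R)%:R : R)%:E))).
    by apply: le_esum => k _; rewrite -EFinD lee_fin -natrD ler_nat ndist_le.
  rewrite esumD//; try by move=> *; rewrite lee_fin.
  apply: leeD => //.
  rewrite /Th -(mass_shift (fun i : ZN => ((trap h i)%:R : R)%:E) (- al)%R).
  by apply: le_esum => k _; rewrite opprK.
rewrite esumZr ?adde_ge0//.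
have Thf : Th \is a fin_num by rewrite ge0_fin_numE//; exact: mass_trap.
have af : mass a \is a fin_num by rewrite ge0_fin_numE ?mass_wmajor ?mass_ge0.
by rewrite ltey_eq fin_numM// fin_numD Thf.
Qed.

Lemma trap_commutator h x : lp sc 1 x ->
  mass (nrm (wiener_op A (weight (trap h) x) - weight (trap h) (wiener_op A x))%R)
  <= \esum_(k in [set: ZN]) (trapvar h k * nrm x k).
Proof.
move=> x1; have bx := lp_bounded (exponent_1 R) x1.
have bcx := bounded_weight (trap_le h) bx.
have t0 (al i : ZN) : 0 <= a al * ((ndist (trap h (i - al)%R) (trap h i))%:R%:E *
      nrm x (i - al)%R).
  by rewrite !mule_ge0 ?lee_fin// rnorm_ge0.
apply: (@le_trans _ _ (\esum_(i in [set: ZN]) \esum_(al in [set: ZN])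
   (a al * ((ndist (trap h (i - al)%R) (trap h i))%:R%:E * nrm x (i - al)%R)))).
  by apply: le_esum => i _; exact: commutator.
rewrite esum_exchange//.
rewrite (_ : \esum_(k in _) (trapvar h k * _) = \esum_(k in [set: ZN])
   \esum_(al in [set: ZN])
   (a al * ((ndist (trap h k) (trap h (k + al)%R))%:R%:E * nrm x k))); last first.
  apply: eq_esum => k _; rewrite -esumZr ?nrm_ge0//; last first.
    by move=> al; apply: mule_ge0 => //; rewrite lee_fin.
  by apply: eq_esum => al _; rewrite muleA.
rewrite [leRHS]esum_exchange; last by move=> *; rewrite !mule_ge0 ?lee_fin// rnorm_ge0.
apply: le_esum => al _; rewrite (reindex_esumT _ (addr_bij (- al)%R)).
by apply: le_esum => k _; rewrite opprK addrK.
Qed.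

(* [x] is replaced by [x - u / h], where [u] in the kernel approximates the cut
   off solution [weight (trap h) x]; near the origin the cutoff equals [h]. *)
Lemma improve : exists (G : ZN -> \bar R), [/\ forall i, 0 <= G i, mass G < +oo &
  forall f x c t s, lp sc 1 f -> (0 <= t)%R -> solves f x c t ->
    \esum_(k in [set: ZN]) (G k * nrm f k) <= s%:E ->
    exists x', solves f x' c (s + t / 2)%R].
Proof.
have [C C0 hC] := bordered_estimate (exponent_1 R) b1 b_basis.
have mfin (g : ZN -> \bar R) : (forall i, 0 <= g i) -> mass g < +oo ->
    exists2 r : R, (0 <= r)%R & mass g = r%:E.
  move=> g0 gm; exists (fine (mass g)); first by rewrite fine_ge0// mass_ge0.
  by rewrite fineK// ge0_fin_numE// mass_ge0.
have [M M0 ME] := mfin _ H0 Hm.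
have [J J0 JE] := mfin _ junk_ge0 mass_junk.
(* [M1] is the mass of [conv H junk], the factor of [t] in [solves_dom]. *)
pose M1 : R := (M * J)%R; have M10 : (0 <= M1)%R by rewrite mulr_ge0.
have e10 : (0 < (4 * (C * M1 + 1))^-1)%R.
  by rewrite invr_gt0 mulr_gt0// ltr_wpDl// mulr_ge0.
have e20 : (0 < (4 * (C + 1))^-1)%R by rewrite invr_gt0 mulr_gt0// ltr_wpDl.
have [h1 hh1] := mass_lipw_small a0 (mass_wmajor A) e10.
have [B hB] := esum_tail bmass_ge0 mass_bmass e20.
have [h2 hh2] := fset_zabs B.
(* Beyond [h1] the commutator is relatively small, beyond [h2] the [b j] have little mass left
   outside the plateau, and [m] puts the ball of [dom] inside the plateau. *)
pose h := (h1 + h2 + m)%N.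
have [h0 small1] : (0 < h)%N /\ mass (lipw a h) <= ((4 * (C * M1 + 1))^-1)%:E.
  by apply: hh1; rewrite /h -addnA leq_addr.
have h2h : (h2 <= h)%N by rewrite /h addnAC leq_addl.
have mh : (m <= h)%N by rewrite /h leq_addl.
have small2 : \esum_(i in [set: ZN]) (if (zabs i <= h)%N then 0 else bmass i) <=
    ((4 * (C + 1))^-1)%:E.
  apply: le_trans (hB B (fsubset_refl _)); apply: le_esum => i _.
  case: ifPn => [_|ih]; first by case: ifP => // _; exact: bmass_ge0.
  rewrite ifN//; apply: contra ih => /hh2 ih.
  exact: leq_trans (ltnW ih) h2h.
have hR : (0 < h%:R :> R)%R by rewrite ltr0n.
(* The weight with which [f j] enters the commutator through the term [conv H (nrm f)] of
   [solves_dom]. *)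
pose G1 j := \esum_(k in [set: ZN]) (trapvar h k * H (k - j)%R).
have G10 j : 0 <= G1 j by apply: esum_ge0 => k _; rewrite mule_ge0// trapvar_ge0.
have G1m : mass G1 < +oo.
  rewrite /mass /G1 esum_exchange; last by move=> *; rewrite mule_ge0// trapvar_ge0.
  have [r r0 rE] := mfin _ (trapvar_ge0 h) (mass_trapvar h).
  apply: (@le_lt_trans _ _ (r * M)%:E); last exact: ltry.
  rewrite EFinM -rE -esumZr ?lee_fin//; last by move=> k; exact: trapvar_ge0.
  apply: le_esum => k _; rewrite esumZl ?trapvar_ge0//; apply: lee_wpmul2l.
    exact: trapvar_ge0.
  by rewrite -ME /mass [leRHS](reindex_esumT _ (subr_bij k)).
pose T (i : ZN) : \bar R := ((trap h i)%:R : R)%:E.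
have T0 i : 0 <= T i by rewrite lee_fin.
have Ch0 : (0 <= C / h%:R)%R by rewrite divr_ge0.
(* [T] accounts for the cut off right-hand side, [C] for the bordered estimate, and [1 / h] for the
   final rescaling. *)
exists (fun j => (C / h%:R)%:E * (T j + G1 j)).
have TG0 j : 0 <= T j + G1 j by exact: adde_ge0.
split.
- by move=> j; rewrite mule_ge0 ?lee_fin.
- rewrite /mass esumZl ?lee_fin// esumD//.
  have [r r0 rE] := mfin _ T0 (mass_trap h).
  have [r' r'0 r'E] := mfin _ G10 G1m.
  rewrite -/(mass T) -/(mass G1) rE r'E; exact: ltry.
move=> f x c t s f1 t0 sol Gs.
have [x1 xf xt ct] := sol.
have bx := lp_bounded (exponent_1 R) x1.
pose z := weight (trap h) x; pose d := (h%:R *: c)%R.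
have z1 : lp sc 1 z := weight_lp1 (trap_le h) x1.
pose g := (wiener_op A z + lincomb b d)%R.
have [u [uker zu du]] := hC z d z1.
have u1 : lp sc 1 u by case: uker.
have bu := lp_bounded (exponent_1 R) u1.
(* Three sources of [g]: the cut off [f], the commutator applied to [x], and the combination of the
   [b j] weighted by [h - trap h], which vanishes on the plateau. *)
have gE : g = ((weight (trap h) f + (wiener_op A z - weight (trap h) (wiener_op A x)))
   + weight (fun i => h - trap h i)%N (lincomb b c))%R.
  apply/funext => i; rewrite /g -{1}xf /d lincombZ.
  rewrite -[LHS]/(wiener_op A z i + h%:R *: lincomb b c i)%R.
  rewrite -[RHS]/((wiener_op A x i + lincomb b c i) *+ trap h i +
    (wiener_op A z i - wiener_op A x i *+ trap h i) +
    lincomb b c i *+ (h - trap h i))%R.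
  rewrite scaler_nat mulrnDl mulrnBr ?trap_le//.
  move: (wiener_op A z i) (wiener_op A x i *+ _)%R (lincomb b c i *+ trap h i)%R
    (lincomb b c i *+ h)%R => p' q' r' w'.
  rewrite [(q' + r')%R]addrC [X in _ = (X + _)%R]addrACA subrr addr0.
  by rewrite [(w' - r')%R]addrC addrACA subrr add0r.
have c1 : lp sc 1 (lincomb b c) by apply: lincomb_lp => //; exact: exponent_1.
have g1 : lp sc 1 g.
  apply: lpD; [exact: exponent_1|apply: op_lp => //; exact: exponent_1|].
  by apply: lincomb_lp => //; exact: exponent_1.
pose Z := \esum_(j in [set: ZN]) ((T j + G1 j) * nrm f j).
have tv0 k : 0 <= trapvar h k by exact: trapvar_ge0.
have nf0 k : 0 <= nrm f k by exact: nrm_ge0.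
pose eta : R := ((4 * (C * M1 + 1))^-1 * M1 + (4 * (C + 1))^-1)%R.
have part1 : mass (nrm (weight (trap h) f)) = \esum_(j in [set: ZN]) (T j * nrm f j).
  by apply: eq_esum => j _; rewrite nrm_weight.
have part2 : mass (nrm (wiener_op A z - weight (trap h) (wiener_op A x))%R) <=
    \esum_(j in [set: ZN]) (G1 j * nrm f j) + (t * (h%:R * ((4 * (C * M1 + 1))^-1 * M1)))%:E.
  apply: le_trans (trap_commutator h x1) _.
  have cj0 k : 0 <= conv H junk k by apply: conv_ge0 => // i; exact: junk_ge0.
  have cf0 k : 0 <= conv H (nrm f) k by exact: conv_ge0.
  have tE0 : 0 <= t%:E by rewrite lee_fin.
  apply: (@le_trans _ _ (\esum_(k in [set: ZN]) (trapvar h k * conv H (nrm f) k +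
     t%:E * (trapvar h k * conv H junk k)))).
    apply: le_esum => k _; rewrite [t%:E * _]muleCA -ge0_muleDr ?mule_ge0//.
    by apply: lee_wpmul2l => //; exact: (solves_dom _ t0 sol).
  rewrite esumD; last 2 first.
  - by move=> k _; exact: mule_ge0.
  - by move=> k _; rewrite !mule_ge0.
  apply: leeD.
    rewrite (@eq_esum _ _ _ _ (fun k => \esum_(j in [set: ZN])
        (trapvar h k * (H (k - j)%R * nrm f j)))); last first.
      by move=> k _; rewrite convE esumZl// => j; exact: mule_ge0.
    rewrite esum_exchange; last by move=> k j; rewrite !mule_ge0.
    apply: le_esum => j _; rewrite /G1 -esumZr//; last by move=> k; exact: mule_ge0.
    by apply: le_esum => k _; rewrite muleA.
  rewrite esumZl//; last by move=> k; exact: mule_ge0.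
  rewrite EFinM; apply: lee_wpmul2l => //.
  apply: (@le_trans _ _ (\esum_(k in [set: ZN])
      ((h%:R * (4 * (C * M1 + 1))^-1)%:E * conv H junk k))).
    apply: le_esum => k _; apply: lee_wpmul2r => //.
    apply: le_trans (trapvar_le k h0) _; rewrite EFinM.
    by apply: lee_wpmul2l => //; rewrite lee_fin.
  rewrite esumZl ?lee_fin ?mulr_ge0 ?(ltW e10)// -/(mass _) mass_conv//; last first.
    exact: junk_ge0.
  by rewrite ME JE -!EFinM lee_fin /M1 !mulrA.
have part3 : mass (nrm (weight (fun i => h - trap h i)%N (lincomb b c))) <=
    (t * (h%:R * (4 * (C + 1))^-1))%:E.
  apply: (@le_trans _ _ (\esum_(i in [set: ZN]) ((t * h%:R)%:E *
      (if (zabs i <= h)%N then 0 else bmass i)))).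
    apply: le_esum => i _; rewrite nrm_weight; case: ifPn => ih.
      by rewrite trap_near// subnn mul0e mule0.
    rewrite [(t * _)%R]mulrC EFinM -muleA; apply: lee_pmul; rewrite ?nrm_ge0 ?lee_fin//.
      by rewrite ler_nat leq_subr.
    exact: nrm_lincomb.
  rewrite esumZl ?lee_fin ?mulr_ge0//; last by move=> i; case: ifP => // _; exact: bmass_ge0.
  rewrite mulrA (EFinM (t * h%:R)%R); apply: lee_wpmul2l; last exact: small2.
  by rewrite lee_fin mulr_ge0.
have gle : (lpn1 g)%:E <= Z + (t * (h%:R * eta))%:E.
  rewrite -lpn1E// gE.
  apply: (@le_trans _ _ (mass (nrm (weight (trap h) f)) +
     mass (nrm (wiener_op A z - weight (trap h) (wiener_op A x))%R) +
     mass (nrm (weight (fun i => h - trap h i)%N (lincomb b c))))).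
    rewrite /mass -!esumD; try by move=> *; rewrite ?adde_ge0 ?nrm_ge0.
    apply: le_esum => i _; apply: le_trans (nrmD _ _ _ _) _.
    by rewrite leeD2r// nrmD.
  rewrite part1; apply: le_trans (leeD (leeD (lexx _) part2) part3) _.
  have -> : (t * (h%:R * eta))%:E = (t * (h%:R * ((4 * (C * M1 + 1))^-1 * M1)))%:E +
      (t * (h%:R * (4 * (C + 1))^-1))%:E by rewrite -EFinD /eta -!mulrDr.
  rewrite [leRHS]addeA leeD2r// [leLHS]addeA leeD2r//.
  rewrite /Z -esumD; try by move=> j _; rewrite mule_ge0.
  by apply: le_esum => j _; rewrite ge0_muleDl.
have fin : ((C / h%:R) * lpn1 g <= s + t / 2)%R.
  rewrite -lee_fin EFinM; apply: le_trans (lee_wpmul2l _ gle) _; first by rewrite lee_fin.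
  have Z0 : 0 <= Z by apply: esum_ge0 => j _; rewrite mule_ge0.
  have eta0 : (0 <= eta)%R by rewrite addr_ge0 ?mulr_ge0 ?(ltW e10) ?(ltW e20).
  rewrite ge0_muleDr//; last by rewrite lee_fin !mulr_ge0.
  rewrite EFinD; apply: leeD.
    apply: le_trans Gs; rewrite /Z -esumZl ?lee_fin//; last by move=> j; exact: mule_ge0.
    by apply: le_esum => j _; rewrite muleA.
  rewrite -EFinM lee_fin.
  have -> : (C / h%:R * (t * (h%:R * eta)) = t * (C * eta))%R.
    by field; rewrite gt_eqF.
  apply: ler_wpM2l => //; rewrite /eta mulrDr.
  have k1 := absorption_le C0 M10.
  have := absorption_le C0 ler01; rewrite !mulr1 => k2.
  exact: le_trans (lerD k1 k2) (quarter_add_quarter R).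
have hK : (h%:R != 0 :> K)%R by rewrite pnatr_eq0 -lt0n.
(* On the ball of radius [m], [h] times the new solution is [z - u]. The coefficients are unchanged,
   but [h *: c = d] gives them the improved bound as well. *)
exists (x - (h%:R)^-1 *: u)%R; split.
- apply: lpB => //; first exact: exponent_1.
  by apply: lpZ => //; exact: exponent_1.
- rewrite opB ?opZ//; last exact: boundedZ.
  by case: uker => _ ->; rewrite scaler0 subr0.
- move=> i im.
  have zu1 : lp sc 1 (z - u)%R by apply: lpB => //; exact: exponent_1.
  apply: le_trans fin; rewrite mulrAC ler_pdivlMr//; apply: le_trans zu.
  apply: le_trans (rnorm_le_lpn (exponent_1 R) i zu1).
  rewrite -[(z - u)%R i]/(x i *+ trap h i - u i)%R trap_near; last first.
    exact: leq_trans (ltnW im) mh.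
  rewrite -rnormMn -[(x - _)%R i]/(x i - (h%:R)^-1 *: u i)%R mulrnBl.
  by rewrite -(scaler_nat h (h%:R^-1 *: u i)) scalerA mulfV// scale1r.
- move=> j; apply: le_trans fin; rewrite mulrAC ler_pdivlMr//.
  by apply: le_trans (du j); rewrite mxE rabsM rabs_nat mulrC.
Qed.

End Correction.

Lemma summable_weights (R : realType) (I : countType) :
  exists eta : I -> R, (forall i, 0 < eta i) /\
    (\esum_(i in [set: I]) (eta i)%:E <= 2%:E)%E.
Proof.
exists (fun i : I => (2 ^+ choice.pickle i)^-1); split.
  by move=> i; rewrite invr_gt0 exprn_gt0.
apply: le_trans (esum_pow2 R); apply: ge_esum => A.
rewrite -(big_map (@choice.pickle I) xpredT (fun k => ((2 ^+ k)^-1 : R)%:E)).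
apply: (uniq_seq_le_esum (fun k => ((2 ^+ k)^-1 : R)%:E)).
by rewrite map_inj_uniq ?fset_uniq//; exact: (pcan_inj choice.pickleK).
Qed.

(** * Solving the bordered equation in every l^q *)

Section Solution.
Variables (R : realType) (K : numFieldType) (sc : scalars R K).
Variables (N : nat) (X : completeNormedModType K) (A : wiener sc N X).
Local Notation ZN := 'rV[int]_N.
Local Notation rnorm := (rnorm sc).
Local Notation nrm := (nrm sc).
Variables (H : ZN -> \bar R) (m : nat).
Hypothesis H0 : forall i, (0 <= H i)%E.
Hypothesis Hm : (mass H < +oo)%E.
Hypothesis dom : forall x, bounded sc x -> forall i,
  (nrm x i <= conv H (fun k => nrm (wiener_op A x) k +
                           if (zabs k < m)%N then nrm x k else 0) i)%E.
Variables (n : nat) (b : 'I_n -> ZN -> X).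
Hypothesis b1 : forall j, lp sc 1%E (b j).
Hypothesis b_basis : forall f, lp sc 1%E f -> exists! c : 'rV[K]_n,
     lp_range A 1%E (f - \sum_(j < n) c ord0 j *: b j).
Implicit Types (x f : ZN -> X) (c : 'rV[K]_n).
Local Open Scope ereal_scope.

Let a := wmajor A.
Let a0 : forall i, 0 <= a i := wmajor_ge0 A.
Local Notation solves := (solves A m b).
Local Notation e1 := (exponent_1 R).

Lemma exact_solution f : lp sc 1 f -> exists x c, exists2 t : R, (0 <= t)%R & solves f x c t.
Proof.
move=> /b_basis[c [[x x1 xf] _]].
exists x, c, (lpn sc 1 x + \sum_(j < n) rabs sc (c ord0 j))%R.
  by rewrite addr_ge0 ?lpn_ge0 ?sumr_ge0// => [|j _]; [exact: e1|exact: rabs_ge0].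
split => //; first by rewrite xf subrK.
  move=> i _; apply: le_trans (rnorm_le_lpn e1 i x1) _; rewrite lerDl.
  by apply: sumr_ge0 => j _; exact: rabs_ge0.
move=> j; rewrite (bigD1 j)//= addrCA lerDl addr_ge0 ?lpn_ge0//; first exact: e1.
by apply: sumr_ge0 => k _; exact: rabs_ge0.
Qed.

Lemma solves_le f x c (s t : R) : (s <= t)%R -> solves f x c s -> solves f x c t.
Proof.
move=> st [h1 h2 h3 h4]; split => // [i im|j].
  exact: le_trans (h3 i im) st.
exact: le_trans (h4 j) st.
Qed.

(** Iterating [t -> s + t / 2] leads from any starting bound towards [2 * s]. The slack [eta] allows
    stopping after finitely many steps, so no limit of solutions has to be taken. *)
Lemma good_solution : exists G : ZN -> \bar R, [/\ forall i, 0 <= G i, mass G < +oo &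
  forall f (s eta : R), lp sc 1 f -> (0 < eta)%R ->
    \esum_(k in [set: ZN]) (G k * nrm f k) <= s%:E ->
    exists x c, solves f x c (2 * s + eta)%R].
Proof.
have [G [G0 Gm hG]] := improve H0 Hm dom b1 b_basis.
exists G; split => // f s eta f1 eta0 Gs.
have s0 : (0 <= s)%R.
  by rewrite -lee_fin; apply: le_trans Gs; apply: esum_ge0 => k _; rewrite mule_ge0 ?nrm_ge0.
have [x0 [c [t t0 sol0]]] := exact_solution f1.
have [k hk] := pow2_small t eta0.
suff [x hx] : exists x, solves f x c (2 * s + t / 2 ^+ k)%R.
  by exists x, c; apply: solves_le hx; rewrite lerD2l.
elim: k {hk} => [|k [x IH]].
  exists x0; apply: solves_le sol0; rewrite expr0 divr1 lerDr; lra.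
have p0 : (0 <= 2 * s + t / 2 ^+ k)%R.
  by apply: addr_ge0; [exact: mulr_ge0|rewrite divr_ge0// exprn_ge0].
have [x' hx'] := hG f x c _ s f1 p0 IH Gs.
exists x'; apply: solves_le hx'; rewrite exprS invfM mulrA.
rewrite le_eqVlt; apply/orP; left; apply/eqP; field.
by rewrite expf_neq0.
Qed.

Definition delta f (j : ZN) : ZN -> X := fun i => if i == j then f j else 0%R.

Lemma nrm_delta f j i : nrm (delta f j) i = if i == j then nrm f j else 0.
Proof. by rewrite /delta /nrm; case: ifP => // _; rewrite rnorm0. Qed.

Lemma delta_lp1 f j : lp sc 1 (delta f j).
Proof.
apply/lp1E; rewrite /mass (@esum_dirac _ _ _ j) ?nrm_delta ?eqxx ?ltry//.
  by move=> i /negPf ij; rewrite nrm_delta ij.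
exact: nrm_ge0.
Qed.

Lemma lp_solvable (q : \bar R) f : exponent q -> lp sc q f ->
  exists2 x, lp sc q x & exists c, f = (wiener_op A x + lincomb b c)%R.
Proof.
move=> eq fq; have [G [G0 Gm hG]] := good_solution.
have [eta [eta0 etas]] := summable_weights R ZN.
have [D fD] := lp_bounded eq fq.
have D0 : (0 <= D)%R by apply: le_trans (fD 0%R); exact: rnorm_ge0.
have Gfin j : G j \is a fin_num.
  by rewrite ge0_fin_numE//; apply: le_lt_trans Gm; exact: le_term_esum.
pose s j : R := (fine (G j) * rnorm (f j))%R.
have s0 j : (0 <= s j)%R by rewrite mulr_ge0 ?fine_ge0// rnorm_ge0.
pose t j : R := (2 * s j + eta j)%R.
have t0 j : (0 <= t j)%R by apply: addr_ge0; [exact: mulr_ge0|exact: ltW].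
have hsol j : exists xc : (ZN -> X) * 'rV[K]_n, solves (delta f j) xc.1 xc.2 (t j).
  have [|x [c xc]] := hG (delta f j) (s j) (eta j) (delta_lp1 f j) (eta0 j).
    rewrite (@esum_dirac _ _ _ j).
    - by rewrite nrm_delta eqxx /s EFinM fineK.
    - by move=> i /negPf ij; rewrite nrm_delta ij mule0.
    - by rewrite mule_ge0 ?nrm_ge0.
  by exists (x, c).
have [xc {}hsol] := choice hsol.
pose x j := (xc j).1; pose c j := (xc j).2.
(* The total of the bounds [t j] is finite for merely bounded [f]: it is at most
   [2 * mass G * D + 2]. *)
pose Tt : \bar R := \esum_(j in [set: ZN]) (t j)%:E.
have Tt0 : 0 <= Tt by apply: esum_ge0 => j _; rewrite lee_fin.
have TtE : exists2 r : R, (0 <= r)%R & Tt = r%:E.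
  suff Ttf : Tt < +oo by exists (fine Tt); rewrite ?fine_ge0// fineK// ge0_fin_numE.
  apply: (@le_lt_trans _ _ (2%:E * (mass G * D%:E) + 2%:E)); last first.
    rewrite ltey_eq fin_numD !fin_numM// ge0_fin_numE ?Gm// mass_ge0//.
  rewrite /Tt (@eq_esum _ _ _ _ (fun j => 2%:E * (s j)%:E + (eta j)%:E)); last first.
    by move=> j _; rewrite -EFinM -EFinD.
  rewrite esumD; last 2 first.
  - by move=> j _; rewrite mule_ge0 ?lee_fin.
  - by move=> j _; rewrite lee_fin ltW.
  apply: leeD => //; rewrite esumZl ?lee_fin//; apply: lee_wpmul2l => //.
  rewrite -esumZr ?lee_fin//; apply: le_esum => j _.
  rewrite /s EFinM fineK//; apply: lee_wpmul2l => //.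
  by rewrite lee_fin.
have [r r0 rE] := TtE.
have jk0 k : 0 <= conv H (junk sc m b) k.
  by apply: conv_ge0 => // i; exact: junk_ge0.
(* Summing the pointwise bounds over the sites gives this common majorant: the single-site data add
   up to [f], the [t j] to [r]. It lies in l^q by Young's inequality. *)
pose g k := conv H (nrm f) k + r%:E * conv H (junk sc m b) k.
have g0 k : 0 <= g k.
  apply: adde_ge0; last by rewrite mule_ge0 ?lee_fin.
  by apply: conv_ge0 => // i; exact: nrm_ge0.
have xg k : \esum_(j in [set: ZN]) nrm (x j) k <= g k.
  apply: (@le_trans _ _ (\esum_(j in [set: ZN]) (conv H (nrm (delta f j)) k +
      (t j)%:E * conv H (junk sc m b) k))).
    by apply: le_esum => j _; apply: (solves_dom H0 dom k (t0 j) (hsol j)).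
  rewrite esumD; last 2 first.
  - by move=> j _; apply: conv_ge0 => // i; exact: nrm_ge0.
  - by move=> j _; rewrite mule_ge0 ?lee_fin.
  rewrite esumZr ?lee_fin// -/Tt rE; apply: leeD => //.
  rewrite -conv_esum//; last by move=> j i; exact: nrm_ge0.
  apply: le_conv => // i; first by apply: esum_ge0 => j _; exact: nrm_ge0.
  rewrite (@esum_dirac _ _ _ i) ?nrm_delta ?eqxx//; last exact: nrm_ge0.
  by move=> j ji; rewrite nrm_delta eq_sym (negPf ji).
have gq : lpmem q g.
  apply: (lpmemD eq).
  - by apply: conv_ge0 => // i; exact: nrm_ge0.
  - by move=> i; rewrite mule_ge0 ?lee_fin.
  - by apply: (lpmem_conv eq H0 (nrm_ge0 sc f) Hm); apply/lpE.
  - apply: (lpmemZ eq) => //; apply: (lpmem_conv eq H0 _ Hm).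
      by move=> i; exact: junk_ge0.
    apply: (lpmem_mass eq); first by move=> i; exact: junk_ge0.
    exact: mass_junk.
have [Dg Dg0 gD] := lpmem_bound eq g0 gq.
have xfin k : \esum_(j in [set: ZN]) nrm (x j) k < +oo.
  by apply: le_lt_trans (xg k) _; apply: le_lt_trans (gD k) (ltry _).
pose y k := usum (fun j => x j k).
have yg k : nrm y k <= g k.
  by apply: le_trans (xg k); apply: rnorm_usum; exact: xfin.
have yq : lp sc q y by apply/lpE; apply: (lpmem_le eq (nrm_ge0 sc y) yg gq).
have cfin i : \esum_(j in [set: ZN]) conv a (nrm (x j)) i < +oo.
  rewrite -conv_esum//; last by move=> j k; exact: nrm_ge0.
  apply: (@le_lt_trans _ _ (mass a * Dg%:E)).
    apply: conv_le_sup => // k; first by apply: esum_ge0 => j _; exact: nrm_ge0.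
    exact: le_trans (xg k) (gD k).
  by rewrite ltey_eq fin_numM// ge0_fin_numE ?mass_wmajor// mass_ge0.
have Ay i : wiener_op A y i = usum (fun j => wiener_op A (x j) i).
  by apply: op_usum => //; exact: xfin.
have x1 j : lp sc 1 (x j) by case: (hsol j).
have lb i : abssum sc (fun j => lincomb b (c j) i) <= r%:E * bmass sc b i.
  rewrite -rE /Tt -esumZr; [|exact: bmass_ge0|by move=> j; rewrite lee_fin].
  by apply: le_esum => j _; apply: nrm_lincomb; case: (hsol j).
have bm := mass_bmass b1.
have bmi i : bmass sc b i < +oo.
  by apply: le_lt_trans bm; apply: le_term_esum => j; exact: bmass_ge0.
have lfin i : abssum sc (fun j => lincomb b (c j) i) < +oo.
  apply: le_lt_trans (lb i) _; apply: lte_mul_pinfty => //.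
have Axfin i : abssum sc (fun j => wiener_op A (x j) i) < +oo.
  apply: le_lt_trans (cfin i); apply: le_esum => j _.
  exact/nrm_op/(lp_bounded e1).
have res i : (f i = wiener_op A y i + usum (fun j => lincomb b (c j) i))%R.
  rewrite Ay -(usumD (Axfin i) (lfin i)).
  transitivity (usum (fun j => delta f j i)); last first.
    by apply: eq_usum => j; case: (hsol j) => _ <-.
  rewrite (usum_fset sc (A := [fset i]%fset)); last first.
    by move=> j; rewrite inE eq_sym /delta => /negPf ->.
  by rewrite big_seq_fset1 /delta eqxx.
(* The [c j] are not summed in the scalar field: the sum of their combinations is a residual in l^1,
   and one more exact solution there supplies a single coefficient row. *)
have h1 : lp sc 1 (f - wiener_op A y)%R.
  apply/lp1E; apply: (@le_lt_trans _ _ (r%:E * mass (bmass sc b))).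
    rewrite /mass -esumZl ?lee_fin//; last by move=> i; exact: bmass_ge0.
    apply: le_esum => i _; apply: le_trans (lb i).
    rewrite /nrm -[(f - _)%R i]/(f i - wiener_op A y i)%R {1}res addrC addKr.
    exact: rnorm_usum.
  apply: lte_mul_pinfty => //.
have [x' [c' [t' _ [x'1 x'f _ _]]]] := exact_solution h1.
have x'q : lp sc q x' by exact: lp1_lp.
exists (y + x')%R; first exact: lpD.
exists c'; rewrite opD; [|exact: lp_bounded eq yq|exact: lp_bounded eq x'q].
by rewrite -addrA x'f addrC subrK.
Qed.

(** The same [b] represents a basis for every exponent. Two candidates differ by a combination of
    the [b j] that lies in l^1 and in the range on l^q, hence in the range on l^1 by [lp_rangeE],
    where only zero coefficients are possible. *)
Lemma quotient_dim_lp (q : \bar R) : exponent q ->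
  quotient_dim (lp sc q) (lp_range A q) n.
Proof.
move=> eq; exists b; first by move=> j; exact: lp1_lp.
move=> f fq; have [x xq [c fc]] := lp_solvable eq fq.
have key (d : 'rV[K]_n) : lp_range A q (f - \sum_(j < n) d ord0 j *: b j)%R -> d = c.
  move=> hd; have hc : lp_range A q (f - lincomb b c)%R.
    by exists x => //; rewrite fc addrK.
  have cd1 : lp sc 1 (lincomb b (d - c)%R) by apply: lincomb_lp => //; exact: e1.
  have rq : lp_range A q (lincomb b (d - c)%R).
    have -> : (lincomb b (d - c) = (f - lincomb b c) - (f - lincomb b d))%R.
      by rewrite lincombB opprB [RHS]addrC addrA subrK.
    exact: (subspaceB (subspace_range A eq) hc hd).
  have r1 : lp_range A 1 (lincomb b (d - c)%R).
    apply/(lp_rangeE H0 Hm dom _ e1); split => //.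
    by have /(lp_rangeE H0 Hm dom _ eq)[] := rq.
  have [d' [_ dU]] := b_basis cd1.
  have dd : d' = (d - c)%R.
    by apply: dU; rewrite -/(lincomb b (d - c)%R) subrr; exact: (subspace_range A e1).1.
  apply/eqP; rewrite -subr_eq0 -dd; apply/eqP; apply: dU.
  by rewrite -/(lincomb b 0) lincomb0 subr0.
exists c; split; first by exists x => //; rewrite fc addrK.
by move=> d /key.
Qed.

End Solution.

Lemma fredholm_all (R : realType) (K : numFieldType) (sc : scalars R K)
    (N : nat) (X : completeNormedModType K) (A : wiener sc N X) (p : \bar R) :
  exponent p -> fredholm A p -> exists k n, forall q, exponent q ->
    quotient_dim (lp_ker A q) [set 0] k /\ quotient_dim (lp sc q) (lp_range A q) n.
Proof.
move=> ep fp; have [H [m [H0 Hm dom]]] := fredholm_domination ep fp.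
have [[k hk] [n [b b1 b_basis]]] := fredholm_lp1 H0 Hm dom ep fp.
exists k, n => q eq; split; last exact: (quotient_dim_lp H0 Hm dom b1 b_basis eq).
by rewrite (lp_ker_oo H0 Hm dom eq) -(lp_ker_oo H0 Hm dom (exponent_1 R)).
Qed.

Theorem theorem3 (R : realType) (K : numFieldType) (sc : scalars R K)
    (N : nat) (X : completeNormedModType K) (A : wiener sc N X) :
  ((exists p : \bar R, exponent p /\ fredholm A p) <->
   (forall p : \bar R, exponent p -> fredholm A p)) /\
  ((exists p : \bar R, exponent p /\ fredholm A p) ->
   forall p q : \bar R, exponent p -> exponent q ->
     fredholm_index A p = fredholm_index A q).
Proof.
split.
  split => [[p [ep fp]] q eq|h].
    by have [k [n /(_ q eq)[hk hn]]] := fredholm_all ep fp; split; [exists k|exists n].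
  by exists 1%E; split; [exact: exponent_1|apply: h; exact: exponent_1].
move=> [p0 [ep0 /(fredholm_all ep0)[k [n h]]]] p q ep eq.
have indexE r : exponent r -> fredholm_index A r = k%:Z - n%:Z.
  move=> er; have [hk hn] := h r er; rewrite /fredholm_index.
  rewrite (dimqE (subspace_ker A er) (@subspace_set0 _ _ _) hk).
  by rewrite (dimqE (@subspace_lp _ _ sc N X _ er) (subspace_range A er) hn).
by rewrite !indexE.
Qed.
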